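(* Let $\varepsilon\in(0,1)$ be a small parameter and consider the equation of motion of a charged particle \[ \ddot x = \dot x\times B(x) + E(x),\qquad x(t)\in\mathbb R^3, \] where $B(x)=\nabla\times A(x)$ for a vector potential $A$, $E(x)=-\nabla\phi(x)$ for a scalar potential $\phi:\mathbb R^3\to\mathbb R$ that is bounded from below, and \[ B(x)=\frac1\varepsilon B_1(x) \] with $B_1$ smooth, independent of $\varepsilon$, and $|B_1(x)|\ge 1$ for all $x$. Let the initial values satisfy $|x(0)|\le M_0$ and $|\dot x(0)|\le M_1$ with constants $M_0,M_1$ independent of $\varepsilon$, and let $T>0$ be fixed independently of $\varepsilon$. Apply the modified Boris method with step size $h$: with $\mu^0=\mu(x(0),\dot x(0))$, it computes $x^n\approx x(nh)$ via \[ \frac{x^{n+1}-2x^n+x^{n-1}}{h^2}=v^n\times B(x^n)+E(x^n)-\mu^0\,\nabla|B|(x^n),\qquad v^n=\frac{x^{n+1}-x^{n-1}}{2h}, \] started from the modified initial values $x^0=x(0)$, $v^0=P_\parallel(x^0)\dot x(0)$ (equivalently, $x^1=x^0+hv^0+\tfrac{h^2}{2}\bigl(v^0\times B(x^0)+E(x^0)-\mu^0\nabla|B|(x^0)\bigr)$). Assume the step size satisfies $c_*\varepsilon\le h^2\le C_*\varepsilon$ for some positive constants $c_*,C_*$, and assume the following nondegeneracy condition: for all $(x,v)=(x^n,v^n)$ along the numerical trajectory, the linear maps \[ L_{x,v}:P_\perp(x)\mathbb R^3\to P_\perp(x)\mathbb R^3,\qquad z\mapsto z+\tfrac14 h^2\,P_\perp(x)\bigl(v\times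 B'(x)z\bigr) \] are invertible with inverse bounded independently of $(x,v)$ and of $h,\varepsilon$ with $h^2/\varepsilon\le C_*$. Then for all $n$ with $t_n=nh\le T$, \[ |x^n-x(t_n)|\le Ch^2,\qquad |v^n_\parallel-v_\parallel(t_n)|\le Ch^2,\qquad |v^n_\perp|\le Ch^2, \] where $v^n_\parallel=P_\parallel(x^n)v^n$, $v^n_\perp=P_\perp(x^n)v^n$, $v_\parallel(t)=P_\parallel(x(t))\dot x(t)$, and $C$ is independent of $\varepsilon$, $h$ and $n$ (but depends on $T$, on bounds of derivatives of $B_1$ and $E$, and on $c_*$ and $C_*$).
   Context: $|\cdot|$ is the Euclidean norm. The magnetic moment is $\mu(x,v)=\frac12\frac{|v\times B(x)|^2}{|B(x)|^3}$. For $x\in\mathbb R^3$, $P_\parallel(x)$ denotes the orthogonal projection onto the span of $B(x)$, and $P_\perp(x)=I-P_\parallel(x)$. $B'(x)$ denotes the Jacobian matrix of $B$ at $x$, and $\nabla|B|$ is the gradient of the function $x\mapsto|B(x)|$. *)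

(* Defs.v *)
From HB Require Import structures.
From mathcomp Require Import all_boot all_order all_algebra.
From mathcomp Require Import all_classical all_reals all_analysis.
Set Implicit Arguments. Unset Strict Implicit. Unset Printing Implicit Defensive.
Import Order.TTheory GRing.Theory Num.Theory.
Import numFieldNormedType.Exports.
Local Open Scope ring_scope.

Definition c0 : 'I_3 := @Ordinal 3 0 isT.
Definition c1 : 'I_3 := @Ordinal 3 1 isT.
Definition c2 : 'I_3 := @Ordinal 3 2 isT.

Section Vec.
Variable R : realType.
Notation V := 'rV[R]_3.

Definition comp (u : V) (i : 'I_3) : R := u ord0 i.

Definition e3 (i : 'I_3) : V := delta_mx ord0 i.

Definition dot (u v : V) : R := \sum_(j < 3) comp u j * comp v j.
Definition enorm (u : V) : R := Num.sqrt (dot u u).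

Definition cross (u v : V) : V :=
  \row_(j < 3)
    (if j == c0 then comp u c1 * comp v c2 - comp u c2 * comp v c1
     else if j == c1 then comp u c2 * comp v c0 - comp u c0 * comp v c2
     else comp u c0 * comp v c1 - comp u c1 * comp v c0).

Definition grad (f : V -> R) (x : V) : V := \row_(i < 3) ('d f x (e3 i)).

Definition pd (A : V -> V) (x : V) (i j : 'I_3) : R := comp ('d A x (e3 i)) j.
Definition curl (A : V -> V) (x : V) : V :=
  \row_(j < 3)
    (if j == c0 then pd A x c1 c2 - pd A x c2 c1
     else if j == c1 then pd A x c2 c0 - pd A x c0 c2
     else pd A x c0 c1 - pd A x c1 c0).

Fixpoint iterD (W : normedModType R) (f : V -> W) (vs : seq V) : V -> W :=
  match vs with
  | [::] => f
  | v :: vs' => fun x => derive (iterD f vs') x v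
  end.

Definition smooth (W : normedModType R) (f : V -> W) : Prop :=
  forall (vs : seq V) (x : V), differentiable (iterD f vs) x.

Definition magmom (B : V -> V) (x v : V) : R :=
  2^-1 * (enorm (cross v (B x)) ^+ 2 / enorm (B x) ^+ 3).

Definition Ppar (B : V -> V) (x w : V) : V :=
  (dot w (B x) / dot (B x) (B x)) *: B x.
Definition Pperp (B : V -> V) (x w : V) : V := w - Ppar B x w.

Definition normB (B : V -> V) : V -> R := fun x => enorm (B x).

Definition Lmap (h : R) (B : V -> V) (x v z : V) : V :=
  z + (h ^+ 2 / 4) *: Pperp B x (cross v ('d B x z)).

Definition Linv_bounded (K h : R) (B : V -> V) (x v : V) : Prop :=
  exists g : V -> V, forall z : V, Pperp B x z = z ->
    [/\ Pperp B x (g z) = g z, g (Lmap h B x v z) = z,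
        Lmap h B x v (g z) = z & enorm (g z) <= K * enorm z].

Definition numv (h : R) (v0 : V) (xs : nat -> V) (n : nat) : V :=
  if n is n'.+1 then (2 * h)^-1 *: (xs n'.+2 - xs n') else v0.

End Vec.

(* Main.v *)
Require Import Defs.
From HB Require Import structures.
From mathcomp Require Import all_boot all_order all_algebra.
From mathcomp Require Import ring lra.
From mathcomp Require Import all_classical all_reals all_analysis.
Set Implicit Arguments. Unset Strict Implicit. Unset Printing Implicit Defensive.
Import Order.TTheory GRing.Theory Num.Theory.
Import numFieldNormedType.Exports.
Local Open Scope ring_scope.

(** Write [b = B1 / |B1|], [rho = |B1|] and let [u] be the component of the
velocity along [b].  Both the particle and the scheme are compared with the
guiding-centre system [x' = u b(x)], [u' = b . (E - m grad rho)(x)], where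
[m = |v x b|^2 / (2 rho)] at time 0, so that the magnetic moment is [eps m].

Exact motion.  Energy conservation bounds the velocity.  The perpendicular
velocity and the traceless part of its tensor square are, up to [O(eps)],
derivatives of quantities of size [O(eps)].  Since [div B1 = 0], the remaining
average of [v . b'(x) v] is [- m b . grad rho], and [m] is conserved up to
[O(eps)].  Subtracting those small quantities from [x] and [u] gives [X], [U]
that satisfy the guiding-centre system with defect [O(eps) = O(h^2)], hence its
two-step midpoint rule with defect [O(h^3)].

Scheme.  With [kappa = h^2 / eps] put [omega_n = kappa rho v_n x b].  The update
is [x_{n+1} = x_n + h v_n + a_n / 2], [2 h (v_{n+1} - v_n) = a_{n+1} + a_n] with
[a_n = omega_n + h^2 G_n].  Hence [omega_{n+1}] is roughly [- omega_n], and over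
two steps [omega_{n+2} - omega_n = O(h (|omega_n| + |omega_{n+1}| + h^2))].  As
[omega_0 = 0], a Gronwall argument gives [omega_n = O(h^2)], that is,
perpendicular velocity [O(h^2)]; then [x_n], [u_n] satisfy the same two-step
midpoint rule with defect [O(h^3)], and a second Gronwall argument bounds their
distance to [X], [U].  The a priori bounds used are closed by induction on [n]
for [h] below a threshold; above it only boundedly many steps occur. *)

(** * Uniform bounds and functions of class C^k along curves *)

(** The obstacle is uniformity in [eps]. The acceleration is of size [1/eps] and a step
    [h ~ sqrt eps] does not resolve the gyration, so Taylor expansion of the exact motion over one
    step is useless. The comparison system is chosen because its right-hand side is free of [eps]:
    the moment is [eps m] and [grad |B| = grad rho / eps], so the mirror force [m grad rho] has size
    1. For the scheme, the constant in the one-step bound on [omega] is not [1 + O(h)] and cannot be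
    iterated [T/h] times; the factor [h] is gained only between steps [n] and [n+2]. Hence every
    recursion is two-step and needs two starting values; the second comes from a forward step, which
    may be one order less accurate because it is taken once. All constants depend on the radius [r]
    of the a priori bounds, and the threshold on [h] depends on those constants. To avoid a circle,
    [r] is fixed first, from the exact motion and with a margin, and each estimate assumes bounds up
    to step [n] and concludes up to [n+1]. *)

Inductive ix := X0 | X1 | X2.

Definition sum3 (R : realType) (f : ix -> R) : R := f X0 + f X1 + f X2.

Definition dot3 (R : realType) (a b : ix -> R) : R := sum3 (fun i => a i * b i).

Definition cross3 (R : realType) (a b : ix -> R) (i : ix) : R :=
  match i with
  | X0 => a X1 * b X2 - a X2 * b X1
  | X1 => a X2 * b X0 - a X0 * b X2
  | X2 => a X0 * b X1 - a X1 * b X0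
  end.

Section UniformBounds.
Variables (R : realType) (A J : Type).
Implicit Types (P : A -> J -> Prop) (f g : A -> J -> R).

(** The index [a] is a whole problem instance (a trajectory or a run of the scheme, with its own
    [eps] and [h]) and [j] a time or a step number. The constant is chosen before both: this is the
    independence of [eps], [h] and [n] in the theorem. *)
Definition bO P g f :=
  exists2 C : R, 0 <= C & forall a j, P a j -> `|f a j| <= C * g a j.

Lemma bO_eq P g f f' :
  (forall a j, P a j -> f a j = f' a j) -> bO P g f' -> bO P g f.
Proof.
by move=> e [C C0 H]; exists C => // a j p; rewrite e//; exact: H.
Qed.

Lemma bO_sub P P' g f :
  (forall a j, P' a j -> P a j) -> bO P g f -> bO P' g f.
Proof. by move=> s [C C0 H]; exists C => // a j p; apply: H; exact: s. Qed.

Lemma bO_refl P g : (forall a j, P a j -> 0 <= g a j) -> bO P g g.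
Proof. by move=> g0; exists 1 => // a j p; rewrite mul1r ger0_norm ?g0. Qed.

Lemma bO_trans P g1 g f : bO P g1 f -> bO P g g1 -> bO P g f.
Proof.
move=> [C C0 H] [D D0 K]; exists (C * D) => [|a j p]; first exact: mulr_ge0.
apply: (le_trans (H _ _ p)); rewrite -mulrA ler_wpM2l//.
by apply: (le_trans (ler_norm _)); exact: K.
Qed.

Lemma bO_cst P (c : R) : bO P (fun _ _ => 1) (fun _ _ => c).
Proof. by exists `|c| => // a j _; rewrite mulr1. Qed.

Lemma bOD P g f1 f2 :
  bO P g f1 -> bO P g f2 -> bO P g (fun a j => f1 a j + f2 a j).
Proof.
move=> [C C0 H] [D D0 K]; exists (C + D) => [|a j p]; first exact: addr_ge0.
by apply: (le_trans (ler_normD _ _)); rewrite mulrDl lerD ?H ?K.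
Qed.

Lemma bON P g f : bO P g f -> bO P g (fun a j => - f a j).
Proof. by move=> [C C0 H]; exists C => // a j p; rewrite normrN H. Qed.

Lemma bOB P g f1 f2 :
  bO P g f1 -> bO P g f2 -> bO P g (fun a j => f1 a j - f2 a j).
Proof. by move=> h1 h2; apply: bOD => //; exact: bON. Qed.

Lemma bOM P g1 g2 f1 f2 :
  bO P g1 f1 -> bO P g2 f2 ->
  bO P (fun a j => g1 a j * g2 a j) (fun a j => f1 a j * f2 a j).
Proof.
move=> [C C0 H] [D D0 K]; exists (C * D) => [|a j p]; first exact: mulr_ge0.
by rewrite normrM mulrACA ler_pM// ?H ?K.
Qed.

Lemma bOMl P g f1 f2 :
  bO P (fun _ _ => 1) f1 -> bO P g f2 -> bO P g (fun a j => f1 a j * f2 a j).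
Proof.
move=> h1 h2; have [C C0 H] := bOM h1 h2; exists C => // a j p.
by have := H _ _ p; rewrite mul1r.
Qed.

Lemma bOMr P g f1 f2 :
  bO P g f1 -> bO P (fun _ _ => 1) f2 -> bO P g (fun a j => f1 a j * f2 a j).
Proof.
move=> h1 h2; apply: (bO_eq (f' := fun a j => f2 a j * f1 a j)).
  by move=> a j _; rewrite mulrC.
exact: bOMl.
Qed.

Lemma bO_abs P g f : bO P g f -> bO P g (fun a j => `|f a j|).
Proof. by move=> [C C0 H]; exists C => // a j p; rewrite normr_id H. Qed.

Lemma bO_sum3 P g (f : ix -> A -> J -> R) :
  (forall i, bO P g (f i)) -> bO P g (fun a j => sum3 (fun i => f i a j)).
Proof. by move=> H; exact: (bOD (bOD (H X0) (H X1)) (H X2)). Qed.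

Lemma bO_cross3 P g (f1 f2 : A -> J -> ix -> R) (i : ix) :
  (forall i, bO P (fun _ _ => 1) (fun a j => f1 a j i)) ->
  (forall i, bO P g (fun a j => f2 a j i)) ->
  bO P g (fun a j => cross3 (f1 a j) (f2 a j) i).
Proof. by move=> h1 h2; case: i; apply: bOB; exact: bOMl. Qed.

End UniformBounds.

Section Regularity.
Variable R : realType.
Notation V3 := (ix -> R).
Implicit Types (f : V3 -> R) (x y : V3) (r : R).

Definition inbox r x := forall i, `|x i| <= r.

Definition locbd f := forall r, exists C : R, forall x, inbox r x -> `|f x| <= C.

Definition dist1 x y := sum3 (fun i => `|x i - y i|).

Definition loclip f := forall r, exists2 C : R, 0 <= C &
  forall x y, inbox r x -> inbox r y -> `|f x - f y| <= C * dist1 x y.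

(* second-difference bound enjoyed by functions with Lipschitz gradient *)
Definition locsym f := forall r, exists2 C : R, 0 <= C &
  forall x y z, inbox r x -> inbox r y -> inbox r z ->
  `|f y + f z - 2 * f x| <=
   C * (sum3 (fun i => `|y i + z i - 2 * x i|) + dist1 y x ^+ 2 + dist1 z x ^+ 2).

(** The chain rule along curves serves as definition of the gradient: it is the form in which
    gradients are used, it passes to sums, products, inverses and roots, and it asks for no norm on
    [ix -> R]. *)
Definition hasgrad f (g : ix -> V3 -> R) :=
  forall (x : R -> V3) (dx : V3) (t : R),
    (forall i, is_derive t (1 : R) (fun s => x s i) (dx i)) ->
    is_derive t (1 : R) (fun s => f (x s)) (sum3 (fun i => g i (x t) * dx i)).

(** Level 0 asks for local boundedness only. Level 1 then yields local Lipschitz bounds, and level 2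
    the second-difference bounds of [locsym]. *)
Fixpoint CC (k : nat) f : Prop :=
  locbd f /\
  if k is k'.+1 then
    exists2 g : ix -> V3 -> R, hasgrad f g & forall i, CC k' (g i)
  else True.

Lemma CC_locbd k f : CC k f -> locbd f. Proof. by case: k => [|k] []. Qed.

Lemma CC_S k f : CC k.+1 f -> CC k f.
Proof.
elim: k f => [|k IH] f; first by case.
move=> [fb [g fg Cg]]; split => //; exists g => // i; exact/IH/Cg.
Qed.

Lemma locbd_cst c : locbd (fun=> c).
Proof. by move=> r; exists `|c|. Qed.

Lemma locbdD f1 f2 : locbd f1 -> locbd f2 -> locbd (fun x => f1 x + f2 x).
Proof.
move=> h1 h2 r; have [C1 H1] := h1 r; have [C2 H2] := h2 r.
exists (C1 + C2) => x hx; apply: (le_trans (ler_normD _ _)).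
by rewrite lerD ?H1 ?H2.
Qed.

Lemma locbdM f1 f2 : locbd f1 -> locbd f2 -> locbd (fun x => f1 x * f2 x).
Proof.
move=> h1 h2 r; have [C1 H1] := h1 r; have [C2 H2] := h2 r.
by exists (C1 * C2) => x hx; rewrite normrM ler_pM ?H1 ?H2.
Qed.

Lemma hasgradD f1 f2 g1 g2 : hasgrad f1 g1 -> hasgrad f2 g2 ->
  hasgrad (fun x => f1 x + f2 x) (fun i x => g1 i x + g2 i x).
Proof.
move=> h1 h2 x dx t d.
apply: is_derive_eq; first exact: (is_deriveD (h1 _ _ _ d) (h2 _ _ _ d)).
rewrite /sum3; ring.
Qed.

Lemma hasgradM f1 f2 g1 g2 : hasgrad f1 g1 -> hasgrad f2 g2 ->
  hasgrad (fun x => f1 x * f2 x) (fun i x => f1 x * g2 i x + f2 x * g1 i x).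
Proof.
move=> h1 h2 x dx t d.
apply: is_derive_eq; first exact: (is_deriveM (h1 _ _ _ d) (h2 _ _ _ d)).
rewrite /sum3 /GRing.scale/=; ring.
Qed.

Lemma hasgrad_cst c : hasgrad (fun=> c) (fun _ _ => 0).
Proof.
move=> x dx t d; rewrite /sum3 !mul0r !addr0; exact: (is_derive_cst (c : R^o) t 1).
Qed.

Lemma CC_cst k c : CC k (fun=> c).
Proof.
elim: k c => [|k IH] c /=; split=> //; try exact: locbd_cst.
by exists (fun _ _ => 0) => //; exact: hasgrad_cst.
Qed.

Lemma CCD k f1 f2 : CC k f1 -> CC k f2 -> CC k (fun x => f1 x + f2 x).
Proof.
elim: k f1 f2 => [|k IH] f1 f2 [b1 h1] [b2 h2].
  by split=> //; exact: locbdD.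
have [g1 d1 c1] := h1; have [g2 d2 c2] := h2.
split; first exact: locbdD.
exists (fun i x => g1 i x + g2 i x); first exact: hasgradD.
by move=> i; exact: (IH _ _ (c1 i) (c2 i)).
Qed.

Lemma CCM k f1 f2 : CC k f1 -> CC k f2 -> CC k (fun x => f1 x * f2 x).
Proof.
elim: k f1 f2 => [|k IH] f1 f2 H1 H2.
  by case: H1 => b1 _; case: H2 => b2 _; split=> //; exact: locbdM.
have [b1 [g1 d1 c1]] := H1; have [b2 [g2 d2 c2]] := H2.
split; first exact: locbdM.
exists (fun i x => f1 x * g2 i x + f2 x * g1 i x); first exact: hasgradM.
move=> i; apply: CCD; first exact: (IH _ _ (CC_S H1) (c2 i)).
exact: (IH _ _ (CC_S H2) (c1 i)).
Qed.

Lemma CC_sum3 k (f : ix -> V3 -> R) :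
  (forall i, CC k (f i)) -> CC k (fun x => sum3 (fun i => f i x)).
Proof. by move=> H; exact: (CCD (CCD (H X0) (H X1)) (H X2)). Qed.

Lemma hasgradV f g : (forall x, 1 <= f x) -> hasgrad f g ->
  hasgrad (fun x => (f x)^-1) (fun i x => - (f x)^-1 * (f x)^-1 * g i x).
Proof.
move=> f1 h x dx t d.
have f0 : f (x t) != 0 by rewrite gt_eqF// (lt_le_trans ltr01).
apply: is_derive_eq; first exact: (is_deriveV (f := fun s => f (x s)) f0 (h _ _ _ d)).
rewrite /sum3 /GRing.scale/= -exprVn; ring.
Qed.

(** The gradient of [1/f] is a product of [g] with powers of [1/f], which are needed one level lower
    only, so the induction on [k] closes. *)
Lemma CCV k f : (forall x, 1 <= f x) -> CC k f -> CC k (fun x => (f x)^-1).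
Proof.
move=> f1.
have bV : locbd (fun x => (f x)^-1).
  move=> r; exists 1 => x _; have f0 := lt_le_trans ltr01 (f1 x).
  by rewrite ger0_norm ?invf_le1 ?invr_ge0 ?(ltW f0).
elim: k => [|k IH] // H; split=> //.
have [_ [g d c]] := H.
exists (fun i x => - (f x)^-1 * (f x)^-1 * g i x); first exact: hasgradV.
have e i : (fun x => - (f x)^-1 * (f x)^-1 * g i x) =
   (fun x => -1 * (((f x)^-1 * (f x)^-1) * g i x)).
  by apply/funext => x; ring.
move=> i; rewrite e; apply: CCM; first exact: CC_cst.
have Vk := IH (CC_S H); exact: (CCM (CCM Vk Vk) (c i)).
Qed.

Lemma hasgrad_sqrt f g : (forall x, 1 <= f x) -> hasgrad f g ->
  hasgrad (fun x => Num.sqrt (f x))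
          (fun i x => 2^-1 * (Num.sqrt (f x))^-1 * g i x).
Proof.
move=> f1 h x dx t d.
have f0 : 0 < f (x t) by rewrite (lt_le_trans ltr01).
apply: is_derive_eq.
  exact: (is_derive1_comp (f := Num.sqrt) (g := fun s => f (x s))
    (is_derive1_sqrt f0) (h _ _ _ d)).
rewrite /sum3 /GRing.scale/= invfM; ring.
Qed.

Lemma CC_sqrt k f : (forall x, 1 <= f x) -> CC k f ->
  CC k (fun x => Num.sqrt (f x)).
Proof.
move=> f1.
have s1 x : 1 <= Num.sqrt (f x) by rewrite -[1]sqrtr1 ler_wsqrtr.
elim: k => [|k IH] H.
all: have bS : locbd (fun x => Num.sqrt (f x)).
(* Since [f >= 1], the root is at most [f], and a bound for [f] also bounds its root. *)
1,3: move=> r; have [C HC] := CC_locbd H r; exists C => x /HC;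
     rewrite !ger0_norm ?sqrtr_ge0// ?(le_trans ler01)//; apply: le_trans;
     rewrite -{2}(@sqr_sqrtr _ (f x)) ?(le_trans ler01)// expr2 ler_peMl// sqrtr_ge0.
  by split.
split=> //; have [_ [g d c]] := H.
exists (fun i x => 2^-1 * (Num.sqrt (f x))^-1 * g i x); first exact: hasgrad_sqrt.
move=> i; apply: CCM; last exact: c.
apply: CCM; first exact: CC_cst.
by apply: CCV => //; exact: (IH (CC_S H)).
Qed.

(** No integral occurs in the development: every passage from a small derivative to a small
    increment goes through this bound. *)
Lemma mean_value_bound (F F' : R -> R) (a b C : R) : a <= b ->
  (forall s, a <= s <= b -> is_derive s (1 : R) F (F' s)) ->
  (forall s, a <= s <= b -> `|F' s| <= C) ->
  `|F b - F a| <= C * (b - a).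
Proof.
move=> ab d B.
have [x xab||c] := @MVT_segment R F F' a b ab; last first.
- rewrite in_itv/= => cab ->; rewrite normrM.
  by rewrite (ger0_norm (_ : 0 <= b - a)) ?subr_ge0// ler_wpM2r ?subr_ge0// B.
- apply: derivable_within_continuous => s; rewrite in_itv/= => sab.
  by have [] := d _ sab.
by apply: d; move: xab; rewrite in_itv/= => /andP[/ltW -> /ltW ->].
Qed.

Lemma is_derive_affine (a b t : R) :
  is_derive t (1 : R) (fun s => a + s * b) b.
Proof.
have h : is_derive t (1 : R) (cst a + (fun s : R => s) * cst b : R -> R)
   (0 + (t *: 0 + b *: 1)).
  exact: is_deriveD.
by apply: is_derive_eq; rewrite scaler0 !add0r /GRing.scale/= mulr1.
Qed.

Lemma inbox_seg r x y s : 0 <= s <= 1 -> inbox r x -> inbox r y ->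
  inbox r (fun i => x i + s * (y i - x i)).
Proof.
move=> /andP[s0 s1] hx hy i.
have -> : x i + s * (y i - x i) = (1 - s) * x i + s * y i by ring.
apply: (le_trans (ler_normD _ _)); rewrite !normrM (ger0_norm s0).
rewrite ger0_norm ?subr_ge0//.
have -> : r = (1 - s) * r + s * r by ring.
by rewrite lerD// ler_wpM2l// ?subr_ge0.
Qed.

Lemma ge0_dist1 x y : 0 <= dist1 x y.
Proof. by rewrite /dist1 /sum3 !addr_ge0. Qed.

Lemma norm_sum3 (f : V3) : `|sum3 f| <= sum3 (fun i => `|f i|).
Proof.
by rewrite /sum3; apply: (le_trans (ler_normD _ _)); rewrite lerD// ler_normD.
Qed.

Lemma sum3_le (f g : V3) : (forall i, f i <= g i) -> sum3 f <= sum3 g.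
Proof. by move=> H; rewrite /sum3 !lerD. Qed.

Lemma sum3_mull c (f : V3) : sum3 (fun i => c * f i) = c * sum3 f.
Proof. rewrite /sum3; ring. Qed.

Lemma locbd_ix (g : ix -> V3 -> R) : (forall i, locbd (g i)) ->
  forall r, exists2 C : R, 0 <= C & forall i x, inbox r x -> `|g i x| <= C.
Proof.
move=> H r; have [C0 H0] := H X0 r; have [C1 H1] := H X1 r.
have [C2 H2] := H X2 r.
exists (`|C0| + `|C1| + `|C2|); first by rewrite !addr_ge0.
move=> i x hx.
have e0 := le_trans (H0 x hx) (ler_norm C0).
have e1 := le_trans (H1 x hx) (ler_norm C1).
have e2 := le_trans (H2 x hx) (ler_norm C2).
have := normr_ge0 C0; have := normr_ge0 C1; have := normr_ge0 C2.
by case: i; lra.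
Qed.

Lemma hasgrad_seg f g x y s : hasgrad f g ->
  is_derive s (1 : R) (fun s => f (fun i => x i + s * (y i - x i)))
    (sum3 (fun i => g i (fun i => x i + s * (y i - x i)) * (y i - x i))).
Proof.
move=> h; apply: (h (fun s i => x i + s * (y i - x i)) (fun i => y i - x i) s).
by move=> i; exact: is_derive_affine.
Qed.

Lemma seg0 x y : (fun i => x i + 0 * (y i - x i)) = x.
Proof. by apply/funext => i; rewrite mul0r addr0. Qed.

Lemma seg1 x y : (fun i => x i + 1 * (y i - x i)) = y.
Proof. by apply/funext => i; rewrite mul1r addrC subrK. Qed.

Lemma CC_loclip f : CC 1 f -> loclip f.
Proof.
move=> [_ [g d c]] r.
have [C C0 HC] := locbd_ix (fun i => CC_locbd (k := 0) (c i)) r.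
exists C => // x y hx hy.
pose F s := f (fun i => y i + s * (x i - y i)).
have := @mean_value_bound F
  (fun s => sum3 (fun i => g i (fun i => y i + s * (x i - y i)) * (x i - y i)))
  0 1 (C * dist1 x y) ler01.
rewrite subr0 mulr1 /F seg0 seg1; apply.
  by move=> s _; exact: hasgrad_seg.
move=> s s01; apply: (le_trans (norm_sum3 _)).
rewrite /dist1 -sum3_mull; apply: sum3_le => i.
by rewrite normrM ler_wpM2r// HC//; exact: inbox_seg.
Qed.

Lemma loclip_ix (g : ix -> V3 -> R) : (forall i, loclip (g i)) ->
  forall r, exists2 C : R, 0 <= C & forall i x y, inbox r x -> inbox r y ->
    `|g i x - g i y| <= C * dist1 x y.
Proof.
move=> H r; have [C0 p0 H0] := H X0 r; have [C1 p1 H1] := H X1 r.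
have [C2 p2 H2] := H X2 r.
exists (C0 + C1 + C2); first by rewrite !addr_ge0.
move=> i x y hx hy; have d0 := ge0_dist1 x y.
rewrite !mulrDl.
have := mulr_ge0 p0 d0; have := mulr_ge0 p1 d0; have := mulr_ge0 p2 d0.
have := H0 x y hx hy; have := H1 x y hx hy; have := H2 x y hx hy.
by case: i; lra.
Qed.

Lemma taylor1 f g : hasgrad f g -> (forall i, CC 1 (g i)) ->
  forall r, exists2 C : R, 0 <= C & forall x y, inbox r x -> inbox r y ->
    `|f y - f x - sum3 (fun i => g i x * (y i - x i))| <= C * dist1 y x ^+ 2.
Proof.
move=> d c r.
have [C C0 HC] := loclip_ix (fun i => CC_loclip (c i)) r.
exists C => // x y hx hy.
(* Along the segment, subtracting the linear part leaves a derivative made of gradient differences,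
   of size [dist1 y x ^+ 2]. The summand 0 matches the shape of [is_derive_affine]. *)
pose F s := f (fun i => x i + s * (y i - x i)) -
  (0 + s * sum3 (fun i => g i x * (y i - x i))).
have := @mean_value_bound F
  (fun s => sum3 (fun i => g i (fun i => x i + s * (y i - x i)) * (y i - x i))
    - sum3 (fun i => g i x * (y i - x i)))
  0 1 (C * dist1 y x ^+ 2) ler01.
rewrite subr0 mulr1 /F seg0 seg1.
have -> : f y - (0 + 1 * sum3 (fun i => g i x * (y i - x i))) -
  (f x - (0 + 0 * sum3 (fun i => g i x * (y i - x i)))) =
  f y - f x - sum3 (fun i => g i x * (y i - x i)) by ring.
apply.
  move=> s _; apply: (is_deriveB (f := fun s => f _)); first exact: hasgrad_seg.
  exact: is_derive_affine.
move=> s s01; set z := fun i => x i + s * (y i - x i).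
have zin : inbox r z by exact: inbox_seg.
have -> : sum3 (fun i => g i z * (y i - x i)) - sum3 (fun i => g i x * (y i - x i))
  = sum3 (fun i => (g i z - g i x) * (y i - x i)) by rewrite /sum3; ring.
apply: (le_trans (norm_sum3 _)).
rewrite expr2 mulrA [X in _ <= _ * X]/dist1 -sum3_mull; apply: sum3_le => i.
rewrite normrM ler_wpM2r//; apply: (le_trans (HC i _ _ zin hx)).
rewrite ler_wpM2l// /dist1; apply: sum3_le => j.
rewrite /z addrC addKr normrM; case/andP: s01 => s0 s1.
by rewrite (ger0_norm s0) ler_piMl.
Qed.

(** The second difference is the sum of two first-order Taylor remainders at [x] and of the gradient
    applied to [y + z - 2 x]. *)
Lemma CC_locsym f : CC 2 f -> locsym f.
Proof.
move=> [_ [g d c]] r.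
have [C C0 HC] := taylor1 d c r.
have [D D0 HD] := locbd_ix (fun i => CC_locbd (k := 1) (c i)) r.
exists (C + D); first exact: addr_ge0.
move=> x y z hx hy hz.
have h1 := HC x y hx hy; have h2 := HC x z hx hz.
set S := sum3 _.
have h3 : `|sum3 (fun i => g i x * (y i + z i - 2 * x i))| <= D * S.
  apply: (le_trans (norm_sum3 _)); rewrite -sum3_mull; apply: sum3_le => i.
  by rewrite normrM ler_wpM2r// HD.
have -> : f y + f z - 2 * f x =
  (f y - f x - sum3 (fun i => g i x * (y i - x i))) +
  (f z - f x - sum3 (fun i => g i x * (z i - x i))) +
  sum3 (fun i => g i x * (y i + z i - 2 * x i)) by rewrite /sum3; ring.
apply: (le_trans (ler_normD _ _)); apply: (le_trans (lerD (ler_normD _ _) h3)).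
have S0 : 0 <= S by rewrite /S /sum3 !addr_ge0.
have := mulr_ge0 C0 S0.
have := mulr_ge0 D0 (sqr_ge0 (dist1 y x)).
have := mulr_ge0 D0 (sqr_ge0 (dist1 z x)).
by move: h1 h2; rewrite !mulrDl !mulrDr; lra.
Qed.

End Regularity.

Section UniformBoundsComposition.
Variables (R : realType) (A J : Type) (P : A -> J -> Prop).
Notation V3 := (ix -> R).
Implicit Types (f : V3 -> R) (x y z : A -> J -> V3) (g : A -> J -> R).
Notation one := (fun (_ : A) (_ : J) => 1 : R).
Notation bO1 := (bO P one).

Lemma bO_inbox x : (forall i, bO1 (fun a j => x a j i)) ->
  exists2 r : R, 0 <= r & forall a j, P a j -> inbox r (x a j).
Proof.
move=> H; have [C0 p0 H0] := H X0; have [C1 p1 H1] := H X1.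
have [C2 p2 H2] := H X2; exists (C0 + C1 + C2); first by rewrite !addr_ge0.
move=> a j p i.
have := H0 a j p; have := H1 a j p; have := H2 a j p; rewrite !mulr1.
by case: i; lra.
Qed.

Lemma bO_ix g (F : ix -> A -> J -> R) : (forall i, bO P g (F i)) ->
  exists2 C : R, 0 <= C & forall i a j, P a j -> `|F i a j| <= C * g a j.
Proof.
move=> H; have [C0 p0 H0] := H X0; have [C1 p1 H1] := H X1.
have [C2 p2 H2] := H X2; exists (C0 + C1 + C2); first by rewrite !addr_ge0.
move=> i a j p.
have := H0 a j p; have := H1 a j p; have := H2 a j p; rewrite !mulrDl.
move: (normr_ge0 (F X0 a j)) (normr_ge0 (F X1 a j)) (normr_ge0 (F X2 a j)).
by case: i; lra.
Qed.

Lemma bO_comp f x : locbd f -> (forall i, bO1 (fun a j => x a j i)) ->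
  bO1 (fun a j => f (x a j)).
Proof.
move=> h /bO_inbox[r r0 hr]; have [C HC] := h r.
exists `|C| => // a j p; rewrite mulr1; apply: (le_trans (HC _ (hr _ _ p))).
exact: ler_norm.
Qed.

Lemma bO_dist1 g x y : (forall i, bO P g (fun a j => x a j i - y a j i)) ->
  bO P g (fun a j => dist1 (x a j) (y a j)).
Proof.
by move=> H; apply: (bO_sum3 (f := fun i a j => `|x a j i - y a j i|)) => i;
  exact: bO_abs.
Qed.

Lemma bO_lip f x y g : loclip f ->
  (forall i, bO1 (fun a j => x a j i)) -> (forall i, bO1 (fun a j => y a j i)) ->
  (forall i, bO P g (fun a j => x a j i - y a j i)) ->
  bO P g (fun a j => f (x a j) - f (y a j)).
Proof.
move=> h /bO_inbox[r r0 hr] /bO_inbox[r' r'0 hr'] /bO_dist1 hd.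
apply: bO_trans hd.
have [C C0 HC] := h (r + r'); exists C => // a j p; apply: HC => i.
  by apply: (le_trans (hr _ _ p i)); rewrite lerDl.
by apply: (le_trans (hr' _ _ p i)); rewrite lerDr.
Qed.

(** Two gauges are kept apart: [g1] for first differences and [g] for second ones, with
    [g1^2 = O(g)]. For the smooth path [g] is [h^2]; for the iterates it is [th2], which may be
    larger. *)
Lemma bO_sym f x y z g1 g : locsym f ->
  (forall i, bO1 (fun a j => x a j i)) -> (forall i, bO1 (fun a j => y a j i)) ->
  (forall i, bO1 (fun a j => z a j i)) ->
  (forall i, bO P g (fun a j => y a j i + z a j i - 2 * x a j i)) ->
  (forall i, bO P g1 (fun a j => y a j i - x a j i)) ->
  (forall i, bO P g1 (fun a j => z a j i - x a j i)) ->
  bO P g (fun a j => g1 a j * g1 a j) ->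
  bO P g (fun a j => f (y a j) + f (z a j) - 2 * f (x a j)).
Proof.
move=> h /bO_inbox[r r0 hr] /bO_inbox[r1 r10 hr1] /bO_inbox[r2 r20 hr2].
move=> hs /bO_dist1 h1 /bO_dist1 h2 hg.
apply: (@bO_trans _ _ _ _
   (fun a j => sum3 (fun i => `|y a j i + z a j i - 2 * x a j i|) +
     dist1 (y a j) (x a j) ^+ 2 + dist1 (z a j) (x a j) ^+ 2)).
  have [C C0 HC] := h (r + r1 + r2); exists C => // a j p; apply: HC => i.
  - by have := hr _ _ p i; lra.
  - by have := hr1 _ _ p i; lra.
  - by have := hr2 _ _ p i; lra.
apply: bOD; first apply: bOD.
- apply: (bO_sum3 (f := fun i a j => `|y a j i + z a j i - 2 * x a j i|)) => i.
  exact: bO_abs.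
- by apply: bO_trans hg; exact: (bOM h1 h1).
- by apply: bO_trans hg; exact: (bOM h2 h2).
Qed.

End UniformBoundsComposition.

(** * Coordinates, smooth maps and mixed partial derivatives *)

(** Coordinates are indexed by [ix] rather than ['I_3] so that case analysis computes and leaves
    polynomial goals for [ring]. *)
Definition ord_of_ix (i : ix) : 'I_3 :=
  match i with X0 => c0 | X1 => c1 | X2 => c2 end.

Definition ix_of_ord (j : 'I_3) : ix :=
  match val j with 0%N => X0 | 1%N => X1 | _ => X2 end.

Lemma ix_of_ordK : cancel ix_of_ord ord_of_ix.
Proof. by case=> -[|[|[|//]]] p; exact: val_inj. Qed.

Section Coordinates.
Variable R : realType.
Notation V := 'rV[R]_3.

Definition mkv (y : ix -> R) : V := \row_j y (ix_of_ord j).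

Definition cvec (u : V) (i : ix) : R := u ord0 (ord_of_ix i).

Lemma mkv_cvec u : mkv (cvec u) = u.
Proof.
by apply/rowP => j; rewrite mxE /cvec ix_of_ordK.
Qed.

Lemma mkv_e3 (y : ix -> R) : mkv y =
  y X0 *: e3 R c0 + y X1 *: e3 R c1 + y X2 *: e3 R c2.
Proof.
apply/rowP => j; rewrite !mxE.
by case: j => -[|[|[|//]]] p /=; rewrite /ix_of_ord/=; ring.
Qed.

Lemma sum_ord3 (F : 'I_3 -> R) : \sum_(j < 3) F j = sum3 (fun i => F (ord_of_ix i)).
Proof.
rewrite !big_ord_recr big_ord0 /= add0r /sum3.
by congr (F _ + F _ + F _); exact: val_inj.
Qed.

Lemma cvec_dot (u v : V) : dot u v = dot3 (cvec u) (cvec v).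
Proof. by rewrite /dot sum_ord3. Qed.

Lemma cvec_cross (u v : V) i : cvec (cross u v) i = cross3 (cvec u) (cvec v) i.
Proof. by case: i; rewrite /cvec mxE. Qed.

Lemma cvecD (u v : V) i : cvec (u + v) i = cvec u i + cvec v i.
Proof. by rewrite /cvec mxE. Qed.

Lemma cvecN (u : V) i : cvec (- u) i = - cvec u i.
Proof. by rewrite /cvec mxE. Qed.

Lemma cvecZ a (u : V) i : cvec (a *: u) i = a * cvec u i.
Proof. by rewrite /cvec mxE. Qed.

Lemma enorm_cvec (u : V) : enorm u = Num.sqrt (sum3 (fun i => cvec u i ^+ 2)).
Proof. by rewrite /enorm cvec_dot. Qed.

Lemma cvec_le_enorm (u : V) i : `|cvec u i| <= enorm u.
Proof.
rewrite enorm_cvec -sqrtr_sqr ler_wsqrtr// /sum3.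
have := sqr_ge0 (cvec u X0); have := sqr_ge0 (cvec u X1).
have := sqr_ge0 (cvec u X2).
by case: i; lra.
Qed.

Lemma enorm_le (u : V) (C : R) : 0 <= C -> (forall i, `|cvec u i| <= C) ->
  enorm u <= 2 * C.
Proof.
move=> C0 H; have D0 : 0 <= 2 * C by rewrite mulr_ge0.
rewrite -(ger0_norm D0) -sqrtr_sqr enorm_cvec ler_wsqrtr// /sum3.
have h i : cvec u i ^+ 2 <= C ^+ 2 by rewrite -real_normK ?num_real// lerXn2r// nnegrE.
have := sqr_ge0 C.
have := h X0; have := h X1; have := h X2.
by rewrite exprMn; lra.
Qed.

Lemma is_derive_cvec (x : R -> V) dx t i : is_derive t (1 : R) x dx ->
  is_derive t (1 : R) (fun s => cvec (x s) i) (cvec dx i).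
Proof.
move=> [d e]; split; first by move/derivable_mxP : d => /(_ ord0 (ord_of_ix i)).
by move: e; rewrite derive_mx// => <-; rewrite /cvec mxE.
Qed.

Lemma is_derive_mkv (x : R -> ix -> R) dx t :
  (forall i, is_derive t (1 : R) (fun s => x s i) (dx i)) ->
  is_derive t (1 : R) (fun s => mkv (x s)) (mkv dx).
Proof.
move=> H.
have E i j : (fun s => mkv (x s) i j) = (fun s => x s (ix_of_ord j)).
  by apply/funext => s; rewrite mxE.
have d : derivable (fun s => mkv (x s)) t 1.
  by apply/derivable_mxP => i j; rewrite E; have [] := H (ix_of_ord j).
split=> //; rewrite derive_mx//; apply/matrixP => i j; rewrite !mxE E.
by have [] := H (ix_of_ord j).
Qed.

Lemma is_derive_diff_comp (F : V -> R) (x : R -> V) dx t :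
  differentiable F (x t) -> is_derive t (1 : R) x dx ->
  is_derive t (1 : R) (fun s => F (x s)) ('d F (x t) dx).
Proof.
move=> dF [/derivable1_diffP dx' e].
have dc : differentiable (F \o x) t by exact: differentiable_comp.
split; first exact/derivable1_diffP.
by rewrite (deriveE _ dc) diff_comp//= -e deriveE.
Qed.

Lemma hasgrad_diff (F : V -> R) : (forall x, differentiable F x) ->
  hasgrad (fun y => F (mkv y)) (fun i y => 'd F (mkv y) (e3 R (ord_of_ix i))).
Proof.
move=> dF x dx t /is_derive_mkv H.
have h := is_derive_diff_comp (dF (mkv (x t))) H.
apply: is_derive_eq.
by rewrite (mkv_e3 dx) !linearD !linearZ /= /sum3 /GRing.scale/= !(mulrC (dx _)).
Qed.

Lemma locbd_cont (F : V -> R) : continuous F -> locbd (fun y => F (mkv y)).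
Proof.
move=> cF r.
pose A := [set v : V | forall i, `[(- r), r]%classic (v ord0 i)]%classic.
have cA : compact A.
  by apply: (@rV_compact R 3 (fun=> `[(- r), r]%classic)) => i; exact: segment_compact.
have cN : {within A, continuous (fun v => `|F v|)}%classic.
  apply: continuous_subspaceT => v.
  exact: (continuous_comp (f := F) (g := fun z : R => `|z|) (cF v) (@norm_continuous _ _ _)).
have [A0|An0] := pselect (A !=set0)%classic.
  have [c _ Hc] := compact_EVT_max A0 cA cN.
  exists `|F c| => x hx; apply: Hc; rewrite inE => i /=.
  by rewrite mxE in_itv/= -ler_norml.
(* The box is empty only for a negative radius; then no point satisfies the premise. *)
exists 0 => x hx; exfalso; apply: An0; exists (mkv x) => i /=.
by rewrite mxE in_itv/= -ler_norml.
Qed.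

(* [l] is the identity on scalars or a coordinate on vectors *)
Lemma smooth_CC_gen (W : normedModType R) (l : W -> R) (f : V -> W) :
  (forall (F : V -> W) x, differentiable F x -> differentiable (fun x => l (F x)) x) ->
  (forall (F : V -> W) x v, differentiable F x ->
      'd (fun x => l (F x)) x v = l ('D_v F x)) ->
  smooth f -> forall k vs, CC k (fun y => l (Defs.iterD f vs (mkv y))).
Proof.
move=> hl1 hl2 sf; elim=> [|k IH] vs; split=> //.
1,2: apply: (locbd_cont (F := fun x => l (Defs.iterD f vs x))) => x;
     apply: differentiable_continuous; apply: hl1; exact: sf.
exists (fun i y => l (Defs.iterD f (e3 R (ord_of_ix i) :: vs) (mkv y))).
  have e : (fun i y => l (Defs.iterD f (e3 R (ord_of_ix i) :: vs) (mkv y))) =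
     (fun i y => 'd (fun x => l (Defs.iterD f vs x)) (mkv y) (e3 R (ord_of_ix i))).
    by apply/funext => i; apply/funext => y; rewrite hl2//; exact: sf.
  rewrite e; apply: (hasgrad_diff (F := fun x => l (Defs.iterD f vs x))) => x.
  by apply: hl1; exact: sf.
by move=> i; exact: IH.
Qed.

Lemma smooth_hasgrad_gen (W : normedModType R) (l : W -> R) (f : V -> W) vs :
  (forall (F : V -> W) x, differentiable F x -> differentiable (fun x => l (F x)) x) ->
  (forall (F : V -> W) x v, differentiable F x ->
      'd (fun x => l (F x)) x v = l ('D_v F x)) ->
  smooth f -> hasgrad (fun y => l (Defs.iterD f vs (mkv y)))
   (fun i y => l (Defs.iterD f (e3 R (ord_of_ix i) :: vs) (mkv y))).
Proof.
move=> hl1 hl2 sf.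
have -> : (fun i y => l (Defs.iterD f (e3 R (ord_of_ix i) :: vs) (mkv y))) =
   (fun i y => 'd (fun x => l (Defs.iterD f vs x)) (mkv y) (e3 R (ord_of_ix i))).
  by apply/funext => i; apply/funext => y; rewrite hl2//; exact: sf.
apply: (hasgrad_diff (F := fun x => l (Defs.iterD f vs x))) => x.
by apply: hl1; exact: sf.
Qed.

Lemma differentiable_cvec (F : V -> V) x i : differentiable F x ->
  differentiable (fun x => cvec (F x) i) x.
Proof.
move=> dF; apply: (differentiable_comp (g := fun N : V => N ord0 (ord_of_ix i))) => //.
exact: differentiable_coord.
Qed.

Lemma diff_cvec (F : V -> V) x v i : differentiable F x ->
  'd (fun x => cvec (F x) i) x v = cvec ('D_v F x) i.
Proof.
move=> dF; rewrite -deriveE; last exact: differentiable_cvec.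
rewrite derive_mx; last exact: diff_derivable.
by rewrite /cvec mxE.
Qed.

Lemma smooth_CC_vec (f : V -> V) k vs i : smooth f ->
  CC k (fun y => cvec (Defs.iterD f vs (mkv y)) i).
Proof.
move=> sf; apply: (smooth_CC_gen (l := cvec^~ i)) => // F x.
  exact: differentiable_cvec.
by move=> v; exact: diff_cvec.
Qed.

Lemma smooth_hasgrad_vec (f : V -> V) vs i : smooth f ->
  hasgrad (fun y => cvec (Defs.iterD f vs (mkv y)) i)
    (fun j y => cvec (Defs.iterD f (e3 R (ord_of_ix j) :: vs) (mkv y)) i).
Proof.
move=> sf; apply: (smooth_hasgrad_gen (l := cvec^~ i)) => // F x.
  exact: differentiable_cvec.
by move=> v; exact: diff_cvec.
Qed.

Lemma smooth_CC_scal (f : V -> R) k vs : smooth f ->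
  CC k (fun y => Defs.iterD f vs (mkv y)).
Proof.
move=> sf; apply: (smooth_CC_gen (l := fun z : R => z)) => // F x v dF.
by rewrite deriveE.
Qed.

Lemma smooth_hasgrad_scal (f : V -> R) vs : smooth f ->
  hasgrad (fun y => Defs.iterD f vs (mkv y))
    (fun j y => Defs.iterD f (e3 R (ord_of_ix j) :: vs) (mkv y)).
Proof.
move=> sf; apply: (smooth_hasgrad_gen (l := fun z : R => z)) => // F x v dF.
by rewrite deriveE.
Qed.

End Coordinates.

(** * Symmetry of second partial derivatives *)

Section MixedPartials.
Variable R : realType.
Notation V3 := (ix -> R).

Definition delta (i k : ix) : R :=
  match i, k with X0, X0 | X1, X1 | X2, X2 => 1 | _, _ => 0 end.

Lemma sum3_delta (g : ix -> R) i : sum3 (fun k => g k * delta i k) = g i.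
Proof. by rewrite /sum3; case: i => /=; ring. Qed.

Lemma is_derive_line (f : V3 -> R) g (x : R -> V3) y i t : hasgrad f g ->
  (forall s k, x s k = y k + s * delta i k) ->
  is_derive t (1 : R) (fun s => f (x s)) (g i (x t)).
Proof.
move=> h e; rewrite -(sum3_delta (fun i => g i (x t)) i); apply: h => k.
have -> : (fun s => x s k) = (fun s => y k + s * delta i k) by apply/funext.
exact: is_derive_affine.
Qed.

Lemma hasgrad_unique f g g' : hasgrad f g -> hasgrad f g' ->
  forall i (y : V3), g i y = g' i y.
Proof.
move=> h h' i y; pose x (s : R) k := y k + s * delta i k.
have -> : y = x 0 by apply/funext => k; rewrite /x mul0r addr0.
have [_ <-] := @is_derive_line f g x y i 0 h (fun _ _ => erefl).
by have [_ <-] := @is_derive_line f g' x y i 0 h' (fun _ _ => erefl).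
Qed.

Definition pt2 (y : V3) i j (s t : R) : V3 :=
  fun k => y k + s * delta i k + t * delta j k.

(** The mean value bound is applied twice, first in direction [i] and then in direction [j]. The
    difference over a square of side [s] is thus [s^2] times the mixed partial at the corner, up to
    [O(s^3)]. *)
Lemma second_diff_half f g gg (y : V3) i j : hasgrad f g ->
  (forall i, hasgrad (g i) (gg i)) -> (forall i j, loclip (gg i j)) ->
  exists L : R, forall s, 0 <= s <= 1 ->
   `|f (pt2 y i j s s) - f (pt2 y i j s 0) -
     (f (pt2 y i j 0 s) - f (pt2 y i j 0 0)) - s ^+ 2 * gg i j y| <= L * s ^+ 3.
Proof.
move=> h hg hl.
(* The margin 2 keeps all points with [s, t <= 1] in the box, one unit for each direction. *)
pose r : R := sum3 (fun k => `|y k|) + 2.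
have [L L0 HL] := hl i j r.
have dl0 a k : 0 <= delta a k <= 1 by case: a; case: k => /=; rewrite ?lexx ?ler01.
have yin : inbox r y.
  move=> k; rewrite /r /sum3.
  by move: (normr_ge0 (y X0)) (normr_ge0 (y X1)) (normr_ge0 (y X2)); case: k; lra.
have ptin s t : 0 <= s <= 1 -> 0 <= t <= 1 -> inbox r (pt2 y i j s t).
  move=> hs ht k.
  have h1 : `|s * delta i k| <= 1.
    rewrite ger0_norm; have := dl0 i k; first nra.
    by move=> ?; apply: mulr_ge0; lra.
  have h2 : `|t * delta j k| <= 1.
    rewrite ger0_norm; have := dl0 j k; first nra.
    by move=> ?; apply: mulr_ge0; lra.
  apply: (le_trans (ler_normD _ _)); apply: (le_trans (lerD (ler_normD _ _) h2)).
  rewrite /r /sum3.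
  by move: (normr_ge0 (y X0)) (normr_ge0 (y X1)) (normr_ge0 (y X2)); case: k h1 {h2}; lra.
have ptd s t : 0 <= s -> 0 <= t -> dist1 (pt2 y i j s t) y <= s + t.
  move=> s0 t0; rewrite /dist1 /sum3 /pt2.
  have e k : `|y k + s * delta i k + t * delta j k - y k| = s * delta i k + t * delta j k.
    rewrite (_ : _ - _ = s * delta i k + t * delta j k); last by ring.
    by rewrite ger0_norm// addr_ge0// mulr_ge0//; have /andP[] := dl0 i k; have /andP[] := dl0 j k.
  rewrite !e.
  have d1 a : delta a X0 + delta a X1 + delta a X2 = 1 by case: a => /=; ring.
  rewrite -[X in _ <= X + _](mulr1) -[X in _ <= _ + X](mulr1) -{1}(d1 i) -(d1 j).
  by rewrite le_eqVlt; apply/orP; left; apply/eqP; ring.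
exists (2 * L) => s s01; have /andP[s0 s1] := s01.
pose F u := f (pt2 y i j u s) - f (pt2 y i j u 0) - (0 + u * (s * gg i j y)).
have := @mean_value_bound R F
  (fun u => g i (pt2 y i j u s) - g i (pt2 y i j u 0) - s * gg i j y) 0 s (2 * L * s ^+ 2) s0.
rewrite (_ : F s - F 0 = f (pt2 y i j s s) - f (pt2 y i j s 0) -
     (f (pt2 y i j 0 s) - f (pt2 y i j 0 0)) - s ^+ 2 * gg i j y); last first.
  by rewrite /F; ring.
rewrite (_ : 2 * L * s ^+ 2 * (s - 0) = 2 * L * s ^+ 3); last by ring.
apply.
  move=> u _; apply: (is_deriveB (f := fun u => f _ - f _)); last exact: is_derive_affine.
  apply: is_deriveB.
    apply: (@is_derive_line f g _ (fun k => y k + s * delta j k)) => // v k.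
    by rewrite /pt2; ring.
  apply: (@is_derive_line f g _ y) => // v k.
  by rewrite /pt2; ring.
move=> u /andP[u0 us].
pose G v := g i (pt2 y i j u v) - (0 + v * gg i j y).
have := @mean_value_bound R G
  (fun v => gg i j (pt2 y i j u v) - gg i j y) 0 s (2 * L * s) s0.
rewrite (_ : G s - G 0 = g i (pt2 y i j u s) - g i (pt2 y i j u 0) - s * gg i j y); last first.
  by rewrite /G; ring.
rewrite (_ : 2 * L * s * (s - 0) = 2 * L * s ^+ 2); last by ring.
apply.
  move=> v _; apply: is_deriveB; last exact: is_derive_affine.
  apply: (@is_derive_line (g i) (gg i) _ (fun k => y k + u * delta i k)) => // w k.
move=> v /andP[v0 vs].
have v1 : 0 <= v <= 1 by lra.
have u1 : 0 <= u <= 1 by lra.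
apply: (le_trans (HL _ _ (ptin _ _ u1 v1) yin)).
have := ptd u v u0 v0; nra.
Qed.

(** The second difference is symmetric in the two directions, so both mixed partials are its leading
    coefficient. This is what makes the divergence of a curl vanish below. *)
Lemma mixed_partials (f : V3 -> R) g gg : hasgrad f g ->
  (forall i, hasgrad (g i) (gg i)) -> (forall i j, loclip (gg i j)) ->
  forall i j y, gg i j y = gg j i y.
Proof.
move=> h hg hl i j y.
have [L HL] := second_diff_half y i j h hg hl.
have [M HM] := second_diff_half y j i h hg hl.
have sw s t : pt2 y j i s t = pt2 y i j t s.
  by apply/funext => k; rewrite /pt2; ring.
apply/eqP; rewrite -subr_eq0 -normr_eq0 eq_le normr_ge0 andbT leNgt.
apply/negP; set d := `|_| => d0.
pose K := `|L| + `|M| + d + 1.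
have K0 : 0 < K by have := normr_ge0 L; have := normr_ge0 M; rewrite /K; lra.
(* With this side length [(|L| + |M|) s <= s K = d / 2], against [d <= (|L| + |M|) s]. The terms
   [d + 1] in [K] ensure [0 < K] and [s <= 1]. *)
pose s := d / (2 * K).
have s0 : 0 < s by rewrite divr_gt0// mulr_gt0.
have sK : s * K = d / 2 by rewrite /s; field; rewrite gt_eqF.
have s1 : 0 <= s <= 1.
  rewrite (ltW s0)/=.
  by rewrite -(ler_pM2r K0) sK mul1r /K; have := normr_ge0 L; have := normr_ge0 M; lra.
have := HL s s1; have := HM s s1; rewrite !sw.
set D := f _; set D1 := f (pt2 y i j 0 s); set D2 := f (pt2 y i j s 0); set D3 := f _.
move=> h1 h2.
have h3 : s ^+ 2 * d <= (`|L| + `|M|) * s ^+ 3.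
  rewrite /d -(ger0_norm (sqr_ge0 s)) -normrM.
  rewrite (_ : _ * _ = (D - D1 - (D2 - D3) - s ^+ 2 * gg j i y) -
      (D - D2 - (D1 - D3) - s ^+ 2 * gg i j y)); last by ring.
  apply: (le_trans (ler_normB _ _)); rewrite mulrDl addrC.
  have s3 : 0 <= s ^+ 3 by rewrite exprn_ge0// ltW.
  have := ler_wpM2r s3 (ler_norm L); have := ler_wpM2r s3 (ler_norm M).
  by move: h1 h2; lra.
have s2 : 0 < s ^+ 2 by rewrite exprn_gt0.
have : d <= (`|L| + `|M|) * s.
  by rewrite -(ler_pM2l s2); apply: (le_trans h3); rewrite [leRHS](_ : _ = (`|L| + `|M|) * s ^+ 3)//; ring.
have : (`|L| + `|M|) * s <= s * K.
  by rewrite mulrC ler_pM2l// /K; lra.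
by rewrite sK; lra.
Qed.

End MixedPartials.

(** * Geometry of the field *)

(** The interface between the fields of the statement and the analysis; nothing in it depends on
    [eps]. [rho] and [bet] are the modulus and direction of [B1], [betg i j] is the [j]-th partial
    of [bet i], and [bet_div] is [div (rho b) = 0] expanded. *)
Record field_data (R : realType) := FieldData {
  rho : (ix -> R) -> R;
  rhog : ix -> (ix -> R) -> R;
  bet : ix -> (ix -> R) -> R;
  betg : ix -> ix -> (ix -> R) -> R;
  pot : (ix -> R) -> R;
  Ef : ix -> (ix -> R) -> R;
  rho_grad : hasgrad rho rhog;
  bet_grad : forall i, hasgrad (bet i) (betg i);
  pot_grad : hasgrad pot (fun i y => - Ef i y);
  rho_CC : CC 2 rho;
  rhog_CC : forall i, CC 2 (rhog i);
  bet_CC : forall i, CC 2 (bet i);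
  betg_CC : forall i j, CC 2 (betg i j);
  pot_CC : CC 2 pot;
  Ef_CC : forall i, CC 2 (Ef i);
  rho_ge1 : forall y, 1 <= rho y;
  bet_unit : forall y, sum3 (fun i => bet i y ^+ 2) = 1;
  bet_ortho : forall j y, sum3 (fun i => bet i y * betg i j y) = 0;
  bet_div : forall y, rho y * sum3 (fun i => betg i i y) =
                      - sum3 (fun i => bet i y * rhog i y) }.

Section FieldData.
Variable R : realType.
Notation V := 'rV[R]_3.
Variables (B1 A1 : V -> V) (phi : V -> R).
Hypotheses (hB1 : smooth B1) (hA1 : smooth A1) (hphi : smooth phi).
Hypothesis hcurl : forall x, curl A1 x = B1 x.
Hypothesis hB1ge : forall x, 1 <= enorm (B1 x).

Let b (i : ix) (y : ix -> R) : R := cvec (B1 (mkv y)) i.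
Let db (i : ix) (j : ix) (y : ix -> R) : R := cvec (Defs.iterD B1 [:: e3 R (ord_of_ix j)] (mkv y)) i.
Let n2 (y : ix -> R) : R := sum3 (fun i => b i y * b i y).
Let n (y : ix -> R) : R := Num.sqrt (n2 y).
Let s (y : ix -> R) : R := (n y)^-1.
Let ng (j : ix) (y : ix -> R) : R := s y * sum3 (fun i => b i y * db i j y).
Let be (i : ix) (y : ix -> R) : R := b i y * s y.
Let beg (i : ix) (j : ix) (y : ix -> R) : R := db i j y * s y - b i y * (s y * s y * ng j y).

Let da (i : ix) (j : ix) (y : ix -> R) : R := cvec (Defs.iterD A1 [:: e3 R (ord_of_ix i)] (mkv y)) j.
Let dda (k : ix) (i : ix) (j : ix) (y : ix -> R) : R :=
  cvec (Defs.iterD A1 [:: e3 R (ord_of_ix k); e3 R (ord_of_ix i)] (mkv y)) j.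

Let b_CC k i : CC k (b i). Proof. exact: (smooth_CC_vec k [::] i hB1). Qed.
Let db_CC k i j : CC k (db i j). Proof. exact: smooth_CC_vec. Qed.
Let b_grad i : hasgrad (b i) (db i).
Proof. exact: (smooth_hasgrad_vec [::] i hB1). Qed.

Let enormE y : enorm (B1 (mkv y)) = n y.
Proof.
by rewrite enorm_cvec /n /n2; congr (Num.sqrt _).
Qed.

Let n_ge1 y : 1 <= n y. Proof. by rewrite -enormE. Qed.

Let n2_sqr y : n2 y = n y ^+ 2.
Proof.
rewrite sqr_sqrtr// /n2 /sum3 -!expr2.
by rewrite !addr_ge0 ?sqr_ge0.
Qed.

Let n2_ge1 y : 1 <= n2 y.
Proof. by rewrite n2_sqr; exact: exprn_ege1. Qed.

Let n2_CC k : CC k n2.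
Proof. by apply: (@CC_sum3 R k (fun i y => b i y * b i y)) => i; exact: CCM. Qed.

Let n_CC k : CC k n. Proof. exact: (CC_sqrt n2_ge1 (n2_CC k)). Qed.
Let s_CC k : CC k s. Proof. exact: (CCV n_ge1 (n_CC k)). Qed.

Let ng_CC k j : CC k (ng j).
Proof.
apply: CCM => //.
by apply: (@CC_sum3 R k (fun i y => b i y * db i j y)) => i; exact: CCM.
Qed.

Let be_CC k i : CC k (be i). Proof. exact: CCM. Qed.

Let beg_CC k i j : CC k (beg i j).
Proof.
rewrite (_ : beg i j = fun y => db i j y * s y + -1 * (b i y * (s y * s y * ng j y))).
  apply: CCD; first exact: CCM.
  apply: CCM; first exact: CC_cst.
  by apply: CCM => //; apply: CCM => //; exact: CCM.
by apply/funext => y; rewrite /beg mulN1r.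
Qed.

Let hasgrad_ext f g g' : hasgrad f g -> (forall i (y : ix -> R), g i y = g' i y) ->
  hasgrad f g'.
Proof.
by move=> h e; rewrite (_ : g' = g)//; apply/funext => i; apply/funext => y.
Qed.

Let n0 y : n y != 0. Proof. by rewrite gt_eqF// (lt_le_trans ltr01). Qed.

Let n_grad : hasgrad n ng.
Proof.
have h2 i : hasgrad (fun y => b i y * b i y) (fun j y => b i y * db i j y + b i y * db i j y).
  exact: hasgradM.
have h3 : hasgrad n2 _ := hasgradD (hasgradD (h2 X0) (h2 X1)) (h2 X2).
apply: hasgrad_ext; first exact: (hasgrad_sqrt n2_ge1 h3).
by move=> i y; rewrite /ng /s /n /sum3 /=; field; exact: n0.
Qed.

Let be_grad i : hasgrad (be i) (beg i).
Proof.
apply: hasgrad_ext; first exact: (hasgradM (b_grad i) (hasgradV n_ge1 n_grad)).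
by move=> j y; rewrite /beg /s; ring.
Qed.

Let be_unit y : sum3 (fun i => be i y ^+ 2) = 1.
Proof.
have := n2_sqr y; rewrite /n2 /be /s /sum3 => h.
transitivity ((b X0 y * b X0 y + b X1 y * b X1 y + b X2 y * b X2 y) / n y ^+ 2).
  by field.
by rewrite h mulfV// expf_neq0.
Qed.

Let be_ortho j y : sum3 (fun i => be i y * beg i j y) = 0.
Proof.
have h := n2_sqr y; rewrite /be /beg /ng /s.
have e : n2 y / n y ^+ 2 = 1 by rewrite h mulfV// expf_neq0.
transitivity ((1 - n2 y / n y ^+ 2) / n y ^+ 2 * sum3 (fun i => b i y * db i j y)).
  by rewrite /sum3 /n2 /sum3; field.
by rewrite e subrr !mul0r.
Qed.

(** Each component of [B1 = curl A1] is a difference of two partials of [A1], so the divergence is a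
    sum of differences of mixed partials that cancel in pairs. *)
Let db_div y : sum3 (fun i => db i i y) = 0.
Proof.
have gA j : hasgrad (fun y => cvec (A1 (mkv y)) j) (fun i => da i j).
  exact: (smooth_hasgrad_vec [::] j hA1).
have gdA i j : hasgrad (da i j) (fun k => dda k i j).
  exact: (smooth_hasgrad_vec [:: _] j hA1).
have sym k i j : dda k i j y = dda i k j y.
  apply: (mixed_partials (gA j) (gg := fun i k => dda k i j)) => [a|a c].
    exact: gdA.
  by apply: CC_loclip; exact: smooth_CC_vec.
have pdE i j z : pd A1 (mkv z) (ord_of_ix i) (ord_of_ix j) = da i j z.
  by rewrite /pd /da /= -deriveE//; exact: (hA1 [::]).
have gB (i1 j1 i2 j2 i : ix) :
   (forall z, b i z = da i1 j1 z - da i2 j2 z) ->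
   forall k, db i k y = dda k i1 j1 y - dda k i2 j2 y.
  move=> e k.
  have eb : b i = fun z => da i1 j1 z + (-1) * da i2 j2 z.
    by apply/funext => z; rewrite e mulN1r.
  have h := hasgradD (gdA i1 j1) (hasgradM (@hasgrad_cst R (-1)) (gdA i2 j2)).
  rewrite -eb in h.
  by rewrite (hasgrad_unique (b_grad i) h) mulr0 addr0 mulN1r.
have e0 := gB X1 X2 X2 X1 X0; have e1 := gB X2 X0 X0 X2 X1.
have e2 := gB X0 X1 X1 X0 X2.
rewrite /sum3 e0 ?e1 ?e2.
- by rewrite (sym X0 X1) (sym X0 X2) (sym X1 X2); ring.
- by move=> z; rewrite /b -hcurl /cvec mxE /= -!pdE.
- by move=> z; rewrite /b -hcurl /cvec mxE /= -!pdE.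
- by move=> z; rewrite /b -hcurl /cvec mxE /= -!pdE.
Qed.

Let be_div y : n y * sum3 (fun i => beg i i y) =
  - sum3 (fun i => be i y * ng i y).
Proof.
have e : sum3 (fun i => beg i i y) =
  sum3 (fun i => db i i y) * s y - s y * sum3 (fun i => be i y * ng i y).
  rewrite /beg /be /sum3.
  move: (db X0 X0 y) (db X1 X1 y) (db X2 X2 y) (b X0 y) (b X1 y) (b X2 y).
  by move: (ng X0 y) (ng X1 y) (ng X2 y) (s y) => *; ring.
rewrite e db_div mul0r sub0r mulrN mulrA /s mulfV// mul1r//.
Qed.

Let pot0 (y : ix -> R) : R := phi (mkv y).
Let Ef0 (i : ix) (y : ix -> R) : R := - Defs.iterD phi [:: e3 R (ord_of_ix i)] (mkv y).

Let pot0_grad : hasgrad pot0 (fun i y => - Ef0 i y).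
Proof.
apply: hasgrad_ext; first exact: (smooth_hasgrad_scal [::] hphi).
by move=> i y; rewrite /Ef0 opprK.
Qed.

Let pot0_CC : CC 2 pot0. Proof. exact: (smooth_CC_scal 2 [::] hphi). Qed.

Let Ef0_CC i : CC 2 (Ef0 i).
Proof.
rewrite (_ : Ef0 i = fun y => -1 * Defs.iterD phi [:: e3 R (ord_of_ix i)] (mkv y)).
  by apply: CCM; [exact: CC_cst|exact: smooth_CC_scal].
by apply/funext => y; rewrite mulN1r.
Qed.

(** The [grad] in the scheme is a Frechet differential. Differentiability of [|B1|] makes it a
    gradient in the sense of [hasgrad], and uniqueness identifies it with [ng]. *)
Let diff_enorm x : differentiable (fun x => enorm (B1 x)) x.
Proof.
have d2 : differentiable (fun x => dot (B1 x) (B1 x)) x.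
  have -> : (fun x => dot (B1 x) (B1 x)) =
    (fun x => cvec (B1 x) X0) * (fun x => cvec (B1 x) X0) +
    (fun x => cvec (B1 x) X1) * (fun x => cvec (B1 x) X1) +
    (fun x => cvec (B1 x) X2) * (fun x => cvec (B1 x) X2).
    by apply/funext => z; rewrite cvec_dot.
  have dc i : differentiable (fun x => cvec (B1 x) i) x.
    by apply: differentiable_cvec; exact: (hB1 [::]).
  have dm i := differentiableM (dc i) (dc i).
  exact: (differentiableD (differentiableD (dm X0) (dm X1)) (dm X2)).
apply: (differentiable_comp (g := Num.sqrt)) => //.
apply/derivable1_diffP; suff h : 0 < dot (B1 x) (B1 x).
  by have [] := is_derive1_sqrt h.
(* [sqrt] is 0 at non-positive arguments, which contradicts [1 <= enorm (B1 x)]. *)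
rewrite ltNge; apply/negP => /ler0_sqrtr.
by have := hB1ge x; rewrite /enorm => + e; rewrite e ler10.
Qed.

Lemma field_data_exists : exists D : field_data R,
  [/\ forall y i, cvec (B1 (mkv y)) i = rho D y * bet D i y,
      forall y, pot D y = phi (mkv y),
      forall y i, cvec (- grad phi (mkv y)) i = Ef D i y &
      forall (eps : R) y i, 0 < eps ->
        cvec (grad (normB (fun x => eps^-1 *: B1 x)) (mkv y)) i =
        eps^-1 * rhog D i y].
Proof.
exists (FieldData n_grad be_grad pot0_grad (n_CC 2) (ng_CC 2) (be_CC 2) (beg_CC 2)
  pot0_CC Ef0_CC n_ge1 be_unit be_ortho be_div); split => //=.
- by move=> y i; rewrite /be /s mulrCA mulfV// mulr1.
- move=> y i; rewrite cvecN /cvec /grad mxE /Ef0 /= deriveE//.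
  exact: (hphi [::]).
- move=> eps y i e0.
  have -> : normB (fun x => eps^-1 *: B1 x) = eps^-1 \*: (fun x => enorm (B1 x)).
    apply/funext => x; rewrite /normB /= !enorm_cvec /GRing.scale/=.
    rewrite -[X in _ = X * _](@ger0_norm _ eps^-1) ?invr_ge0 ?ltW// -sqrtr_sqr.
    rewrite -sqrtrM ?sqr_ge0//; congr (Num.sqrt _).
    by rewrite /sum3 !cvecZ; ring.
  rewrite /cvec /grad mxE diffZ//=; congr (_ * _).
  have h := hasgrad_diff diff_enorm.
  have e : (fun y => enorm (B1 (mkv y))) = n by apply/funext => z; exact: enormE.
  rewrite e in h.
  exact: (hasgrad_unique h n_grad).
Qed.

End FieldData.

(** * Exact motion *)

(** Descends through the expression; in a product it tries both choices of the factor that is O(1),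
    and it closes the leaves with bounds from the context. *)
Ltac bo_solve :=
  lazymatch goal with
  | |- bO _ _ (fun a j => @Algebra.add _ (@?f a j) (@?g a j)) =>
      apply: (bOD (f1 := f) (f2 := g)); bo_solve
  | |- bO _ _ (fun a j => @Algebra.opp _ (@?f a j)) =>
      apply: (bON (f := f)); bo_solve
  | |- bO _ _ (fun a j => @GRing.mul _ (@?f a j) (@?g a j)) =>
      first [ solve [apply: (bOMl (f1 := f) (f2 := g)); bo_solve]
            | solve [apply: (bOMr (f1 := f) (f2 := g)); bo_solve] ]
  | |- bO _ _ (fun a j => @GRing.exp _ (@?f a j) 2) =>
      apply: (bOMl (f1 := f) (f2 := f)); bo_solve
  | |- _ => solve [apply: bO_cst | eauto]
  end.

Ltac bo := cbv [sum3 dot3 cross3]; bo_solve.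

Section ExactDynamics.
Variables (R : realType) (D : field_data R) (T M : R).
Hypothesis T0 : 0 < T.
Variable phimin : R.
Hypothesis pot_lb : forall y, phimin <= pot D y.
Notation V3 := (ix -> R).

Record trajectory := Trajectory { oe : R; ox : R -> V3; ov : R -> V3; oa : R -> V3 }.

(** The parameter [eps] is a field of the trajectory, so bounds over all good trajectories are
    uniform in it. The equation of motion is kept multiplied by [eps]. *)
Record good (c : trajectory) : Prop := Good {
  g_e0 : 0 < oe c;
  g_e1 : oe c < 1;
  g_x : forall t i, is_derive t (1 : R) (fun s => ox c s i) (ov c t i);
  g_v : forall t i, is_derive t (1 : R) (fun s => ov c s i) (oa c t i);
  g_a : forall t i, 0 <= t <= T -> oe c * oa c t i =
     rho D (ox c t) * cross3 (ov c t) (fun k => bet D k (ox c t)) i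
     + oe c * Ef D i (ox c t);
  g_x0 : forall i, `|ox c 0 i| <= M;
  g_v0 : forall i, `|ov c 0 i| <= M }.

Definition onT (c : trajectory) (t : R) : Prop := good c /\ 0 <= t <= T.

Notation one := (fun _ _ => 1 : R).
Notation eps := (fun (c : trajectory) (t : R) => oe c).
Notation B1 := (bO onT one).
Notation Be := (bO onT eps).
Notation sig := (trajectory -> R -> R).
Implicit Types f g W : sig.

(** Derivatives are taken at every real time, while the size bounds, and the equation of motion
    itself, are confined to [[0, T]] through [onT]. *)
Definition der f f' :=
  forall c, good c -> forall t, is_derive t (1 : R) (f c) (f' c t).

Definition slow f := exists f', [/\ der f f', B1 f & B1 f'].

(* [f] is, up to O(eps), the derivative of a function of size O(eps) *)
Definition osc f := exists W W',
  [/\ der W W', B1 W & Be (fun c t => f c t - oe c * W' c t)].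

Lemma der_eq f f' f'' : der f f' -> (forall c t, f' c t = f'' c t) -> der f f''.
Proof. by move=> d e c gc t; rewrite -e; exact: d. Qed.

Lemma derD f f' g g' : der f f' -> der g g' ->
  der (fun c t => f c t + g c t) (fun c t => f' c t + g' c t).
Proof. by move=> d1 d2 c gc t; exact: (is_deriveD (d1 c gc t) (d2 c gc t)). Qed.

Lemma derN f f' : der f f' -> der (fun c t => - f c t) (fun c t => - f' c t).
Proof. by move=> d1 c gc t; exact: (is_deriveN (d1 c gc t)). Qed.

Lemma derM f f' g g' : der f f' -> der g g' ->
  der (fun c t => f c t * g c t) (fun c t => f c t * g' c t + g c t * f' c t).
Proof. by move=> d1 d2 c gc t; exact: (is_deriveM (d1 c gc t) (d2 c gc t)). Qed.

Lemma der_cst (k : trajectory -> R) : der (fun c _ => k c) (fun _ _ => 0).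
Proof. by move=> c gc t; exact: (is_derive_cst (k c : R^o) t 1). Qed.

Lemma der_comp (F : V3 -> R) G : hasgrad F G ->
  der (fun c t => F (ox c t)) (fun c t => sum3 (fun i => G i (ox c t) * ov c t i)).
Proof. by move=> h c gc t; apply: h => i; exact: g_x. Qed.

Lemma der_v i : der (fun c t => ov c t i) (fun c t => oa c t i).
Proof. by move=> c gc t; exact: g_v. Qed.

Lemma der_x i : der (fun c t => ox c t i) (fun c t => ov c t i).
Proof. by move=> c gc t; exact: g_x. Qed.

Lemma eps_ge0 c t : onT c t -> 0 <= oe c.
Proof. by move=> [[/ltW]]. Qed.

Lemma Be_eps : Be eps.
Proof. exact: (bO_refl eps_ge0). Qed.

Lemma bounded_eps : B1 eps.
Proof.
exists 1 => // c t [[e0 e1 _ _ _ _ _] _].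
by rewrite mulr1 ger0_norm ltW.
Qed.

Lemma Be_B1 f : Be f -> B1 f.
Proof. by move=> h; apply: bO_trans h bounded_eps. Qed.

(** The gauge must be constant in time to be pulled out of the increment over [[0, t]]; the two uses
    are the gauges 1 and [eps]. *)
Lemma der_bound f f' g : der f f' -> bO onT g f' ->
  (forall c t, g c t = g c 0) -> bO onT g (fun c t => f c t - f c 0).
Proof.
move=> d [C C0 H] gc; exists (C * T); first by rewrite mulr_ge0// ltW.
move=> c t [gd t0T]; have /andP[t0 tT] := t0T.
have h := @mean_value_bound R (f c) (f' c) 0 t (C * g c 0) t0
  (fun s _ => d c gd s).
have h' : forall s, 0 <= s <= t -> `|f' c s| <= C * g c 0.
  move=> s /andP[s0 st]; rewrite -(gc c s); apply: H; split=> //.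
  by rewrite s0 (le_trans st).
apply: (le_trans (h h')).
rewrite subr0 gc [leRHS](_ : _ = C * g c 0 * T); last by ring.
rewrite ler_wpM2l//; apply: (le_trans (normr_ge0 (f' c 0))).
by apply: h'; rewrite lexx.
Qed.

Notation x i := (fun c t => ox c t i).
Notation v i := (fun c t => ov c t i).

Lemma sum3_cross_self (p q : V3) : sum3 (fun i => p i * cross3 p q i) = 0.
Proof. by rewrite /sum3 /cross3; ring. Qed.

Lemma sum3_cross_self2 (p q : V3) : sum3 (fun i => p i * cross3 q p i) = 0.
Proof. by rewrite /sum3 /cross3; ring. Qed.

(** The potential is bounded below globally, so the energy argument needs no bound on [x(t)];
    positions are bounded afterwards by integrating the velocity. *)
Lemma bounded_v i : B1 (v i).
Proof.
have [K HK] := CC_locbd (pot_CC D) M.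
pose H c t := 2^-1 * sum3 (fun i => ov c t i * ov c t i) + pot D (ox c t).
have dH : der H (fun c t => sum3 (fun i => ov c t i * oa c t i)
    + sum3 (fun i => - Ef D i (ox c t) * ov c t i)).
  apply: derD; last exact: (der_comp (pot_grad D)).
  apply: der_eq.
    apply: derM; first exact: (der_cst (fun=> 2^-1)).
    exact: (derD (derD (derM (der_v X0) (der_v X0)) (derM (der_v X1) (der_v X1)))
             (derM (der_v X2) (der_v X2))).
  by move=> c t; rewrite /sum3; field.
have H0 : forall c t, onT c t -> H c t = H c 0.
  move=> c t [gd t0T]; have /andP[t0 tT] := t0T.
  apply/eqP; rewrite -subr_eq0 -normr_eq0 eq_le normr_ge0 andbT.
  have := @mean_value_bound R (H c) _ 0 t 0 t0 (fun s _ => dH c gd s).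
  rewrite mul0r; apply=> s /andP[s0 st].
  have ha k := g_a gd k (_ : 0 <= s <= T).
  have sT : 0 <= s <= T by rewrite s0 (le_trans st).
  rewrite normr_le0 -(mulrI_eq0 _ (mulfI (lt0r_neq0 (g_e0 gd)))).
  set q := (X in oe c * X); apply/eqP.
  have -> : oe c * q = sum3 (fun i => ov c s i * (oe c * oa c s i))
      - oe c * sum3 (fun i => ov c s i * Ef D i (ox c s)).
    by rewrite /q /sum3; ring.
  have -> : sum3 (fun i => ov c s i * (oe c * oa c s i)) =
    rho D (ox c s) * sum3 (fun i => ov c s i * cross3 (ov c s) (fun k => bet D k (ox c s)) i)
    + oe c * sum3 (fun i => ov c s i * Ef D i (ox c s)).
    by rewrite /sum3 !ha//; ring.
  by rewrite sum3_cross_self mulr0 add0r subrr.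
(* Twice the initial energy is at most [3 M^2 + 2 |K|], and the potential is at least [- |phimin|].
   So each squared component is at most [Q], which is below [(Q + 1)^2]. *)
pose Q := 3 * M ^+ 2 + 2 * (`|K| + `|phimin|).
have Q0 : 0 <= Q.
  by rewrite /Q; have := sqr_ge0 M; have := normr_ge0 K; have := normr_ge0 phimin; lra.
exists (Q + 1); first lra.
move=> c t ct; rewrite mulr1.
have hH := H0 c t ct; have [gd _] := ct.
have h0 k : ov c 0 k * ov c 0 k <= M ^+ 2.
  rewrite -expr2 -real_normK ?num_real//; have h := g_v0 gd k.
  by rewrite lerXn2r// nnegrE// (le_trans _ h).
have p0 : pot D (ox c 0) <= `|K|.
  apply: (le_trans (ler_norm _)); apply: (le_trans (HK _ (g_x0 gd))).
  exact: ler_norm.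
have p1 : - `|phimin| <= pot D (ox c t).
  by apply: le_trans (pot_lb _); rewrite lerNl -normrN ler_norm.
have q0 k : 0 <= ov c t k * ov c t k by rewrite -expr2 sqr_ge0.
have : ov c t i * ov c t i <= Q.
  move: hH; rewrite /H /sum3 /Q => hH.
  have := h0 X0; have := h0 X1; have := h0 X2.
  have := q0 X0; have := q0 X1; have := q0 X2.
  by case: i; lra.
rewrite -expr2 -real_normK ?num_real// => h.
rewrite leNgt; apply/negP => hc.
have : (Q + 1) * (Q + 1) <= `|ov c t i| ^+ 2.
  by rewrite expr2 ler_pM ?(ltW hc)//; lra.
nra.
Qed.

Lemma bounded_x i : B1 (x i).
Proof.
have h := der_bound (der_x i) (bounded_v i) (fun _ _ => erefl).
have h0 : B1 (fun c t => ox c 0 i).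
  by exists `|M| => // c t [gd _]; rewrite mulr1; apply: (le_trans (g_x0 gd i)); exact: ler_norm.
apply: (bO_eq _ (bOD h h0)) => c t _; by rewrite subrK.
Qed.

Lemma bounded_comp F : CC 2 F -> B1 (fun c t => F (ox c t)).
Proof. by move=> /CC_locbd h; apply: bO_comp => // i; exact: bounded_x. Qed.

Let bounded_rho := bounded_comp (rho_CC D).
Let bounded_bet i := bounded_comp (bet_CC D i).
Let bounded_betg i j := bounded_comp (betg_CC D i j).
Let bounded_E i := bounded_comp (Ef_CC D i).
Let bounded_rg i := bounded_comp (rhog_CC D i).

Definition irho c t := (rho D (ox c t))^-1.

Lemma rho_neq0 y : rho D y != 0.
Proof. by rewrite gt_eqF// (lt_le_trans ltr01)// rho_ge1. Qed.

Lemma bounded_irho : B1 irho.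
Proof.
exists 1 => // c t _; rewrite /irho mulr1; have h := rho_ge1 D (ox c t).
have h0 := lt_le_trans ltr01 h.
by rewrite ger0_norm ?invf_le1 ?invr_ge0 ?(ltW h0).
Qed.

Definition dirho c t :=
  sum3 (fun i => - irho c t * irho c t * rhog D i (ox c t) * ov c t i).

Lemma der_irho : der irho dirho.
Proof. exact: (der_comp (hasgradV (@rho_ge1 R D) (rho_grad D))). Qed.

Lemma bounded_dirho : B1 dirho.
Proof. by have := bounded_irho; have := bounded_v => ? ?; rewrite /dirho; bo. Qed.

Lemma slow_comp F : CC 2 F -> slow (fun c t => F (ox c t)).
Proof.
move=> H; have [_ [G d c]] := H.
exists (fun c t => sum3 (fun i => G i (ox c t) * ov c t i)); split.
- exact: der_comp.
- exact: bounded_comp.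
- have ? i : B1 (fun c t => G i (ox c t)).
    by apply: bO_comp; [exact: (CC_locbd (k := 1) (c i))|exact: bounded_x].
  by have := bounded_v => ?; bo.
Qed.

Lemma slow_irho : slow irho.
Proof. by exists dirho; split; [exact: der_irho|exact: bounded_irho|exact: bounded_dirho]. Qed.

Lemma slowM f g : slow f -> slow g -> slow (fun c t => f c t * g c t).
Proof.
move=> [f' [d1 b1 b1']] [g' [d2 b2 b2']].
exists (fun c t => f c t * g' c t + g c t * f' c t).
by split; [exact: derM|exact: bOMl|bo].
Qed.

Lemma slow_cst (k : R) : slow (fun _ _ => k).
Proof.
by exists (fun _ _ => 0); split; [exact: (der_cst (fun=> k))|exact: bO_cst|exact: bO_cst].
Qed.

Lemma osc_eq f g : (forall c t, onT c t -> f c t = g c t) -> osc g -> osc f.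
Proof.
move=> e [W [W' [d b h]]]; exists W, W'; split=> //.
by apply: bO_eq h => c t p; rewrite e.
Qed.

Lemma oscD f g : osc f -> osc g -> osc (fun c t => f c t + g c t).
Proof.
move=> [W [W' [d b h]]] [Z [Z' [d' b' h']]].
exists (fun c t => W c t + Z c t), (fun c t => W' c t + Z' c t); split.
- exact: derD.
- exact: bOD.
- by apply: bO_eq (bOD h h') => c t _; ring.
Qed.

(** Integration by parts: letting the derivative fall on the slow factor costs [eps W s'], which is
    [O(eps)]. *)
Lemma oscM s f : slow s -> osc f -> osc (fun c t => s c t * f c t).
Proof.
move=> [s' [ds bs bs']] [W [W' [d b h]]].
exists (fun c t => s c t * W c t), (fun c t => s c t * W' c t + W c t * s' c t); split.
- exact: derM.
- exact: bOMl.
- have h2 : Be (fun c t => oe c * (W c t * s' c t)).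
    by apply: bOMr; [exact: Be_eps|bo].
  by apply: bO_eq (bOB (bOMl bs h) h2) => c t _; ring.
Qed.

Lemma oscN f : osc f -> osc (fun c t => - f c t).
Proof.
move=> h; apply: osc_eq (oscM (slow_cst (-1)) h) => c t _.
by rewrite mulN1r.
Qed.

Lemma osc_sum3 (f : ix -> sig) : (forall i, osc (f i)) ->
  osc (fun c t => sum3 (fun i => f i c t)).
Proof. by move=> H; exact: (oscD (oscD (H X0) (H X1)) (H X2)). Qed.

Definition bc c t (i : ix) : R := bet D i (ox c t).
Definition dbc c t (i : ix) : R := sum3 (fun j => betg D i j (ox c t) * ov c t j).
Definition vpar c t : R := sum3 (fun i => bet D i (ox c t) * ov c t i).
Definition vperp c t (i : ix) : R := ov c t i - vpar c t * bet D i (ox c t).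
Definition vxb c t (i : ix) : R := cross3 (ov c t) (bc c t) i.

Definition dvpar c t : R := sum3 (fun i => bet D i (ox c t) * oa c t i + ov c t i * dbc c t i).
Definition dvxb c t (i : ix) : R := cross3 (oa c t) (bc c t) i + cross3 (ov c t) (dbc c t) i.
Definition dvperp c t (i : ix) : R :=
  oa c t i - (vpar c t * dbc c t i + bet D i (ox c t) * dvpar c t).

Lemma der_bc i : der (fun c t => bc c t i) (fun c t => dbc c t i).
Proof. exact: (der_comp (bet_grad D i)). Qed.

Lemma der_vpar : der vpar dvpar.
Proof.
exact: (derD (derD (derM (der_bc X0) (der_v X0)) (derM (der_bc X1) (der_v X1)))
             (derM (der_bc X2) (der_v X2))).
Qed.

Lemma der_vperp i : der (fun c t => vperp c t i) (fun c t => dvperp c t i).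
Proof. exact: (derD (der_v i) (derN (derM der_vpar (der_bc i)))). Qed.

Lemma der_vxb i : der (fun c t => vxb c t i) (fun c t => dvxb c t i).
Proof.
have h j k : der (fun c t => ov c t j * bc c t k - ov c t k * bc c t j)
  (fun c t => ov c t j * dbc c t k + bc c t k * oa c t j
    - (ov c t k * dbc c t j + bc c t j * oa c t k)).
  exact: (derD (derM (der_v j) (der_bc k)) (derN (derM (der_v k) (der_bc j)))).
by case: i; apply: der_eq (h _ _) _ => c t; rewrite /dvxb /cross3; ring.
Qed.

Lemma bounded_bc i : B1 (fun c t => bc c t i). Proof. exact: bounded_bet. Qed.

Lemma bounded_dbc i : B1 (fun c t => dbc c t i).
Proof. by have := bounded_v => ?; rewrite /dbc; bo. Qed.

Lemma bounded_vpar : B1 vpar. Proof. by have := bounded_v => ?; rewrite /vpar; bo. Qed.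

Lemma bounded_vperp i : B1 (fun c t => vperp c t i).
Proof. by have := bounded_v => ?; have := bounded_vpar => ?; rewrite /vperp; bo. Qed.

Lemma bounded_vxb i : B1 (fun c t => vxb c t i).
Proof. by have := bounded_v => ?; have := bounded_bc => ?; rewrite /vxb; case: i; bo. Qed.

(** The magnetic force is orthogonal to [b], so the [1/eps] part of the acceleration drops out. This
    makes the parallel velocity slow. *)
Lemma dvparE c t : onT c t -> dvpar c t =
  sum3 (fun i => bet D i (ox c t) * Ef D i (ox c t) + ov c t i * dbc c t i).
Proof.
move=> [gd tT]; apply: (mulfI (lt0r_neq0 (g_e0 gd))).
have ha k := g_a gd k tT.
transitivity (sum3 (fun i => bet D i (ox c t) * (oe c * oa c t i))
    + oe c * sum3 (fun i => ov c t i * dbc c t i)).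
  by rewrite /dvpar /sum3; ring.
rewrite /sum3 !ha.
have := sum3_cross_self2 (fun k => bet D k (ox c t)) (ov c t).
rewrite /sum3; set q0 := cross3 _ _ X0; set q1 := cross3 _ _ X1; set q2 := cross3 _ _ X2.
move=> h.
transitivity (rho D (ox c t) * (bet D X0 (ox c t) * q0 + bet D X1 (ox c t) * q1 + bet D X2 (ox c t) * q2)
  + oe c * (sum3 (fun i => bet D i (ox c t) * Ef D i (ox c t) + ov c t i * dbc c t i))).
  by rewrite /sum3; ring.
by rewrite h mulr0 add0r /sum3.
Qed.

Lemma bounded_dvpar : B1 dvpar.
Proof.
apply: (bO_eq dvparE); have := bounded_v => ?; have := bounded_dbc => ?; bo.
Qed.

Lemma slow_vpar : slow vpar.
Proof. by exists dvpar; split; [exact: der_vpar|exact: bounded_vpar|exact: bounded_dvpar]. Qed.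

Lemma unitE y : bet D X0 y ^+ 2 + bet D X1 y ^+ 2 + bet D X2 y ^+ 2 = 1.
Proof. exact: (bet_unit D y). Qed.

(** Uses [(v x b) x b = - vperp]. Together with [dvperpE] this is a rotation of the pair [vperp],
    [v x b] at frequency [rho / eps], perturbed by terms of size 1. *)
Lemma dvxbE c t i : onT c t -> oe c * dvxb c t i =
  - rho D (ox c t) * vperp c t i
  + oe c * (cross3 (fun k => Ef D k (ox c t)) (bc c t) i + cross3 (ov c t) (dbc c t) i).
Proof.
move=> [gd tT]; have ha k := g_a gd k tT; have e := unitE (ox c t).
have -> : oe c * dvxb c t i = cross3 (fun k => oe c * oa c t k) (bc c t) i
   + oe c * cross3 (ov c t) (dbc c t) i.
  by rewrite /dvxb; case: i; rewrite /cross3; ring.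
rewrite [X in _ = _ + X]mulrDr [RHS]addrA; congr (_ + _).
have -> : cross3 (fun k => oe c * oa c t k) (bc c t) i =
  cross3 (fun k => rho D (ox c t) * cross3 (ov c t) (bc c t) k + oe c * Ef D k (ox c t)) (bc c t) i.
  by case: i; rewrite /cross3 !ha.
rewrite /vperp -(mulr1 (ov c t i)) -e /vpar /bc.
by case: i; rewrite /cross3 /sum3; ring.
Qed.

Lemma dvperpE c t i : onT c t -> oe c * dvperp c t i =
  rho D (ox c t) * vxb c t i
  + oe c * (Ef D i (ox c t) - (vpar c t * dbc c t i + bet D i (ox c t) * dvpar c t)).
Proof.
move=> [gd tT]; have ha k := g_a gd k tT.
by rewrite /dvperp mulrBr ha /vxb /bc; ring.
Qed.

Lemma osc_vperp i : osc (fun c t => vperp c t i).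
Proof.
exists (fun c t => - (irho c t * vxb c t i)),
  (fun c t => - (irho c t * dvxb c t i + vxb c t i * dirho c t)); split.
- exact: (derN (derM der_irho (der_vxb i))).
- by have := bounded_vxb => ?; have := bounded_irho => ?; bo.
- apply: (@bO_eq _ _ _ _ _ _ (fun c t => oe c * (irho c t *
     (cross3 (fun k => Ef D k (ox c t)) (bc c t) i + cross3 (ov c t) (dbc c t) i)
     + vxb c t i * dirho c t))).
    move=> c t ct.
    transitivity (vperp c t i + irho c t * (oe c * dvxb c t i) + oe c * (vxb c t i * dirho c t)).
      by ring.
    by rewrite dvxbE// /irho; field; exact: rho_neq0.
  apply: bOMr; first exact: Be_eps.
  have := bounded_vxb => ?; have := bounded_irho => ?; have := bounded_dirho => ?; have := bounded_v => ?.
  by have := bounded_dbc => ?; have := bounded_bc => ?; case: i; bo.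
Qed.

(** By the rotation equations, [eps] times the derivative of [vperp_i vxb_j] is [rho] times this
    difference, up to [O(eps)]. *)
Lemma osc_quadratic i j : osc (fun c t => vxb c t i * vxb c t j - vperp c t i * vperp c t j).
Proof.
apply: (@osc_eq _ (fun c t => irho c t * (rho D (ox c t) * (vxb c t i * vxb c t j - vperp c t i * vperp c t j)))).
  by move=> c t _; rewrite /irho mulrA mulVf ?mul1r// rho_neq0.
apply: oscM; first exact: slow_irho.
exists (fun c t => vperp c t i * vxb c t j), (fun c t => vperp c t i * dvxb c t j + vxb c t j * dvperp c t i); split.
- exact: (derM (der_vperp i) (der_vxb j)).
- by have := bounded_vxb => ?; have := bounded_vperp => ?; bo.
- apply: (@bO_eq _ _ _ _ _ _ (fun c t => oe c * (- (vperp c t i *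
     (cross3 (fun k => Ef D k (ox c t)) (bc c t) j + cross3 (ov c t) (dbc c t) j)
     + vxb c t j * (Ef D i (ox c t) - (vpar c t * dbc c t i + bet D i (ox c t) * dvpar c t)))))).
    move=> c t ct.
    transitivity (rho D (ox c t) * (vxb c t i * vxb c t j - vperp c t i * vperp c t j)
      - (vperp c t i * (oe c * dvxb c t j) + vxb c t j * (oe c * dvperp c t i))).
      by ring.
    by rewrite dvxbE// dvperpE//; ring.
  apply: bOMr; first exact: Be_eps.
  have := bounded_vxb => ?; have := bounded_vperp => ?; have := bounded_v => ?.
  have := bounded_vpar => ?; have := bounded_dvpar => ?.
  by have := bounded_dbc => ?; have := bounded_bc => ?; case: j; bo.
Qed.

(** Half the squared perpendicular speed, by Pythagoras. *)
Definition vsq c t : R := 2^-1 * (sum3 (fun i => ov c t i * ov c t i) - vpar c t * vpar c t).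

(** For unit [b], the vectors [aperp] and [a x b] are orthogonal of equal length in the plane normal
    to [b], so their tensor squares add up to a multiple of the projection. The homogeneous form,
    with [n = |b|^2], is a polynomial identity. *)
Lemma perp_quadratic (a b : V3) i j :
  let n := b X0 ^+ 2 + b X1 ^+ 2 + b X2 ^+ 2 in
  let ub := a X0 * b X0 + a X1 * b X1 + a X2 * b X2 in
  (n * a i - ub * b i) * (n * a j - ub * b j) + n * (cross3 a b i * cross3 a b j) =
  (n * (a X0 ^+ 2 + a X1 ^+ 2 + a X2 ^+ 2) - ub ^+ 2) * (n * delta R i j - b i * b j).
Proof. by move=> n ub; rewrite /n /ub; case: i; case: j; rewrite /cross3 /delta; ring. Qed.

Lemma vperp_vxb_quadratic c t i j : vperp c t i * vperp c t j + vxb c t i * vxb c t j =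
  2 * vsq c t * (delta R i j - bet D i (ox c t) * bet D j (ox c t)).
Proof.
have := perp_quadratic (ov c t) (bc c t) i j; rewrite /= /bc unitE !mul1r => h.
rewrite /vperp /vxb /vsq /vpar /bc /sum3.
have e k : ov c t k - (bet D X0 (ox c t) * ov c t X0 + bet D X1 (ox c t) * ov c t X1 +
   bet D X2 (ox c t) * ov c t X2) * bet D k (ox c t) =
   ov c t k - (ov c t X0 * bet D X0 (ox c t) + ov c t X1 * bet D X1 (ox c t) +
   ov c t X2 * bet D X2 (ox c t)) * bet D k (ox c t) by ring.
by rewrite !e h; field.
Qed.

(** The sum of the tensor squares of [vperp] and [v x b] is explicit and their difference
    oscillates; hence [vperp] alone averages to half the sum. *)
Lemma osc_vperp_quadratic i j : osc (fun c t => vperp c t i * vperp c t j -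
  vsq c t * (delta R i j - bet D i (ox c t) * bet D j (ox c t))).
Proof.
apply: osc_eq (oscM (slow_cst (- 2^-1)) (osc_quadratic i j)) => c t _.
have h := vperp_vxb_quadratic c t i j.
have -> : vsq c t * (delta R i j - bet D i (ox c t) * bet D j (ox c t)) =
  2^-1 * (vperp c t i * vperp c t j + vxb c t i * vxb c t j) by rewrite h; field.
by field.
Qed.

Definition mom c t : R := irho c t * vsq c t.
Definition dmom c t : R :=
  irho c t * (sum3 (fun i => ov c t i * oa c t i) - vpar c t * dvpar c t) + vsq c t * dirho c t.
Definition bE (y : V3) : R := sum3 (fun i => bet D i y * Ef D i y).
Definition bR (y : V3) : R := sum3 (fun i => bet D i y * rhog D i y).

Lemma bE_CC : CC 2 bE.
Proof. by apply: (@CC_sum3 R 2 (fun i y => bet D i y * Ef D i y)) => i; exact: (CCM (bet_CC D i) (Ef_CC D i)). Qed.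

Lemma bR_CC : CC 2 bR.
Proof. by apply: (@CC_sum3 R 2 (fun i y => bet D i y * rhog D i y)) => i; exact: (CCM (bet_CC D i) (rhog_CC D i)). Qed.

Lemma der_mom : der mom dmom.
Proof.
apply: derM; first exact: der_irho.
apply: der_eq.
  apply: derM; first exact: (der_cst (fun=> 2^-1)).
  apply: derD.
    exact: (derD (derD (derM (der_v X0) (der_v X0)) (derM (der_v X1) (der_v X1)))
             (derM (der_v X2) (der_v X2))).
  exact: (derN (derM der_vpar der_vpar)).
by move=> c t; rewrite /sum3; field.
Qed.

Lemma bounded_vsq : B1 vsq.
Proof. by have := bounded_v => ?; have := bounded_vpar => ?; rewrite /vsq; bo. Qed.

Lemma bounded_mom : B1 mom.
Proof. by have := bounded_vsq => ?; have := bounded_irho => ?; rewrite /mom; bo. Qed.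

Lemma dmomE c t : onT c t -> dmom c t =
  irho c t * (sum3 (fun i => ov c t i * Ef D i (ox c t)) - vpar c t * dvpar c t) + vsq c t * dirho c t.
Proof.
move=> [gd tT]; rewrite /dmom; congr (irho c t * (_ - _) + _).
apply: (mulfI (lt0r_neq0 (g_e0 gd))).
have ha k := g_a gd k tT.
transitivity (sum3 (fun i => ov c t i * (oe c * oa c t i))); first by rewrite /sum3; ring.
have h := sum3_cross_self (ov c t) (fun k => bet D k (ox c t)).
transitivity (rho D (ox c t) * sum3 (fun i => ov c t i * cross3 (ov c t) (fun k => bet D k (ox c t)) i)
   + oe c * sum3 (fun i => ov c t i * Ef D i (ox c t))).
  by rewrite /sum3 !ha; ring.
by rewrite h mulr0 add0r.
Qed.

Lemma slow_mom : slow mom.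
Proof.
exists dmom; split; [exact: der_mom|exact: bounded_mom|].
apply: (bO_eq dmomE).
have := bounded_v => ?; have := bounded_vpar => ?; have := bounded_vsq => ?; have := bounded_irho => ?.
have := bounded_dirho => ?; have := bounded_dvpar => ?; bo.
Qed.

(** In [v . b' v] the left factor reduces to [vperp], since [b . b' = 0]. The part linear in [vperp]
    oscillates; the quadratic part averages to [vsq] times the trace of [b']. *)
Lemma osc_dvpar : osc (fun c t => dvpar c t - (bE (ox c t) - mom c t * bR (ox c t))).
Proof.
have s1 i j := slow_comp (betg_CC D i j).
have s2 j := slow_comp (bet_CC D j).
apply: (@osc_eq _ (fun c t =>
  sum3 (fun i => sum3 (fun j => betg D i j (ox c t) * (vperp c t i * vperp c t j -
    vsq c t * (delta R i j - bet D i (ox c t) * bet D j (ox c t)))))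
  + sum3 (fun i => sum3 (fun j => (vpar c t * bet D j (ox c t)) * betg D i j (ox c t) * vperp c t i)))); last first.
  apply: oscD.
    apply: (osc_sum3 (f := fun i c t => sum3 (fun j => _))) => i.
    apply: (osc_sum3 (f := fun j c t => _)) => j.
    exact: (oscM (s1 i j) (osc_vperp_quadratic i j)).
  apply: (osc_sum3 (f := fun i c t => sum3 (fun j => _))) => i.
  apply: (osc_sum3 (f := fun j c t => _)) => j.
  exact: (oscM (slowM (slowM slow_vpar (s2 j)) (s1 i j)) (osc_vperp i)).
move=> c t ct; rewrite dvparE//.
have o0 := bet_ortho D X0 (ox c t); have o1 := bet_ortho D X1 (ox c t).
have o2 := bet_ortho D X2 (ox c t).
have dv := bet_div D (ox c t).
(* [bet_div] identifies the trace of [b'] with the mirror force. *)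
have mE : mom c t * bR (ox c t) = - (vsq c t * sum3 (fun i => betg D i i (ox c t))).
  have -> : bR (ox c t) = - (rho D (ox c t) * sum3 (fun i => betg D i i (ox c t))).
    by rewrite dv opprK.
  by rewrite /mom /irho; field; exact: rho_neq0.
rewrite mE.
(* All [O j] vanish by [bet_ortho]; multiples of them are inserted so that [ring] proves what
   remains. *)
pose O j := sum3 (fun i => bet D i (ox c t) * betg D i j (ox c t)).
transitivity (sum3 (fun i => vperp c t i * dbc c t i) + vpar c t * sum3 (fun j => O j * ov c t j)
   - vsq c t * sum3 (fun i => betg D i i (ox c t))).
  by rewrite /O /vperp /dbc /bE /sum3; ring.
rewrite [X in _ + vpar c t * X - _](_ : _ = 0); last first.
  by rewrite /sum3 /O o0 o1 o2 !mul0r !addr0.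
rewrite mulr0 addr0.
transitivity (sum3
    (fun i =>
     sum3
       (fun j =>
        betg D i j (ox c t) *
        (vperp c t i * vperp c t j -
         vsq c t * (delta R i j)))) +
  sum3 (fun i => sum3 (fun j => vpar c t * bet D j (ox c t) * betg D i j (ox c t) * vperp c t i))
  + vsq c t * sum3 (fun j => O j * bet D j (ox c t))).
  rewrite [X in _ + vsq c t * X](_ : _ = 0); last first.
    by rewrite /sum3 /O o0 o1 o2 !mul0r !addr0.
  have e j : ov c t j = vperp c t j + vpar c t * bet D j (ox c t) by rewrite /vperp subrK.
  rewrite /dbc mulr0 addr0 /sum3 !e; move: (vperp c t) => ww.
  by rewrite /delta; ring.
by rewrite /O /sum3; move: (vperp c t) => ww; ring.
Qed.

(** With [u' = b.E - m b.grad rho] up to oscillation, the electric work along [b] cancels against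
    [u u'], and the mirror term against the derivative of [1/rho]. Only slow factors times
    oscillating ones are left. *)
Lemma osc_dmom : osc dmom.
Proof.
have s1 i := slow_comp (Ef_CC D i).
have s2 i := slow_comp (rhog_CC D i).
apply: (@osc_eq _ (fun c t =>
  sum3 (fun i => (irho c t * Ef D i (ox c t)) * vperp c t i)
  + - ((irho c t * vpar c t) * (dvpar c t - (bE (ox c t) - mom c t * bR (ox c t))))
  + - sum3 (fun i => (mom c t * irho c t * rhog D i (ox c t)) * vperp c t i))); last first.
  apply: oscD; first apply: oscD.
  - apply: (osc_sum3 (f := fun i c t => _)) => i.
    exact: (oscM (slowM slow_irho (s1 i)) (osc_vperp i)).
  - by apply: oscN; exact: (oscM (slowM slow_irho slow_vpar) osc_dvpar).
  - apply: oscN; apply: (osc_sum3 (f := fun i c t => _)) => i.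
    exact: (oscM (slowM (slowM slow_mom slow_irho) (s2 i)) (osc_vperp i)).
move=> c t ct; rewrite dmomE//.
have e j : ov c t j = vperp c t j + vpar c t * bet D j (ox c t) by rewrite /vperp subrK.
rewrite /dirho /mom /bE /bR /sum3 !e; move: (vperp c t) => ww.
by ring.
Qed.

Lemma onT0 c t : onT c t -> onT c 0.
Proof. by move=> [gd _]; split=> //; rewrite lexx ltW. Qed.

Lemma bO_at0 (g f : sig) : bO onT g f -> bO onT (fun c _ => g c 0) (fun c _ => f c 0).
Proof. by move=> [C C0 H]; exists C => // c t /onT0; exact: H. Qed.

Lemma osc_drift f f' : der f f' -> osc f' -> Be (fun c t => f c t - f c 0).
Proof.
move=> d [W [W' [dW bW h]]].
have h1 := der_bound (derD d (derN (derM (der_cst (fun c => oe c)) dW))).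
have h2 : Be (fun c t => (f c t - oe c * W c t) - (f c 0 - oe c * W c 0)).
  apply: h1 => //; apply: bO_eq h => c t _; ring.
have h3 : Be (fun c t => oe c * W c t) by apply: bOMr => //; exact: Be_eps.
have h4 : Be (fun c t => oe c * W c 0) := bO_at0 h3.
by apply: bO_eq (bOD h2 (bOB h3 h4)) => c t _; ring.
Qed.

Lemma mom_drift : Be (fun c t => mom c t - mom c 0).
Proof. exact: (osc_drift der_mom osc_dmom). Qed.

Definition gforce c (y : V3) : R := bE y - mom c 0 * bR y.

Lemma guiding_center : exists (X dX : trajectory -> R -> V3) (U dU : sig),
  [/\ forall i, der (fun c t => X c t i) (fun c t => dX c t i), der U dU,
      forall i, Be (fun c t => X c t i - ox c t i) & Be (fun c t => U c t - vpar c t)] /\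
  (forall i, Be (fun c t => dX c t i - U c t * bet D i (X c t))) /\
  Be (fun c t => dU c t - gforce c (X c t)).
Proof.
have [W [W' [dW bW hW]]] : exists W W' : trajectory -> R -> V3,
  [/\ forall i, der (fun c t => W c t i) (fun c t => W' c t i),
      forall i, B1 (fun c t => W c t i)
    & forall i, Be (fun c t => vperp c t i - oe c * W' c t i)].
  have [A0 [A0' [d0 b0 h0]]] := osc_vperp X0; have [A1 [A1' [d1 b1 h1]]] := osc_vperp X1.
  have [A2 [A2' [d2 b2 h2]]] := osc_vperp X2.
  exists (fun c t i => match i with X0 => A0 c t | X1 => A1 c t | X2 => A2 c t end),
   (fun c t i => match i with X0 => A0' c t | X1 => A1' c t | X2 => A2' c t end).
  by split; case.
have [Z [Z' [dZ bZ hZ]]] := osc_dvpar.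
pose X c t i := ox c t i - oe c * W c t i.
pose dX c t i := ov c t i - oe c * W' c t i.
pose U c t := vpar c t - oe c * Z c t.
pose dU c t := dvpar c t - oe c * Z' c t.
have cX i : Be (fun c t => X c t i - ox c t i).
  apply: (@bO_eq _ _ _ _ _ _ (fun c t => - (oe c * W c t i))).
    by move=> c t _; rewrite /X; ring.
  by apply: bON; apply: bOMr => //; exact: Be_eps.
have cU : Be (fun c t => U c t - vpar c t).
  apply: (@bO_eq _ _ _ _ _ _ (fun c t => - (oe c * Z c t))).
    by move=> c t _; rewrite /U; ring.
  by apply: bON; apply: bOMr => //; exact: Be_eps.
have bX i : B1 (fun c t => X c t i).
  apply: (@bO_eq _ _ _ _ _ _ (fun c t => (X c t i - ox c t i) + ox c t i)).
    by move=> c t _; rewrite subrK.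
  by apply: bOD; [exact: Be_B1|exact: bounded_x].
have lipX F : CC 2 F -> Be (fun c t => F (X c t) - F (ox c t)).
  by move=> hF; apply: bO_lip => //; [exact/CC_loclip/CC_S|exact: bounded_x].
exists X, dX, U, dU; split; first split=> //.
- move=> i; apply: der_eq.
    exact: (derD (der_x i) (derN (derM (der_cst (fun c => oe c)) (dW i)))).
  by move=> c t; rewrite /dX; ring.
- apply: der_eq.
    exact: (derD der_vpar (derN (derM (der_cst (fun c => oe c)) dZ))).
  by move=> c t; rewrite /dU; ring.
split=> [i|].
  apply: (@bO_eq _ _ _ _ _ _ (fun c t => (vperp c t i - oe c * W' c t i)
     - (vpar c t * (bet D i (X c t) - bet D i (ox c t)) + (U c t - vpar c t) * bet D i (X c t)))).
    by move=> c t _; rewrite /dX /vperp; ring.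
  apply: bOB => //; apply: bOD.
    by apply: bOMl; [exact: bounded_vpar|apply: lipX; exact: bet_CC].
  by apply: bOMr => //; apply: bO_comp => //; exact: (CC_locbd (bet_CC D i)).
(* Three sources of defect: the remainder of the oscillating part, the shift from [x] to [X] in the
   force, and the drift of the moment away from its initial value. *)
apply: (@bO_eq _ _ _ _ _ _ (fun c t =>
  (dvpar c t - (bE (ox c t) - mom c t * bR (ox c t)) - oe c * Z' c t)
  - (bE (X c t) - bE (ox c t)) + mom c 0 * (bR (X c t) - bR (ox c t))
  - (mom c t - mom c 0) * bR (ox c t))).
  by move=> c t _; rewrite /dU /gforce; ring.
have lE := lipX _ bE_CC; have lR := lipX _ bR_CC.
apply: bOB; first apply: bOD; first apply: bOB => //.
  by apply: bOMl => //; exact: (bO_at0 bounded_mom).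
by apply: bOMr; [exact: mom_drift|apply: bounded_comp; exact: bR_CC].
Qed.
End ExactDynamics.

(** * Finite differences of the guiding-centre path *)

Lemma bO_reindex (R : realType) (A J J' : Type) (P : A -> J -> Prop)
    (P' : A -> J' -> Prop) (k : A -> J' -> J) (g f : A -> J -> R) :
  (forall a j, P' a j -> P a (k a j)) -> bO P g f ->
  bO P' (fun a j => g a (k a j)) (fun a j => f a (k a j)).
Proof. by move=> H [C C0 h]; exists C => // a j /H; exact: h. Qed.

(** The increment [s] varies while the time [t] and the step [h] stay fixed. [Q] survives decreasing
    [s], so the derivative bound holds on all of [[0, s]], and [s <= h] supplies the extra factor
    [h]. *)
Lemma bO_integrate (R : realType) (A : Type) (Q : A -> R * R * R -> Prop)
    (F dF : A -> R * R -> R -> R) (g : A -> R * R -> R) :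
  (forall a t h s, Q a (t, h, s) ->
     0 <= s <= h /\ forall s', 0 <= s' <= s -> Q a (t, h, s')) ->
  (forall a t h s, Q a (t, h, s) ->
     is_derive s (1 : R) (F a (t, h)) (dF a (t, h) s)) ->
  (forall a j, F a j 0 = 0) ->
  bO Q (fun a j => g a j.1) (fun a j => dF a j.1 j.2) ->
  bO Q (fun a j => j.1.2 * g a j.1) (fun a j => F a j.1 j.2).
Proof.
move=> hQ hd h0 [C C0 H]; exists C => // a [[t h] s] q /=.
have [/andP[s0 sh] hs] := hQ _ _ _ _ q.
have := @mean_value_bound R (F a (t, h)) (dF a (t, h)) 0 s (C * g a (t, h)) s0.
rewrite h0 !subr0 => m; apply: (le_trans (m _ _)).
- by move=> s' h'; apply: hd; exact: hs.
- by move=> s' h'; apply: (H a (t, h, s')); exact: hs.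
rewrite mulrCA mulrC ler_wpM2r//.
apply: (le_trans (normr_ge0 (dF a (t, h) s))).
by apply: (H a (t, h, s)).
Qed.

Lemma is_derive_shift_add (R : realType) (f : R -> R) d t s :
  is_derive (t + s) (1 : R) f d -> is_derive s (1 : R) (fun s => f (t + s)) d.
Proof.
move=> h.
have ha := is_derive_affine t 1 s.
have h' : is_derive (t + s * 1) (1 : R) f d by rewrite mulr1.
have hc := is_derive1_comp (g := fun s => t + s * 1) h' ha.
rewrite (_ : (fun s => f (t + s)) = f \o (fun s => t + s * 1)); last first.
  by apply/funext => z /=; rewrite mulr1.
by apply: is_derive_eq; rewrite mulr1.
Qed.

Lemma is_derive_shift_sub (R : realType) (f : R -> R) d t s :
  is_derive (t - s) (1 : R) f d -> is_derive s (1 : R) (fun s => f (t - s)) (- d).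
Proof.
move=> h.
have ha := is_derive_affine t (-1) s.
have h' : is_derive (t + s * -1) (1 : R) f d by rewrite mulrN1.
have hc := is_derive1_comp (g := fun s => t + s * -1) h' ha.
rewrite (_ : (fun s => f (t - s)) = f \o (fun s => t + s * -1)); last first.
  by apply/funext => z /=; rewrite mulrN1.
by apply: is_derive_eq; rewrite mulrN1.
Qed.

Section CentredDifferences.
Variables (R : realType) (D : field_data R) (T M : R).
Hypothesis T0 : 0 < T.
Variable phimin : R.
Hypothesis pot_lb : forall y, phimin <= pot D y.
Variable Lam : R.
Hypothesis Lam0 : 0 < Lam.
Notation V3 := (ix -> R).
Notation good := (good D T M).
Notation onT := (onT D T M).
Notation one := (fun _ _ => 1 : R).
Notation Be := (bO onT (fun c _ => oe c)).
Notation B1 := (bO onT one).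
Notation sig := (trajectory R -> R -> R).
Implicit Types (Y dY F : sig) (j : R * R * R).

(* a triple is (time, step size, increment) *)
Definition fwd (c : trajectory R) j := good c /\
  [/\ 0 <= j.1.1, j.1.1 + j.1.2 <= T, 0 <= j.2 <= j.1.2, 0 < j.1.2 <= 1 &
      oe c <= Lam * j.1.2 ^+ 2].

Definition ctr (c : trajectory R) j := good c /\
  [/\ j.1.2 <= j.1.1, j.1.1 + j.1.2 <= T, 0 <= j.2 <= j.1.2, 0 < j.1.2 <= 1 &
      oe c <= Lam * j.1.2 ^+ 2].

Notation H1 := (fun (_ : trajectory R) j => j.1.2).
Notation H2 := (fun (_ : trajectory R) j => j.1.2 ^+ 2).
Notation H3 := (fun (_ : trajectory R) j => j.1.2 ^+ 3).

Lemma fwd_down c t h s : fwd c (t, h, s) ->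
  0 <= s <= h /\ forall s', 0 <= s' <= s -> fwd c (t, h, s').
Proof.
move=> [gd [/= a1 a2 /andP[a3 a4] a5 a6]]; split; first by rewrite a3.
by move=> s' /andP[b1 b2]; split=> //; split=> //=; rewrite b1 (le_trans b2).
Qed.

Lemma ctr_down c t h s : ctr c (t, h, s) ->
  0 <= s <= h /\ forall s', 0 <= s' <= s -> ctr c (t, h, s').
Proof.
move=> [gd [/= a1 a2 /andP[a3 a4] a5 a6]]; split; first by rewrite a3.
by move=> s' /andP[b1 b2]; split=> //; split=> //=; rewrite b1 (le_trans b2).
Qed.

Lemma ctr_fwd c j : ctr c j -> fwd c j.
Proof.
move=> [gd [a1 a2 a3 /andP[a4 a4'] a5]]; split=> //; split=> //; last by rewrite a4.
by rewrite (le_trans _ a1)// ltW.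
Qed.

Lemma ctr_fwd_back c j : ctr c j -> fwd c (j.1.1 - j.2, j.1.2, j.2).
Proof.
move=> [gd [a1 a2 /andP[a3 a3'] /andP[a4 a4'] a5]]; split=> //; split=> //=.
- by lra.
- by lra.
- by rewrite a3.
- by rewrite a4.
Qed.

Lemma fwd_onT c j : fwd c j -> onT c (j.1.1 + j.2).
Proof.
move=> [gd [a1 a2 /andP[a3 a3'] /andP[a4 a4'] a5]]; split=> //; lra.
Qed.

Lemma fwd_onT0 c j : fwd c j -> onT c j.1.1.
Proof.
move=> [gd [a1 a2 /andP[a3 a3'] /andP[a4 a4'] a5]]; split=> //; lra.
Qed.

Lemma ctr_onT_sub c j : ctr c j -> onT c (j.1.1 - j.2).
Proof. by move=> /ctr_fwd_back /fwd_onT0. Qed.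

Lemma H21 Q : (forall c j, Q c j -> fwd c j) -> bO Q H1 H2.
Proof.
move=> QF; exists 1 => // c j /QF[_ [_ _ _ /andP[/ltW h0 h1] _]].
by rewrite mul1r ger0_norm ?sqr_ge0// expr2 ler_piMl.
Qed.

Lemma eps_H2 Q : (forall c j, Q c j -> fwd c j) -> bO Q H2 (fun c j => oe c).
Proof.
move=> QF; exists Lam => [|c j /QF[gd [_ _ _ _ h]]]; first exact: ltW.
by rewrite ger0_norm// ltW//; exact: (g_e0 gd).
Qed.

Section OneSignal.
Variables (Y dY F : sig).
Hypothesis dYd : der D T M Y dY.
Hypothesis dYF : Be (fun c t => dY c t - F c t).
Hypothesis bF : B1 F.

Lemma dY_bounded : B1 dY.
Proof.
apply: (@bO_eq _ _ _ _ _ _ (fun c t => (dY c t - F c t) + F c t)).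
  by move=> c t _; rewrite subrK.
by apply: bOD => //; exact: (Be_B1 dYF).
Qed.

Lemma fwd_diff : bO fwd H1 (fun c j => Y c (j.1.1 + j.2) - Y c j.1.1).
Proof.
have h := @bO_integrate R (trajectory R) fwd (fun c th s => Y c (th.1 + s) - Y c th.1)
  (fun c th s => dY c (th.1 + s)) (fun _ _ => 1) fwd_down.
apply: bO_trans (h _ _ _) _.
- move=> c t hh s [gd _] /=.
  have h1 : is_derive s (1 : R) (fun s => Y c (t + s)) (dY c (t + s)).
    by apply: is_derive_shift_add; exact: dYd.
  have h2 : is_derive s (1 : R) (cst (Y c t) : R -> R) 0 by exact: is_derive_cst.
  have h3 := is_deriveB h1 h2.
  by apply: is_derive_eq; rewrite subr0.
- by move=> c j /=; rewrite addr0 subrr.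
- exact: (bO_reindex (k := fun c j => j.1.1 + j.2) fwd_onT dY_bounded).
- exists 1 => // c j [_ [_ _ _ /andP[h0 h1] _]].
  by rewrite mulr1 mul1r ger0_norm// ltW.
Qed.

Lemma ctr_second : bO ctr H1 (fun c j => F c (j.1.1 + j.2) - F c (j.1.1 - j.2)) ->
  bO ctr H2 (fun c j => Y c (j.1.1 + j.2) + Y c (j.1.1 - j.2) - 2 * Y c j.1.1).
Proof.
move=> hF.
have h := @bO_integrate R (trajectory R) ctr
  (fun c th s => Y c (th.1 + s) + Y c (th.1 - s) - 2 * Y c th.1)
  (fun c th s => dY c (th.1 + s) - dY c (th.1 - s)) (fun _ th => th.2) ctr_down.
apply: (h _ _ _).
- move=> c t hh s [gd _] /=.
  have h1 : is_derive s (1 : R) (fun s => Y c (t + s)) (dY c (t + s)).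
    by apply: is_derive_shift_add; exact: dYd.
  have h1' : is_derive s (1 : R) (fun s => Y c (t - s)) (- dY c (t - s)).
    by apply: is_derive_shift_sub; exact: dYd.
  have h2 : is_derive s (1 : R) (cst (2 * Y c t) : R -> R) 0 by exact: is_derive_cst.
  have h3 := is_deriveB (is_deriveD h1 h1') h2.
  by apply: is_derive_eq; rewrite subr0.
- by move=> c j /=; rewrite addr0 subr0; ring.
apply: (@bO_eq _ _ _ _ _ _ (fun c j => (F c (j.1.1 + j.2) - F c (j.1.1 - j.2))
   + ((dY c (j.1.1 + j.2) - F c (j.1.1 + j.2)) - (dY c (j.1.1 - j.2) - F c (j.1.1 - j.2))))).
  by move=> c j _ /=; ring.
apply: bOD => //.
have e1 := bO_trans (eps_H2 ctr_fwd) (H21 ctr_fwd).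
apply: bOB.
  apply: bO_trans e1.
  exact: (bO_reindex (k := fun c j => j.1.1 + j.2) (fun c j q => fwd_onT (ctr_fwd q)) dYF).
apply: bO_trans e1.
exact: (bO_reindex (k := fun c j => j.1.1 - j.2) ctr_onT_sub dYF).
Qed.

(** [Y] is not expanded in powers of [s], since [dY] is known only up to [O(eps)]. The
    [s]-derivative of the centred defect is a second difference of [F] plus [O(eps)], hence
    [O(h^2)]. *)
Lemma ctr_step :
  bO ctr H2 (fun c j => F c (j.1.1 + j.2) + F c (j.1.1 - j.2) - 2 * F c j.1.1) ->
  bO ctr H3 (fun c j => Y c (j.1.1 + j.2) - Y c (j.1.1 - j.2) - 2 * j.2 * F c j.1.1).
Proof.
move=> hF.
have h := @bO_integrate R (trajectory R) ctr
  (fun c th s => Y c (th.1 + s) - Y c (th.1 - s) - (0 + s * (2 * F c th.1)))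
  (fun c th s => dY c (th.1 + s) + dY c (th.1 - s) - 2 * F c th.1)
  (fun _ th => th.2 ^+ 2) ctr_down.
apply: (@bO_eq _ _ _ _ _ _ (fun c j => Y c (j.1.1 + j.2) - Y c (j.1.1 - j.2)
   - (0 + j.2 * (2 * F c j.1.1)))).
  by move=> c j _; ring.
apply: bO_trans (h _ _ _) _.
- move=> c t hh s [gd _] /=.
  have h1 : is_derive s (1 : R) (fun s => Y c (t + s)) (dY c (t + s)).
    by apply: is_derive_shift_add; exact: dYd.
  have h1' : is_derive s (1 : R) (fun s => Y c (t - s)) (- dY c (t - s)).
    by apply: is_derive_shift_sub; exact: dYd.
  have h2 := is_derive_affine 0 (2 * F c t) s.
  have h3 := is_deriveB (is_deriveB h1 h1') h2.
  by apply: is_derive_eq; rewrite opprK.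
- by move=> c j /=; rewrite addr0 subr0; ring.
- apply: (@bO_eq _ _ _ _ _ _ (fun c j => (F c (j.1.1 + j.2) + F c (j.1.1 - j.2) - 2 * F c j.1.1)
   + ((dY c (j.1.1 + j.2) - F c (j.1.1 + j.2)) + (dY c (j.1.1 - j.2) - F c (j.1.1 - j.2))))).
    by move=> c j _ /=; ring.
  have e1 := eps_H2 ctr_fwd.
  apply: bOD => //; apply: bOD.
    apply: bO_trans e1.
    exact: (bO_reindex (k := fun c j => j.1.1 + j.2) (fun c j q => fwd_onT (ctr_fwd q)) dYF).
  apply: bO_trans e1.
  exact: (bO_reindex (k := fun c j => j.1.1 - j.2) ctr_onT_sub dYF).
- exists 1 => // c j [_ [_ _ _ /andP[h0 h1] _]].
  rewrite mul1r -exprS ger0_norm// exprn_ge0// ltW//.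
Qed.

(** Meant for the step from 0 to [h] only; its [O(h^2)] defect enters once and does not
    accumulate. *)
Lemma fwd_step : bO fwd H1 (fun c j => F c (j.1.1 + j.2) - F c j.1.1) ->
  bO fwd H2 (fun c j => Y c (j.1.1 + j.2) - Y c j.1.1 - j.2 * F c j.1.1).
Proof.
move=> hF.
have h := @bO_integrate R (trajectory R) fwd
  (fun c th s => Y c (th.1 + s) - Y c th.1 - (0 + s * F c th.1))
  (fun c th s => dY c (th.1 + s) - F c th.1) (fun _ th => th.2) fwd_down.
apply: (@bO_eq _ _ _ _ _ _ (fun c j => Y c (j.1.1 + j.2) - Y c j.1.1
   - (0 + j.2 * F c j.1.1))).
  by move=> c j _; ring.
apply: (h _ _ _).
- move=> c t hh s [gd _] /=.
  have h1 : is_derive s (1 : R) (fun s => Y c (t + s)) (dY c (t + s)).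
    by apply: is_derive_shift_add; exact: dYd.
  have h1' : is_derive s (1 : R) (cst (Y c t) : R -> R) 0 by exact: is_derive_cst.
  have h2 := is_derive_affine 0 (F c t) s.
  have h3 := is_deriveB (is_deriveB h1 h1') h2.
  by apply: is_derive_eq; rewrite subr0.
- by move=> c j /=; rewrite addr0; ring.
apply: (@bO_eq _ _ _ _ _ _ (fun c j => (F c (j.1.1 + j.2) - F c j.1.1)
   + (dY c (j.1.1 + j.2) - F c (j.1.1 + j.2)))).
  by move=> c j _ /=; ring.
apply: bOD => //.
apply: bO_trans (bO_trans (eps_H2 (fun c j h => h)) (H21 (fun c j h => h))).
exact: (bO_reindex (k := fun c j => j.1.1 + j.2) fwd_onT dYF).
Qed.

End OneSignal.

Lemma guiding_center_steps : exists (X : trajectory R -> R -> V3) (U : sig),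
  [/\ forall i, Be (fun c t => X c t i - ox c t i),
      Be (fun c t => U c t - vpar D c t),
      forall i, bO ctr H3 (fun c j => X c (j.1.1 + j.2) i - X c (j.1.1 - j.2) i
                   - 2 * j.2 * (U c j.1.1 * bet D i (X c j.1.1))) &
      bO ctr H3 (fun c j => U c (j.1.1 + j.2) - U c (j.1.1 - j.2)
                   - 2 * j.2 * gforce D c (X c j.1.1))] /\
  (forall i, bO fwd H2 (fun c j => X c (j.1.1 + j.2) i - X c j.1.1 i
                   - j.2 * (U c j.1.1 * bet D i (X c j.1.1)))) /\
  bO fwd H2 (fun c j => U c (j.1.1 + j.2) - U c j.1.1 - j.2 * gforce D c (X c j.1.1)).
Proof.
have [X [dX [U [dU [[dXd dUd cX cU] [eX eU]]]]]] := @guiding_center R D T M T0 phimin pot_lb.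
have bX i : B1 (fun c t => X c t i).
  apply: (@bO_eq _ _ _ _ _ _ (fun c t => (X c t i - ox c t i) + ox c t i)).
    by move=> c t _; rewrite subrK.
  by apply: bOD; [exact: Be_B1|exact: (@bounded_x R D T M T0 phimin pot_lb)].
have bU : B1 U.
  apply: (@bO_eq _ _ _ _ _ _ (fun c t => (U c t - vpar D c t) + vpar D c t)).
    by move=> c t _; rewrite subrK.
  by apply: bOD; [exact: Be_B1|exact: (@bounded_vpar R D T M T0 phimin pot_lb)].
have bm : B1 (fun c _ => mom D c 0).
  exact: (bO_at0 T0 (@bounded_mom R D T M T0 phimin pot_lb)).
have bFX (F : V3 -> R) : CC 2 F -> B1 (fun c t => F (X c t)).
  by move=> /CC_locbd h; exact: bO_comp.
have bb i := bFX _ (bet_CC D i).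
have bFi i : B1 (fun c t => U c t * bet D i (X c t)) := bOMl bU (bb i).
have bG : B1 (fun c t => gforce D c (X c t)).
  by apply: bOB; [exact: (bFX _ (bE_CC D))|apply: bOMl => //; exact: (bFX _ (bR_CC D))].
(* A ladder: first differences of [X] and [U] are [O(h)]; they give second differences [O(h^2)],
   then second differences of the right-hand sides, which is the premise of [ctr_step]. *)
have XI i := fwd_diff (dXd i) (eX i) (bFi i).
have UI := fwd_diff dUd eU bG.
have fS c j : fwd c j -> onT c (j.1.1 + j.2) by exact: fwd_onT.
have f0 c j : fwd c j -> onT c j.1.1 by exact: fwd_onT0.
have rF (f : sig) (h : B1 f) : bO fwd (fun _ _ => 1) (fun c j => f c (j.1.1 + j.2)).
  exact: (bO_reindex (k := fun c j => j.1.1 + j.2) fS h).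
have rF0 (f : sig) (h : B1 f) : bO fwd (fun _ _ => 1) (fun c j => f c (j.1.1)).
  exact: (bO_reindex (k := fun c j => j.1.1) f0 h).
have lipf (F : V3 -> R) : CC 2 F -> bO fwd H1 (fun c j => F (X c (j.1.1 + j.2)) - F (X c j.1.1)).
  move=> hF; apply: bO_lip; first exact/CC_loclip/CC_S.
  - by move=> i; exact: (rF _ (bX i)).
  - by move=> i; exact: (rF0 _ (bX i)).
  - exact: XI.
have FI i : bO fwd H1 (fun c j => U c (j.1.1 + j.2) * bet D i (X c (j.1.1 + j.2))
    - U c j.1.1 * bet D i (X c j.1.1)).
  apply: (@bO_eq _ _ _ _ _ _ (fun c j =>
    U c (j.1.1 + j.2) * (bet D i (X c (j.1.1 + j.2)) - bet D i (X c j.1.1))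
    + (U c (j.1.1 + j.2) - U c j.1.1) * bet D i (X c j.1.1))).
    by move=> c j _; ring.
  apply: bOD; first by apply: bOMl; [exact: (rF _ bU)|exact: (lipf _ (bet_CC D i))].
  by apply: bOMr => //; exact: (rF0 _ (bb i)).
have GI : bO fwd H1 (fun c j => gforce D c (X c (j.1.1 + j.2)) - gforce D c (X c j.1.1)).
  apply: (@bO_eq _ _ _ _ _ _ (fun c j =>
    (bE D (X c (j.1.1 + j.2)) - bE D (X c j.1.1)) -
    mom D c 0 * (bR D (X c (j.1.1 + j.2)) - bR D (X c j.1.1)))).
    by move=> c j _; rewrite /gforce; ring.
  apply: bOB; first exact: (lipf _ (bE_CC D)).
  by apply: bOMl; [exact: (rF _ bm)|exact: (lipf _ (bR_CC D))].
have back (f : trajectory R -> R -> R) :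
   bO fwd H1 (fun c j => f c (j.1.1 + j.2) - f c j.1.1) ->
   bO ctr H1 (fun c j => f c (j.1.1 - j.2) - f c j.1.1).
  move=> h.
  have h' := bO_reindex (k := fun c j => (j.1.1 - j.2, j.1.2, j.2)) ctr_fwd_back h.
  by apply: bO_eq (bON h') => c j _ /=; rewrite subrK opprB.
have twos (f : trajectory R -> R -> R) :
   bO fwd H1 (fun c j => f c (j.1.1 + j.2) - f c j.1.1) ->
   bO ctr H1 (fun c j => f c (j.1.1 + j.2) - f c (j.1.1 - j.2)).
  move=> h; apply: bO_eq (bOB (bO_sub ctr_fwd h) (back _ h)) => c j _; ring.
have XX i := ctr_second (dXd i) (eX i) (twos (fun c t => U c t * bet D i (X c t)) (FI i)).
have UU := ctr_second dUd eU (twos (fun c t => gforce D c (X c t)) GI).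
have cS c j : ctr c j -> onT c (j.1.1 + j.2) by move=> /ctr_fwd; exact: fwd_onT.
have c0' c j : ctr c j -> onT c j.1.1 by move=> /ctr_fwd; exact: fwd_onT0.
have cM c j : ctr c j -> onT c (j.1.1 - j.2) by exact: ctr_onT_sub.
have rS (f : sig) (h : B1 f) : bO ctr (fun _ _ => 1) (fun c j => f c (j.1.1 + j.2)).
  exact: (bO_reindex (k := fun c j => j.1.1 + j.2) cS h).
have r0 (f : sig) (h : B1 f) : bO ctr (fun _ _ => 1) (fun c j => f c (j.1.1)).
  exact: (bO_reindex (k := fun c j => j.1.1) c0' h).
have rM (f : sig) (h : B1 f) : bO ctr (fun _ _ => 1) (fun c j => f c (j.1.1 - j.2)).
  exact: (bO_reindex (k := fun c j => j.1.1 - j.2) cM h).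
have H11 : bO ctr H2 (fun c j => j.1.2 * j.1.2).
  by exists 1 => // c j _; rewrite mul1r -expr2 ger0_norm// sqr_ge0.
have sym (F : V3 -> R) : CC 2 F -> bO ctr H2 (fun c j =>
    F (X c (j.1.1 + j.2)) + F (X c (j.1.1 - j.2)) - 2 * F (X c j.1.1)).
  move=> hF; apply: (@bO_sym _ _ _ _ _ _ _ _ H1); first exact/CC_locsym.
  - by move=> i; exact: (r0 _ (bX i)).
  - by move=> i; exact: (rS _ (bX i)).
  - by move=> i; exact: (rM _ (bX i)).
  - exact: XX.
  - by move=> i; exact: (bO_sub ctr_fwd (XI i)).
  - by move=> i; exact: (back (fun c t => X c t i) (XI i)).
  - exact: H11.
(* A discrete Leibniz rule for the second difference of a product, expanded about the midpoint. *)
have FF i : bO ctr H2 (fun c j => U c (j.1.1 + j.2) * bet D i (X c (j.1.1 + j.2))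
    + U c (j.1.1 - j.2) * bet D i (X c (j.1.1 - j.2))
    - 2 * (U c j.1.1 * bet D i (X c j.1.1))).
  have lb := lipf _ (bet_CC D i).
  apply: (@bO_eq _ _ _ _ _ _ (fun c j =>
    U c j.1.1 * (bet D i (X c (j.1.1 + j.2)) + bet D i (X c (j.1.1 - j.2)) - 2 * bet D i (X c j.1.1))
    + (U c (j.1.1 + j.2) + U c (j.1.1 - j.2) - 2 * U c j.1.1) * bet D i (X c j.1.1)
    + ((U c (j.1.1 + j.2) - U c j.1.1) * (bet D i (X c (j.1.1 + j.2)) - bet D i (X c j.1.1))
    + (U c (j.1.1 - j.2) - U c j.1.1) * (bet D i (X c (j.1.1 - j.2)) - bet D i (X c j.1.1))))).
    by move=> c j _; ring.
  apply: bOD; first apply: bOD.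
  - by apply: bOMl; [exact: (r0 _ bU)|exact: (sym _ (bet_CC D i))].
  - by apply: bOMr => //; exact: (r0 _ (bb i)).
  - apply: bO_trans H11; apply: bOD.
      exact: (bOM (bO_sub ctr_fwd UI) (bO_sub ctr_fwd lb)).
    exact: (bOM (back _ UI) (back (fun c t => bet D i (X c t)) lb)).
have GG : bO ctr H2 (fun c j => gforce D c (X c (j.1.1 + j.2))
    + gforce D c (X c (j.1.1 - j.2)) - 2 * gforce D c (X c j.1.1)).
  apply: (@bO_eq _ _ _ _ _ _ (fun c j =>
    (bE D (X c (j.1.1 + j.2)) + bE D (X c (j.1.1 - j.2)) - 2 * bE D (X c j.1.1)) -
    mom D c 0 * (bR D (X c (j.1.1 + j.2)) + bR D (X c (j.1.1 - j.2)) - 2 * bR D (X c j.1.1)))).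
    by move=> c j _; rewrite /gforce; ring.
  apply: bOB; first exact: (sym _ (bE_CC D)).
  by apply: bOMl; [exact: (r0 _ bm)|exact: (sym _ (bR_CC D))].
exists X, U; split; first split=> //.
- by move=> i; exact: (ctr_step (dXd i) (eX i) (FF i)).
- exact: (ctr_step dUd eU GG).
split.
- by move=> i; exact: (fwd_step (dXd i) (eX i) (FI i)).
- exact: (fwd_step dUd eU GI).
Qed.

End CentredDifferences.

(** * The modified Boris scheme *)

Section BoundProducts.
Variables (R : realType) (A J : Type) (P : A -> J -> Prop).
Implicit Types f g : A -> J -> R.

Lemma bO_mul g1 g2 g f1 f2 : bO P g1 f1 -> bO P g2 f2 ->
  bO P g (fun a j => g1 a j * g2 a j) -> bO P g (fun a j => f1 a j * f2 a j).
Proof. by move=> h1 h2; apply: bO_trans; exact: (bOM h1 h2). Qed.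

Lemma bO_dot3 g1 g2 g (f1 f2 : A -> J -> ix -> R) :
  (forall i, bO P g1 (fun a j => f1 a j i)) ->
  (forall i, bO P g2 (fun a j => f2 a j i)) ->
  bO P g (fun a j => g1 a j * g2 a j) ->
  bO P g (fun a j => dot3 (f1 a j) (f2 a j)).
Proof.
move=> h1 h2 hg; apply: (bO_sum3 (f := fun i a j => f1 a j i * f2 a j i)) => i.
exact: (bO_mul (h1 i) (h2 i) hg).
Qed.

End BoundProducts.

Definition proj3 (R : realType) (b z : ix -> R) (i : ix) : R := z i - dot3 b z * b i.

Lemma bO_proj3 (R : realType) (A J : Type) (P : A -> J -> Prop)
   (g : A -> J -> R) (b z : A -> J -> ix -> R) i :
  (forall i, bO P (fun _ _ => 1) (fun a j => b a j i)) ->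
  (forall i, bO P g (fun a j => z a j i)) ->
  bO P g (fun a j => proj3 (b a j) (z a j) i).
Proof.
move=> hb hz; apply: bOB => //; apply: bOMr => //.
by apply: (bO_sum3 (f := fun i a j => b a j i * z a j i)) => k; exact: bOMl.
Qed.

Section Scheme.
Variables (R : realType) (D : field_data R) (Hm cs Cs Mm : R).
Hypothesis cs0 : 0 < cs.
Notation V3 := (ix -> R).

(** [sk] is [kappa = h^2 / eps] and [sm] is [m]. The scheme sees [eps] only through [kappa], which
    stays between [cs] and [Cs]. *)
Record scheme := Scheme { sh : R; sk : R; sm : R; sx : nat -> V3; sv : nat -> V3 }.

Definition bn (c : scheme) n (i : ix) : R := bet D i (sx c n).
Definition om c n (i : ix) : R :=
  sk c * rho D (sx c n) * cross3 (sv c n) (bn c n) i.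
Definition Gn c n (i : ix) : R := Ef D i (sx c n) - sm c * rhog D i (sx c n).
Definition an c n (i : ix) : R := om c n i + sh c ^+ 2 * Gn c n i.
Definition un c n : R := dot3 (bn c n) (sv c n).
Definition wn c n (i : ix) : R := sv c n i - un c n * bn c n i.
Definition ikr c n : R := (sk c * rho D (sx c n))^-1.

(** A position-velocity form of the three-term recursion. Positions are explicit; the velocity
    relation is implicit, since [an c n.+1] contains [sv c n.+1]. *)
Record wf (c : scheme) : Prop := Wf {
  wf_h : 0 < sh c <= Hm;
  wf_k : cs <= sk c <= Cs;
  wf_m : `|sm c| <= Mm;
  wf_x : forall n i, sx c n.+1 i = sx c n i + sh c * sv c n i + 2^-1 * an c n i;
  wf_v : forall n i, 2 * sh c * (sv c n.+1 i - sv c n i) = an c n.+1 i + an c n i }.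

(** The gauge for perpendicular quantities before [omega] is known to be [O(h^2)]; the term [h^2]
    absorbs the forcing. *)
Definition th c n : R := sum3 (fun i => `|om c n i|) + sh c ^+ 2.

(** Assuming only [omega = O(h)] already gives [x_{n+1} - x_n = O(h)], and leaves room to recover
    the assumption from the sharper [O(h^2)]. *)
Definition bd (r : R) c n : Prop :=
  [/\ forall i, `|sx c n i| <= r, `|un c n| <= r & forall i, `|om c n i| <= r * sh c].

Variable r : R.
Hypothesis r0 : 0 <= r.

Definition dom1 c n := wf c /\ bd r c n.

Notation one := (fun _ _ => 1 : R).
Notation H1 := (fun (c : scheme) (_ : nat) => sh c).
Notation H2 := (fun (c : scheme) (_ : nat) => sh c ^+ 2).
Notation H3 := (fun (c : scheme) (_ : nat) => sh c ^+ 3).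

Section Gauges.
Variable P : scheme -> nat -> Prop.
Hypothesis Pwf : forall c n, P c n -> wf c.

Lemma gaugeX (k l : nat) : (l <= k)%N ->
  bO P (fun c _ => sh c ^+ l) (fun c _ => sh c ^+ k).
Proof.
move=> kl; exists (`|Hm| ^+ (k - l)) => [|c n /Pwf[/andP[/ltW h0 h1] _ _ _ _]].
  by rewrite exprn_ge0.
rewrite ger0_norm ?exprn_ge0// -{1}(subnK kl) exprD ler_wpM2r ?exprn_ge0//.
by rewrite lerXn2r// ?nnegrE// (le_trans h1)// ler_norm.
Qed.

Lemma gauge11 : bO P H2 (fun c _ => sh c * sh c).
Proof. exact: (gaugeX (leqnn 2)). Qed.

Lemma gauge12 : bO P H3 (fun c _ => sh c * sh c ^+ 2).
Proof. by apply: (bO_eq _ (gaugeX (leqnn 3))) => c n _; rewrite -exprS. Qed.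

Lemma gauge22 : bO P (fun c _ => sh c ^+ 4) (fun c _ => sh c ^+ 2 * sh c ^+ 2).
Proof. by apply: (bO_eq _ (gaugeX (leqnn 4))) => c n _; rewrite -exprD. Qed.

Lemma gauge13 : bO P (fun c _ => sh c ^+ 4) (fun c _ => sh c * sh c ^+ 3).
Proof. by apply: (bO_eq _ (gaugeX (leqnn 4))) => c n _; rewrite -exprS. Qed.

Lemma gauge1 : bO P H1 H1. Proof. exact: (gaugeX (leqnn 1)). Qed.
Lemma gauge2 : bO P H2 H2. Proof. exact: (gaugeX (leqnn 2)). Qed.
Lemma gauge21 : bO P H1 H2. Proof. exact: (@gaugeX 2 1 isT). Qed.
Lemma gauge10 : bO P one H1. Proof. exact: (@gaugeX 1 0 isT). Qed.
Lemma gauge32 : bO P H2 H3. Proof. exact: (@gaugeX 3 2 isT). Qed.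

Lemma bO_divh (g f : scheme -> nat -> R) :
  bO P (fun c n => sh c * g c n) f -> bO P g (fun c n => f c n / (2 * sh c)).
Proof.
move=> [C C0 H]; exists C => // c n p; have [/andP[h0 _] _ _ _ _] := Pwf p.
rewrite normrM normfV (@ger0_norm _ (2 * sh c)); last by rewrite mulr_ge0// ltW.
rewrite ler_pdivrMr ?mulr_gt0//; apply: (le_trans (H _ _ p)).
have := le_trans (normr_ge0 _) (H _ _ p).
rewrite (_ : C * g c n * (2 * sh c) = 2 * (C * (sh c * g c n))); last by ring.
by set q := C * _; lra.
Qed.

Lemma bsm : bO P one (fun c _ => sm c).
Proof.
by exists `|Mm| => // c n /Pwf[_ _ h _ _]; rewrite mulr1 (le_trans h)// ler_norm.
Qed.

End Gauges.

Lemma skrho_gt0 c n : wf c -> 0 < sk c * rho D (sx c n).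
Proof.
move=> [_ /andP[k0 _] _ _ _]; apply: mulr_gt0; first exact: lt_le_trans k0.
exact: (lt_le_trans ltr01 (rho_ge1 D _)).
Qed.

Lemma beta_unit c n : dot3 (bn c n) (bn c n) = 1.
Proof. exact: (bet_unit D (sx c n)). Qed.

Lemma om_ortho c n : dot3 (bn c n) (om c n) = 0.
Proof. by rewrite /dot3 /om /sum3 /cross3; ring. Qed.

Lemma wn_om c n i : wf c -> wn c n i = ikr c n * cross3 (bn c n) (om c n) i.
Proof.
move=> hw; have k0 := lt0r_neq0 (skrho_gt0 n hw).
have -> : ikr c n * cross3 (bn c n) (om c n) i =
  ikr c n * (sk c * rho D (sx c n)) *
  (dot3 (bn c n) (bn c n) * sv c n i - un c n * bn c n i).
  by rewrite /om /un /dot3 /sum3; case: i; rewrite /cross3; ring.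
by rewrite beta_unit /ikr mulVf// !mul1r.
Qed.

Lemma sv_split c n i : sv c n i = un c n * bn c n i + wn c n i.
Proof. by rewrite /wn addrC subrK. Qed.

Lemma bO_ikr P : (forall c n, P c n -> wf c) -> bO P one (fun c n => ikr c n).
Proof.
move=> Pwf; exists cs^-1; first by rewrite invr_ge0 ltW.
move=> c n /Pwf hw; have k0 := skrho_gt0 n hw; have [_ /andP[k1 _] _ _ _] := hw.
rewrite mulr1 /ikr ger0_norm ?invr_ge0 ?(ltW k0)// lef_pV2 ?posrE//.
by rewrite (le_trans k1)// ler_peMr ?rho_ge1// (le_trans _ k1)// ltW.
Qed.

Let D1wf c n : dom1 c n -> wf c. Proof. by case. Qed.
Notation D1 := (bO dom1).

Lemma one_step_x i : D1 one (fun c n => sx c n i).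
Proof. by exists r => // c n [_ [h _ _]]; rewrite mulr1. Qed.

Lemma one_step_u : D1 one un.
Proof. by exists r => // c n [_ [_ h _]]; rewrite mulr1. Qed.

Lemma one_step_om1 i : D1 H1 (fun c n => om c n i).
Proof. by exists r => // c n [_ [_ _ h]]. Qed.

Lemma one_step_om i : D1 th (fun c n => om c n i).
Proof.
exists 1 => // c n _; rewrite mul1r /th /sum3.
move: (normr_ge0 (om c n X0)) (normr_ge0 (om c n X1)) (normr_ge0 (om c n X2)).
by have := sqr_ge0 (sh c); case: i; lra.
Qed.

Lemma one_step_h2th : D1 th H2.
Proof.
exists 1 => // c n _; rewrite mul1r /th /sum3 ger0_norm ?sqr_ge0//.
move: (normr_ge0 (om c n X0)) (normr_ge0 (om c n X1)) (normr_ge0 (om c n X2)).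
by lra.
Qed.

Lemma one_step_th1 : D1 H1 th.
Proof.
apply: bOD; last exact: gauge21.
by apply: (bO_sum3 (f := fun i c n => `|om c n i|)) => i; apply: bO_abs; exact: one_step_om1.
Qed.

Lemma one_step_comp F : CC 2 F -> D1 one (fun c n => F (sx c n)).
Proof. by move=> /CC_locbd h; apply: bO_comp => // i; exact: one_step_x. Qed.

Lemma one_step_b i : D1 one (fun c n => bn c n i).
Proof. exact: (one_step_comp (bet_CC D i)). Qed.

Lemma one_step_G i : D1 one (fun c n => Gn c n i).
Proof.
apply: bOB; first exact: (one_step_comp (Ef_CC D i)).
by apply: bOMl; [exact: bsm|exact: (one_step_comp (rhog_CC D i))].
Qed.

Lemma one_step_w i : D1 th (fun c n => wn c n i).
Proof.
apply: (@bO_eq _ _ _ _ _ _ (fun c n => ikr c n * cross3 (bn c n) (om c n) i)).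
  by move=> c n [hw _]; exact: wn_om.
apply: bOMl; first exact: bO_ikr.
by apply: bO_cross3; [exact: one_step_b|exact: one_step_om].
Qed.

Lemma one_step_th0 : D1 one th.
Proof. exact: (bO_trans one_step_th1 (gauge10 D1wf)). Qed.

Lemma one_step_v i : D1 one (fun c n => sv c n i).
Proof.
apply: (@bO_eq _ _ _ _ _ _ (fun c n => un c n * bn c n i + wn c n i)).
  by move=> c n _; exact: sv_split.
apply: bOD; first by apply: bOMl; [exact: one_step_u|exact: one_step_b].
exact: (bO_trans (one_step_w i) one_step_th0).
Qed.

Lemma one_step_a i : D1 th (fun c n => an c n i).
Proof.
apply: bOD; first exact: one_step_om.
by apply: bOMr; [exact: one_step_h2th|exact: one_step_G].
Qed.

Lemma one_step_dx i : D1 H1 (fun c n => sx c n.+1 i - sx c n i).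
Proof.
apply: (@bO_eq _ _ _ _ _ _ (fun c n => sh c * sv c n i + 2^-1 * an c n i)).
  by move=> c n [hw _]; rewrite (wf_x hw); ring.
apply: bOD; first by apply: bOMr; [exact: gauge1|exact: one_step_v].
apply: bOMl; first exact: bO_cst.
exact: (bO_trans (one_step_a i) one_step_th1).
Qed.

Lemma one_step_x' i : D1 one (fun c n => sx c n.+1 i).
Proof.
apply: (@bO_eq _ _ _ _ _ _ (fun c n => (sx c n.+1 i - sx c n i) + sx c n i)).
  by move=> c n _; rewrite subrK.
by apply: bOD; [exact: (bO_trans (one_step_dx i) (gauge10 D1wf))|exact: one_step_x].
Qed.

Lemma one_step_comp' F : CC 2 F -> D1 one (fun c n => F (sx c n.+1)).
Proof. by move=> /CC_locbd h; apply: bO_comp => // i; exact: one_step_x'. Qed.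

Lemma one_step_dcomp F : CC 2 F -> D1 H1 (fun c n => F (sx c n.+1) - F (sx c n)).
Proof.
by move=> h; apply: bO_lip; [exact/CC_loclip/CC_S|exact: one_step_x'|exact: one_step_x|exact: one_step_dx].
Qed.

Lemma one_step_b' i : D1 one (fun c n => bn c n.+1 i).
Proof. exact: (one_step_comp' (bet_CC D i)). Qed.

Lemma one_step_G' i : D1 one (fun c n => Gn c n.+1 i).
Proof.
apply: bOB; first exact: (one_step_comp' (Ef_CC D i)).
by apply: bOMl; [exact: bsm|exact: (one_step_comp' (rhog_CC D i))].
Qed.

Lemma one_step_db i : D1 H1 (fun c n => bn c n.+1 i - bn c n i).
Proof. exact: (one_step_dcomp (bet_CC D i)). Qed.

Lemma one_step_dG i : D1 H1 (fun c n => Gn c n.+1 i - Gn c n i).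
Proof.
apply: (@bO_eq _ _ _ _ _ _ (fun c n => (Ef D i (sx c n.+1) - Ef D i (sx c n))
   - sm c * (rhog D i (sx c n.+1) - rhog D i (sx c n)))).
  by move=> c n _; rewrite /Gn; ring.
apply: bOB; first exact: (one_step_dcomp (Ef_CC D i)).
by apply: bOMl; [exact: bsm|exact: (one_step_dcomp (rhog_CC D i))].
Qed.

(** Involves no velocity beyond step [n]; by [wf_v] it equals [2 h v_{n+1} - omega_{n+1}]. *)
Definition Zn c n i := 2 * sh c * sv c n i + an c n i + sh c ^+ 2 * Gn c n.+1 i.

(* the implicit relation for omega_{n+1}, solved explicitly *)
Lemma om_solve c n i : wf c -> om c n.+1 i =
  - ((1 + (2 * sh c * ikr c n.+1) ^+ 2)^-1 *
   (proj3 (bn c n.+1) (Zn c n) i +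
    2 * sh c * ikr c n.+1 * cross3 (bn c n.+1) (proj3 (bn c n.+1) (Zn c n)) i)).
Proof.
move=> hw; set y := 2 * sh c * ikr c n.+1.
have y1 : 1 + y ^+ 2 != 0 by rewrite gt_eqF//; have := sqr_ge0 y; lra.
set b := bn c n.+1; set o := om c n.+1.
have bb : dot3 b b = 1 by exact: beta_unit.
have bo0 : dot3 b o = 0 by exact: om_ortho.
have zE k : Zn c n k = 2 * sh c * sv c n.+1 k - o k.
  have := wf_v hw n k; rewrite /Zn {1}/an -/o => e.
  transitivity (2 * sh c * sv c n.+1 k - 2 * sh c * (sv c n.+1 k - sv c n k) +
     (an c n k + sh c ^+ 2 * Gn c n.+1 k)); first by ring.
  by rewrite e; ring.
(* On the plane normal to [b], [b x] squares to minus the identity. So the inverse of [y (b x) - 1]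
   is [- (1 + y (b x)) / (1 + y^2)]. *)
have pE k : proj3 b (Zn c n) k = y * cross3 b o k - o k.
  have -> : y * cross3 b o k = 2 * sh c * wn c n.+1 k by rewrite wn_om// /y; ring.
  rewrite /wn /un -/b.
  transitivity (2 * sh c * (sv c n.+1 k - dot3 b (sv c n.+1) * b k) - (o k - dot3 b o * b k)).
    by rewrite /proj3 /dot3 /sum3 !zE; ring.
  by rewrite bo0 mul0r subr0.
have cE : cross3 b (proj3 b (Zn c n)) i = - (y * o i) - cross3 b o i.
  have -> : cross3 b (proj3 b (Zn c n)) i = cross3 b (fun k => y * cross3 b o k - o k) i.
    by case: i; rewrite /cross3 !pE.
  transitivity (y * (dot3 b o * b i - dot3 b b * o i) - cross3 b o i).
    by rewrite /dot3 /sum3; case: i; rewrite /cross3; ring.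
  by rewrite bb bo0; ring.
rewrite pE cE; apply: (mulfI y1).
set Q := y * cross3 b o i - o i + _.
have -> : (1 + y ^+ 2) * - ((1 + y ^+ 2)^-1 * Q) =
  - ((1 + y ^+ 2) * (1 + y ^+ 2)^-1 * Q) by ring.
by rewrite mulfV// mul1r /Q; ring.
Qed.

Lemma one_step_projZ i : D1 th (fun c n => proj3 (bn c n.+1) (Zn c n) i).
Proof.
(* The projection kills [b_{n+1}], so the [O(h)] term [2 h u_n b_n] can be replaced by
   [2 h u_n (b_n - b_{n+1})], which is [O(h^2)]. *)
pose q c n i := un c n * (2 * sh c * (bn c n i - bn c n.+1 i)) + 2 * sh c * wn c n i
  + an c n i + sh c ^+ 2 * Gn c n.+1 i.
apply: (@bO_eq _ _ _ _ _ _ (fun c n => proj3 (bn c n.+1) (q c n) i)).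
  move=> c n _.
  transitivity (proj3 (bn c n.+1) (q c n) i +
    2 * sh c * un c n * (1 - dot3 (bn c n.+1) (bn c n.+1)) * bn c n.+1 i).
    by rewrite /proj3 /Zn /q /dot3 /sum3 !sv_split; ring.
  by rewrite beta_unit subrr mulr0 mul0r addr0.
apply: bO_proj3; first exact: one_step_b'.
move=> {}i; apply: bOD; first apply: bOD; first apply: bOD.
- apply: bOMl; first exact: one_step_u.
  apply: bO_trans one_step_h2th; apply: (@bO_mul _ _ _ _ H1 H1).
  + by apply: bOMl; [exact: bO_cst|exact: gauge1].
  + by apply: bO_eq (bON (one_step_db i)) => c n _; rewrite opprB.
  + exact: gauge11.
- apply: bOMl; last exact: one_step_w.
  by apply: bOMl; [exact: bO_cst|exact: gauge10].
- exact: one_step_a.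
- by apply: bOMr; [exact: one_step_h2th|exact: one_step_G'].
Qed.

Lemma one_step_om' i : D1 th (fun c n => om c n.+1 i).
Proof.
apply: (@bO_eq _ _ _ _ _ _ (fun c n => - ((1 + (2 * sh c * ikr c n.+1) ^+ 2)^-1 *
   (proj3 (bn c n.+1) (Zn c n) i +
    2 * sh c * ikr c n.+1 * cross3 (bn c n.+1) (proj3 (bn c n.+1) (Zn c n)) i)))).
  by move=> c n [hw _]; exact: om_solve.
apply: bON; apply: bOMl.
  exists 1 => // c n _; rewrite mulr1.
  have h : 1 <= 1 + (2 * sh c * ikr c n.+1) ^+ 2.
    by have := sqr_ge0 (2 * sh c * ikr c n.+1); lra.
  by rewrite ger0_norm ?invr_ge0 ?(le_trans ler01 h)// invf_le1// (lt_le_trans ltr01).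
apply: bOD; first exact: one_step_projZ.
apply: bOMl.
  apply: bOMl; first by apply: bOMl; [exact: bO_cst|exact: gauge10].
  (* The predicate is shifted down so that reindexing by [n.+1] lands in [dom1] at [n]. *)
  have := @bO_ikr (fun c n => dom1 c n.-1).
  move=> /(_ (fun c n h => D1wf h)) h.
  exact: (bO_reindex (k := fun _ n => n.+1) (P' := dom1) _ h).
by apply: bO_cross3; [exact: one_step_b'|exact: one_step_projZ].
Qed.

(** By [om_ortho] the products with [omega] enter only through [b_{n+1} - b_n], which compensates
    the division by [2 h]. *)
Lemma un_step c n : wf c -> un c n.+1 - un c n =
  dot3 (fun i => bn c n.+1 i - bn c n i) (sv c n) +
  (dot3 (fun i => bn c n.+1 i - bn c n i) (om c n) +
   sh c ^+ 2 * dot3 (bn c n.+1) (fun i => Gn c n i + Gn c n.+1 i)) / (2 * sh c).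
Proof.
move=> hw; have h0 : 2 * sh c != 0.
  by have [/andP[h _] _ _ _ _] := hw; rewrite gt_eqF// mulr_gt0.
apply: (mulfI h0).
have e i := wf_v hw n i.
transitivity (2 * sh c * dot3 (fun i => bn c n.+1 i - bn c n i) (sv c n) +
   dot3 (bn c n.+1) (fun i => 2 * sh c * (sv c n.+1 i - sv c n i))).
  by rewrite /un /dot3 /sum3; ring.
rewrite [RHS]mulrDr; congr (_ + _); rewrite [RHS]mulrCA mulfV// mulr1.
transitivity (dot3 (bn c n.+1) (om c n.+1) + dot3 (bn c n) (om c n) +
  (dot3 (fun i => bn c n.+1 i - bn c n i) (om c n) +
   sh c ^+ 2 * dot3 (bn c n.+1) (fun i => Gn c n i + Gn c n.+1 i))).
  by rewrite /dot3 /sum3 !e /an; ring.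
by rewrite !om_ortho !add0r.
Qed.

Lemma one_step_du : D1 H1 (fun c n => un c n.+1 - un c n).
Proof.
apply: (@bO_eq _ _ _ _ _ _ _ (fun c n p => un_step n (D1wf p))).
apply: bOD.
  by apply: (bO_dot3 one_step_db one_step_v); apply: bO_eq (gauge1 D1wf) => c n _; rewrite mulr1.
apply: bO_divh => //; apply: bOD.
  exact: (bO_dot3 one_step_db one_step_om1 (bO_refl (fun c n _ => sqr_ge0 (sh c)))).
apply: bOMr; first exact: (bO_refl (fun c n _ => sqr_ge0 (sh c))).
apply: (bO_dot3 one_step_b' (fun i => bOD (one_step_G i) (one_step_G' i))).
by apply: bO_eq (bO_cst dom1 1) => c n _; rewrite mulr1.
Qed.

Lemma one_step_u' : D1 one (fun c n => un c n.+1).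
Proof.
apply: (@bO_eq _ _ _ _ _ _ (fun c n => (un c n.+1 - un c n) + un c n)).
  by move=> c n _; rewrite subrK.
by apply: bOD; [exact: (bO_trans one_step_du (gauge10 D1wf))|exact: one_step_u].
Qed.

Definition dom2 c n := [/\ wf c, bd r c n & bd r c n.+1].

Let D2wf c n : dom2 c n -> wf c. Proof. by case. Qed.
Notation D2 := (bO dom2).

Implicit Types f g : scheme -> nat -> R.

Lemma dom2_at0 g f : D1 g f -> D2 g f.
Proof. by apply: bO_sub => c n []. Qed.

Lemma dom2_at1 g f : D1 g f -> D2 (fun c n => g c n.+1) (fun c n => f c n.+1).
Proof. by apply: (bO_reindex (k := fun _ n => n.+1)) => c n []. Qed.

Definition th2 c n := th c n + th c n.+1.

Lemma th_ge0 c n : 0 <= th c n.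
Proof. by rewrite /th /sum3 !addr_ge0// sqr_ge0. Qed.

Lemma th2_ge0 c n : 0 <= th2 c n.
Proof. by rewrite addr_ge0// th_ge0. Qed.

Lemma th2_0 : D2 th2 th.
Proof.
exists 1 => // c n _; rewrite mul1r ger0_norm ?th_ge0// /th2 lerDl.
exact: th_ge0.
Qed.

Lemma th2_1 : D2 th2 (fun c n => th c n.+1).
Proof.
exists 1 => // c n _; rewrite mul1r ger0_norm ?th_ge0// /th2 lerDr.
exact: th_ge0.
Qed.

Lemma th2_h2 : D2 th2 H2.
Proof. exact: (bO_trans (dom2_at0 one_step_h2th) th2_0). Qed.

Lemma second_x c n i : wf c ->
  sx c n.+2 i + sx c n i - 2 * sx c n.+1 i = an c n.+1 i.
Proof.
move=> hw; have e := wf_v hw n i; have e1 := wf_x hw n i; have e2 := wf_x hw n.+1 i.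
rewrite e2.
transitivity (sh c * sv c n.+1 i + 2^-1 * an c n.+1 i - (sx c n.+1 i - sx c n i)); first by ring.
rewrite {1}e1.
transitivity (2^-1 * (2 * sh c * (sv c n.+1 i - sv c n i)) + 2^-1 * an c n.+1 i - 2^-1 * an c n i).
  by field.
by rewrite e; field.
Qed.

Lemma two_step_x i : D2 th2 (fun c n => sx c n.+2 i + sx c n i - 2 * sx c n.+1 i).
Proof.
apply: (@bO_eq _ _ _ _ _ _ (fun c n => an c n.+1 i)).
  by move=> c n /D2wf; exact: second_x.
exact: (bO_trans (dom2_at1 (one_step_a i)) th2_1).
Qed.

Lemma two_step_sym F : CC 2 F ->
  D2 th2 (fun c n => F (sx c n.+2) + F (sx c n) - 2 * F (sx c n.+1)).
Proof.
move=> hF; apply: (@bO_sym _ _ _ _ _ _ _ _ H1); first exact: CC_locsym.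
- by move=> i; exact: (dom2_at1 (one_step_x i)).
- by move=> i; exact: (dom2_at1 (one_step_x' i)).
- by move=> i; exact: (dom2_at0 (one_step_x i)).
- exact: two_step_x.
- by move=> i; exact: (dom2_at1 (one_step_dx i)).
- by move=> i; apply: bO_eq (bON (dom2_at0 (one_step_dx i))) => c n _; rewrite opprB.
- exact: (bO_trans (gauge11 D2wf) th2_h2).
Qed.

Lemma two_step_b i : D2 th2 (fun c n => bn c n.+2 i + bn c n i - 2 * bn c n.+1 i).
Proof. exact: (two_step_sym (bet_CC D i)). Qed.

Lemma two_step_G i : D2 th2 (fun c n => Gn c n.+2 i + Gn c n i - 2 * Gn c n.+1 i).
Proof.
apply: (@bO_eq _ _ _ _ _ _ (fun c n =>
  (Ef D i (sx c n.+2) + Ef D i (sx c n) - 2 * Ef D i (sx c n.+1)) -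
  sm c * (rhog D i (sx c n.+2) + rhog D i (sx c n) - 2 * rhog D i (sx c n.+1)))).
  by move=> c n _; rewrite /Gn; ring.
apply: bOB; first exact: (two_step_sym (Ef_CC D i)).
by apply: bOMl; [exact: bsm|exact: (two_step_sym (rhog_CC D i))].
Qed.

Lemma two_step_om2 i : D2 th2 (fun c n => om c n.+2 i).
Proof. exact: (bO_trans (dom2_at1 (one_step_om' i)) th2_1). Qed.

Lemma two_step_om0 i : D2 th2 (fun c n => om c n i).
Proof. exact: (bO_trans (dom2_at0 (one_step_om i)) th2_0). Qed.

Lemma two_step_w0 i : D2 th2 (fun c n => wn c n i).
Proof. exact: (bO_trans (dom2_at0 (one_step_w i)) th2_0). Qed.

Lemma two_step_w1 i : D2 th2 (fun c n => wn c n.+1 i).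
Proof. exact: (bO_trans (dom2_at1 (one_step_w i)) th2_1). Qed.

Lemma two_step_w2 i : D2 th2 (fun c n => wn c n.+2 i).
Proof.
apply: (@bO_eq _ _ _ _ _ _ (fun c n => ikr c n.+2 * cross3 (bn c n.+2) (om c n.+2) i)).
  by move=> c n /D2wf hw; exact: wn_om.
apply: bOMl.
  have := @bO_ikr (fun c n => dom2 c n.-2).
  move=> /(_ (fun c n h => D2wf h)) h.
  exact: (bO_reindex (k := fun _ n => n.+2) (P' := dom2) _ h).
by apply: bO_cross3 => k; [exact: (dom2_at1 (one_step_b' k))|exact: two_step_om2].
Qed.

Lemma two_step_db2 i : D2 H1 (fun c n => bn c n.+2 i - bn c n.+1 i).
Proof. exact: (dom2_at1 (one_step_db i)). Qed.

Lemma two_step_db0 i : D2 H1 (fun c n => bn c n i - bn c n.+1 i).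
Proof. by apply: bO_eq (bON (dom2_at0 (one_step_db i))) => c n _; rewrite opprB. Qed.

Lemma two_step_db20 i : D2 H1 (fun c n => bn c n.+2 i - bn c n i).
Proof. by apply: bO_eq (bOB (two_step_db2 i) (two_step_db0 i)) => c n _; ring. Qed.

Lemma two_step_du2 : D2 H1 (fun c n => un c n.+2 - un c n.+1).
Proof. exact: (dom2_at1 one_step_du). Qed.

Lemma two_step_du0 : D2 H1 (fun c n => un c n - un c n.+1).
Proof. by apply: bO_eq (bON (dom2_at0 one_step_du)) => c n _; rewrite opprB. Qed.

Lemma two_step_dG i : D2 H1 (fun c n => Gn c n.+2 i - Gn c n i).
Proof. by apply: bO_eq (bOD (dom2_at1 (one_step_dG i)) (dom2_at0 (one_step_dG i))) => c n _; ring. Qed.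

(** Subtracting consecutive instances of [wf_v] cancels [a_{n+1}]: [dlt] is [2 h] times the second
    difference of [v], minus [h^2 (G_{n+2} - G_n)]. [qv] is that second difference without its
    multiple of [b_{n+1}], and [Qv] the resulting right-hand side. *)
Definition dlt c n i := om c n.+2 i - om c n i.
Definition qv c n i := un c n.+1 * (bn c n.+2 i + bn c n i - 2 * bn c n.+1 i)
  + (un c n.+2 - un c n.+1) * (bn c n.+2 i - bn c n.+1 i)
  + (un c n - un c n.+1) * (bn c n i - bn c n.+1 i)
  + (wn c n.+2 i + wn c n i - 2 * wn c n.+1 i).
Definition Qv c n i := 2 * sh c * qv c n i - sh c ^+ 2 * (Gn c n.+2 i - Gn c n i).

(** The projected recursion controls only the part normal to [b_{n+1}]. The part along it is read
    off from [omega_{n+2}] and [omega_n] being orthogonal to their own directions. *)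
Lemma dlt_split c n i : wf c -> dlt c n i =
  proj3 (bn c n.+1) (Qv c n) i -
  (dot3 (fun i => bn c n.+2 i - bn c n.+1 i) (om c n.+2)
   - dot3 (fun i => bn c n i - bn c n.+1 i) (om c n)) * bn c n.+1 i.
Proof.
move=> hw.
have dE k : dlt c n k = Qv c n k + 2 * sh c * (un c n.+2 + un c n - 2 * un c n.+1) * bn c n.+1 k.
  have e0 := wf_v hw n k; have e1 := wf_v hw n.+1 k.
  transitivity (an c n.+2 k + an c n.+1 k - (an c n.+1 k + an c n k)
     - sh c ^+ 2 * (Gn c n.+2 k - Gn c n k)).
    by rewrite /dlt /an; ring.
  by rewrite -e0 -e1 !sv_split /Qv /qv; ring.
have pE : proj3 (bn c n.+1) (dlt c n) i = proj3 (bn c n.+1) (Qv c n) i.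
  transitivity (proj3 (bn c n.+1) (Qv c n) i +
    2 * sh c * (un c n.+2 + un c n - 2 * un c n.+1) *
    (1 - dot3 (bn c n.+1) (bn c n.+1)) * bn c n.+1 i).
    by rewrite /proj3 /dot3 /sum3 !dE; ring.
  by rewrite beta_unit subrr mulr0 mul0r addr0.
rewrite -pE.
transitivity (proj3 (bn c n.+1) (dlt c n) i + dot3 (bn c n.+1) (dlt c n) * bn c n.+1 i).
  by rewrite /proj3 subrK.
rewrite -[RHS]addr0; have o2 := om_ortho c n.+2; have o0 := om_ortho c n.
transitivity (proj3 (bn c n.+1) (dlt c n) i -
  (dot3 (fun i => bn c n.+2 i - bn c n.+1 i) (om c n.+2)
   - dot3 (fun i => bn c n i - bn c n.+1 i) (om c n)) * bn c n.+1 i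
  + (dot3 (bn c n.+2) (om c n.+2) - dot3 (bn c n) (om c n)) * bn c n.+1 i).
  by rewrite {2}/dlt /dot3 /sum3; ring.
by rewrite o2 o0 subrr mul0r.
Qed.

Lemma one_step_qv i : D2 th2 (fun c n => qv c n i).
Proof.
have g11 := bO_trans (gauge11 D2wf) th2_h2.
apply: bOD; first apply: bOD; first apply: bOD.
- by apply: bOMl; [exact: (dom2_at1 one_step_u)|exact: two_step_b].
- exact: (bO_mul two_step_du2 (two_step_db2 i) g11).
- exact: (bO_mul two_step_du0 (two_step_db0 i) g11).
- apply: bOB; first by apply: bOD; [exact: two_step_w2|exact: two_step_w0].
  by apply: bOMl; [exact: bO_cst|exact: two_step_w1].
Qed.

Notation Hth := (fun c n => sh c * th2 c n).

Lemma Hth_refl : D2 Hth Hth.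
Proof.
apply: bO_refl => c n /D2wf[/andP[/ltW h _] _ _ _ _].
by rewrite mulr_ge0// th2_ge0.
Qed.

Lemma two_step_dlt i : D2 Hth (fun c n => dlt c n i).
Proof.
apply: (@bO_eq _ _ _ _ _ _ _ (fun c n p => dlt_split n i (D2wf p))).
apply: bOB.
  apply: bO_proj3 => k; first exact: (dom2_at1 (one_step_b k)).
  apply: bOB.
    apply: (@bO_mul _ _ _ _ H1 th2); [|exact: one_step_qv|exact: Hth_refl].
    by apply: bOMl; [exact: bO_cst|exact: gauge1].
  apply: (bO_mul (gauge2 D2wf) (two_step_dG k)).
  apply: (@bO_eq _ _ _ _ _ _ (fun c n => sh c * sh c ^+ 2)).
    by move=> c n _; rewrite mulrC.
  apply: (bO_mul (gauge1 D2wf) th2_h2 Hth_refl).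
apply: bOMr; last exact: (dom2_at1 (one_step_b i)).
apply: bOB.
  exact: (bO_dot3 two_step_db2 two_step_om2 Hth_refl).
exact: (bO_dot3 two_step_db0 two_step_om0 Hth_refl).
Qed.

(** The second stage: once [omega = O(h^2)] is available, the gauge [th2] becomes [h^2]. *)
Definition dom3 c n := [/\ dom2 c n, forall i, `|om c n i| <= r * sh c ^+ 2 &
  forall i, `|om c n.+1 i| <= r * sh c ^+ 2].

Let D3wf c n : dom3 c n -> wf c. Proof. by case=> -[]. Qed.
Let D32 c n : dom3 c n -> dom2 c n. Proof. by case. Qed.
Notation D3 := (bO dom3).
Let D3s g f : D2 g f -> D3 g f. Proof. exact: (bO_sub D32). Qed.

Lemma th2_D3 : D3 H2 th2.
Proof.
apply: bOD; apply: bOD; try exact: (gauge2 D3wf).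
  apply: (bO_sum3 (f := fun i c n => `|om c n i|)) => i; apply: bO_abs.
  by exists r => // c n [].
apply: (bO_sum3 (f := fun i c n => `|om c n.+1 i|)) => i; apply: bO_abs.
by exists r => // c n [].
Qed.

Lemma D3th g : D2 th2 g -> D3 H2 g.
Proof. by move=> /D3s h; exact: (bO_trans h th2_D3). Qed.

Lemma D3Hth g : D2 Hth g -> D3 H3 g.
Proof.
move=> /D3s h; apply: (bO_trans h).
exact: (bO_mul (gauge1 D3wf) th2_D3 (gauge12 D3wf)).
Qed.

Lemma scheme_step_x i : D3 H3 (fun c n => sx c n.+2 i - sx c n i
   - 2 * sh c * (un c n.+1 * bn c n.+1 i)).
Proof.
apply: (@bO_eq _ _ _ _ _ _ (fun c n => 2 * (sh c * wn c n.+1 i))).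
  move=> c n /D3wf hw.
  have e := wf_v hw n i; have e1 := wf_x hw n i; have e2 := wf_x hw n.+1 i.
  rewrite e2 e1.
  transitivity (2^-1 * (an c n.+1 i + an c n i) + sh c * sv c n.+1 i + sh c * sv c n i
     - 2 * sh c * (un c n.+1 * bn c n.+1 i)); first by ring.
  rewrite -e [wn _ _ _](_ : _ = sv c n.+1 i - un c n.+1 * bn c n.+1 i)//.
  by field.
apply: bOMl; first exact: bO_cst.
exact: (bO_mul (gauge1 D3wf) (D3th (two_step_w1 i)) (gauge12 D3wf)).
Qed.

(** An exact identity arranged so that each term is [O(h^3)] under [dom3]; the quotient by [2 h] has
    a numerator of size [h^4]. *)
Lemma un_two_step c n : wf c ->
  let b0 := bn c n in let b1 := bn c n.+1 in let b2 := bn c n.+2 in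
  let e2 := fun i => b2 i - b1 i in let e0 := fun i => b0 i - b1 i in
  let bb := fun i => b2 i + b0 i - 2 * b1 i in
  un c n.+2 - un c n - 2 * sh c * dot3 b1 (Gn c n.+1) =
  (- dot3 e2 (dlt c n) - dot3 bb (om c n)
   + sh c ^+ 2 * dot3 b1 (fun i => Gn c n.+2 i + Gn c n i - 2 * Gn c n.+1 i)) / (2 * sh c)
  + ((un c n.+2 - un c n) * (2^-1 * dot3 e2 e2)
     + un c n * (2^-1 * dot3 bb (fun i => b2 i - b0 i)))
  + (dot3 e2 (wn c n.+2) - dot3 e0 (wn c n)).
Proof.
move=> hw b0 b1 b2 e2 e0 bb.
have h0 : 2 * sh c != 0.
  by have [/andP[h _] _ _ _ _] := hw; rewrite gt_eqF// mulr_gt0.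
have E0 i := wf_v hw n i; have E1 i := wf_v hw n.+1 i.
have o2 : dot3 b2 (om c n.+2) = 0 by exact: om_ortho.
have o1 : dot3 b1 (om c n.+1) = 0 by exact: om_ortho.
have o0 : dot3 b0 (om c n) = 0 by exact: om_ortho.
(* The products of [b1] with [omega_{n+2}] and [omega_n] become products with [e2] and [e0] by
   orthogonality. Writing [omega_{n+2}] as [omega_n + dlt] merges them: [e2 + e0 = bb] is a second
   difference. *)
have A : 2 * sh c * dot3 b1 (fun i => sv c n.+2 i - sv c n i) =
  - dot3 e2 (dlt c n) - dot3 bb (om c n)
   + sh c ^+ 2 * dot3 b1 (fun i => Gn c n.+2 i + Gn c n i - 2 * Gn c n.+1 i)
   + 4 * sh c ^+ 2 * dot3 b1 (Gn c n.+1).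
  transitivity (dot3 b1 (fun i => 2 * sh c * (sv c n.+2 i - sv c n.+1 i)
    + 2 * sh c * (sv c n.+1 i - sv c n i))).
    by rewrite /dot3 /sum3; ring.
  transitivity (dot3 b2 (om c n.+2) + 2 * dot3 b1 (om c n.+1) + dot3 b0 (om c n) +
   (- dot3 e2 (dlt c n) - dot3 bb (om c n)
   + sh c ^+ 2 * dot3 b1 (fun i => Gn c n.+2 i + Gn c n i - 2 * Gn c n.+1 i)
   + 4 * sh c ^+ 2 * dot3 b1 (Gn c n.+1))).
    by rewrite /dot3 /sum3 !E0 !E1 /an /dlt /e2 /bb; ring.
  by rewrite o2 o1 o0 mulr0 !add0r.
have u2 : dot3 b2 b2 = 1 by exact: beta_unit.
have u1 : dot3 b1 b1 = 1 by exact: beta_unit.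
have u0 : dot3 b0 b0 = 1 by exact: beta_unit.
(* For unit vectors [b1 . b2 = 1 - |e2|^2 / 2], and [wn] is orthogonal to its own direction. *)
have B2 : dot3 b1 (sv c n.+2) = un c n.+2 - un c n.+2 * (2^-1 * dot3 e2 e2) - dot3 e2 (wn c n.+2).
  transitivity (un c n.+2 - (un c n.+2 * (2^-1 * (dot3 e2 e2 + dot3 b2 b2 - dot3 b1 b1))
     + dot3 e2 (wn c n.+2))).
    transitivity (un c n.+2 - dot3 e2 (fun i => un c n.+2 * b2 i + wn c n.+2 i)).
      rewrite {1}/un -/b2 /dot3 /sum3 /b2 -!sv_split /e2 -/b2.
      by ring.
    by rewrite /dot3 /sum3 /e2; field.
  by rewrite u2 u1 addrK; ring.
have B0 : dot3 b1 (sv c n) = un c n - un c n * (2^-1 * dot3 e0 e0) - dot3 e0 (wn c n).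
  transitivity (un c n - (un c n * (2^-1 * (dot3 e0 e0 + dot3 b0 b0 - dot3 b1 b1))
     + dot3 e0 (wn c n))).
    transitivity (un c n - dot3 e0 (fun i => un c n * b0 i + wn c n i)).
      rewrite {1}/un -/b0 /dot3 /sum3 /b0 -!sv_split /e0 -/b0.
      by ring.
    by rewrite /dot3 /sum3 /e0; field.
  by rewrite u0 u1 addrK; ring.
(* Each square is only [O(h^2)], but their difference is [O(h^3)]. *)
have dd : dot3 e2 e2 = dot3 e0 e0 + dot3 bb (fun i => b2 i - b0 i).
  by rewrite /dot3 /sum3 /e2 /e0 /bb; ring.
set S := - dot3 e2 (dlt c n) - _ + _ in A *.
have Sd : S / (2 * sh c) = dot3 b1 (sv c n.+2) - dot3 b1 (sv c n) - 2 * sh c * dot3 b1 (Gn c n.+1).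
  have -> : S = 2 * sh c * (dot3 b1 (sv c n.+2) - dot3 b1 (sv c n) - 2 * sh c * dot3 b1 (Gn c n.+1)).
    have -> : S = S + 4 * sh c ^+ 2 * dot3 b1 (Gn c n.+1) - 4 * sh c ^+ 2 * dot3 b1 (Gn c n.+1).
      by rewrite addrK.
    by rewrite -A /dot3 /sum3; ring.
  by rewrite mulrAC mulfV// mul1r.
by rewrite Sd B2 B0 dd; field.
Qed.

Lemma scheme_step_u : D3 H3 (fun c n => un c n.+2 - un c n
   - 2 * sh c * dot3 (bn c n.+1) (Gn c n.+1)).
Proof.
apply: (@bO_eq _ _ _ _ _ _ _ (fun c n p => un_two_step n (D3wf p))).
have db2 i := D3s (two_step_db2 i); have db0 i := D3s (two_step_db0 i).
have db20 i := D3s (two_step_db20 i); have tb i := D3th (two_step_b i).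
have om0 i := D3th (two_step_om0 i).
have dl i := D3Hth (two_step_dlt i).
apply: bOD; first apply: bOD.
- apply: bO_divh => //.
  apply: (@bO_trans _ _ _ _ (fun c _ => sh c ^+ 4)); last first.
    by apply: bO_eq (bO_refl _) => [c n _|c n /D3wf[/andP[/ltW h _] _ _ _ _]];
      rewrite ?exprS// !mulr_ge0.
  apply: bOD; first apply: bOD; try apply: bON.
  + exact: (bO_dot3 db2 dl (gauge13 D3wf)).
  + exact: (bO_dot3 tb om0 (gauge22 D3wf)).
  + apply: (bO_mul (gauge2 D3wf) _ (gauge22 D3wf)).
    have b1 i := D3s (dom2_at1 (one_step_b i)).
    apply: (bO_dot3 b1 (fun i => D3th (two_step_G i))).
    by apply: bO_eq (gauge2 D3wf) => c n _; rewrite mul1r.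
- apply: bOD.
    have du : D3 H1 (fun c n => un c n.+2 - un c n).
      by apply: bO_eq (D3s (bOB two_step_du2 two_step_du0)) => c n _; ring.
    apply: (bO_mul du _ (gauge12 D3wf)).
    by apply: bOMl; [exact: bO_cst|exact: (bO_dot3 db2 db2 (gauge11 D3wf))].
  apply: bOMl; first exact: (D3s (dom2_at0 one_step_u)).
  apply: bOMl; first exact: bO_cst.
  apply: (bO_dot3 tb db20).
  by apply: bO_eq (gauge12 D3wf) => c n _; rewrite mulrC.
- apply: bOB.
    exact: (bO_dot3 db2 (fun i => D3th (two_step_w2 i)) (gauge12 D3wf)).
  exact: (bO_dot3 db0 (fun i => D3th (two_step_w0 i)) (gauge12 D3wf)).
Qed.

(** The setting of the forward estimates, which start the two-step comparison. *)
Definition dom1s c n := dom1 c n /\ forall i, `|om c n i| <= r * sh c ^+ 2.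

Let D1swf c n : dom1s c n -> wf c. Proof. by case=> -[]. Qed.
Let D1s g f : D1 g f -> bO dom1s g f. Proof. by apply: bO_sub => c n []. Qed.

Lemma th_D1s : bO dom1s H2 th.
Proof.
apply: bOD; last exact: (gauge2 D1swf).
apply: (bO_sum3 (f := fun i c n => `|om c n i|)) => i; apply: bO_abs.
by exists r => // c n [].
Qed.

Lemma scheme_fwd_x i : bO dom1s H2 (fun c n => sx c n.+1 i - sx c n i
   - sh c * (un c n * bn c n i)).
Proof.
apply: (@bO_eq _ _ _ _ _ _ (fun c n => sh c * wn c n i + 2^-1 * an c n i)).
  by move=> c n /D1swf hw; rewrite (wf_x hw) sv_split; ring.
apply: bOD.
  apply: bOMl; first exact: (gauge10 D1swf).
  exact: (bO_trans (D1s (one_step_w i)) th_D1s).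
apply: bOMl; first exact: bO_cst.
exact: (bO_trans (D1s (one_step_a i)) th_D1s).
Qed.

Lemma scheme_fwd_u : bO dom1s H2 (fun c n => un c n.+1 - un c n
   - sh c * dot3 (bn c n) (Gn c n)).
Proof.
pose db c n i := bn c n.+1 i - bn c n i.
apply: (@bO_eq _ _ _ _ _ _ (fun c n =>
  (- (un c n * (2^-1 * dot3 (db c n) (db c n))) + dot3 (db c n) (wn c n))
  + (dot3 (db c n) (om c n) + sh c ^+ 2 * (dot3 (bn c n.+1) (fun i => Gn c n.+1 i - Gn c n i)
     + 2 * dot3 (db c n) (Gn c n))) / (2 * sh c))).
  move=> c n /D1swf hw; rewrite un_step//.
  have h0 : sh c != 0 by have [/andP[h _] _ _ _ _] := hw; rewrite gt_eqF.
  have e1 : dot3 (bn c n.+1) (bn c n.+1) = 1 by exact: beta_unit.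
  have e0 : dot3 (bn c n) (bn c n) = 1 by exact: beta_unit.
  have -> : dot3 (fun i => bn c n.+1 i - bn c n i) (sv c n) =
    - (un c n * (2^-1 * dot3 (db c n) (db c n))) + dot3 (db c n) (wn c n)
    + un c n * (2^-1 * (dot3 (bn c n.+1) (bn c n.+1) - dot3 (bn c n) (bn c n))).
    by rewrite /dot3 /sum3 !sv_split /db; field.
  rewrite e1 e0 subrr !mulr0 addr0 -[LHS]addrA; congr (_ + _).
  by rewrite /dot3 /sum3 /db; field.
have ddb i := D1s (one_step_db i).
apply: bOD; first apply: bOD.
- apply: bON; apply: bOMl; first exact: (D1s one_step_u).
  by apply: bOMl; [exact: bO_cst|exact: (bO_dot3 ddb ddb (gauge11 D1swf))].
- have ww i := bO_trans (D1s (one_step_w i)) th_D1s.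
  exact: (bO_dot3 ddb ww (bO_trans (gauge12 D1swf) (gauge32 D1swf))).
- apply: bO_divh => //.
  apply: (@bO_trans _ _ _ _ H3); last first.
    by apply: bO_eq (bO_refl _) => [c n _|c n /D1swf[/andP[/ltW h _] _ _ _ _]];
      rewrite ?exprS// !mulr_ge0.
  apply: bOD.
    have oo i := bO_trans (D1s (one_step_om i)) th_D1s.
    exact: (bO_dot3 ddb oo (gauge12 D1swf)).
  have g1 : bO dom1s H1 (fun c n => 1 * sh c).
    by apply: bO_eq (gauge1 D1swf) => c n _; rewrite mul1r.
  have g1' : bO dom1s H1 (fun c n => sh c * 1).
    by apply: bO_eq (gauge1 D1swf) => c n _; rewrite mulr1.
  apply: (@bO_mul _ _ _ _ H2 H1).
  + exact: (gauge2 D1swf).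
  + apply: bOD.
      exact: (bO_dot3 (fun i => D1s (one_step_b' i)) (fun i => D1s (one_step_dG i)) g1).
    apply: bOMl; first exact: bO_cst.
    exact: (bO_dot3 ddb (fun i => D1s (one_step_G i)) g1').
  + by apply: bO_eq (gauge12 D1swf) => c n _; rewrite mulrC.
Qed.
End Scheme.

(** * Comparison *)

(** The induction carries two consecutive indices. [Q q^(k+1)] dominates [a k], [a k.+1] and [Q], so
    one step adds at most [h (2 L + 1)] times it. *)
Lemma gronwall2 (R : realType) (a : nat -> R) (Q L h : R) (N : nat) :
  0 <= Q -> 0 <= L -> 0 <= h -> a 0%N <= Q -> ((0 < N)%N -> a 1%N <= Q) ->
  (forall k, (k.+2 <= N)%N -> a k.+2 <= a k + h * (L * (a k + a k.+1) + Q)) ->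
  forall k, (k <= N)%N -> a k <= Q * (1 + (2 * L + 1) * h) ^+ k.
Proof.
move=> Q0 L0 h0 a0 a1 H.
set q := 1 + _.
have Lh : 0 <= (2 * L + 1) * h by rewrite mulr_ge0// addr_ge0// mulr_ge0.
have q1 : 1 <= q by rewrite /q lerDl.
suff S k : ((k <= N)%N -> a k <= Q * q ^+ k) /\ ((k.+1 <= N)%N -> a k.+1 <= Q * q ^+ k.+1).
  by move=> k; have [] := S k.
elim: k => [|k [IH1 IH2]].
  split=> [_|N0]; first by rewrite expr0 mulr1.
  by apply: (le_trans (a1 N0)); rewrite expr1 ler_peMr.
split=> // kN; have h1 := IH1 (ltnW (ltnW kN)); have h2 := IH2 (ltnW kN).
apply: (le_trans (H k kN)).
set p := Q * q ^+ k.+1 in h2 *.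
have e1 : Q * q ^+ k <= p by rewrite /p exprS ler_wpM2l// ler_peMl// exprn_ge0// (le_trans ler01).
have e2 : Q <= p by rewrite /p ler_peMr// exprn_ege1.
have -> : Q * q ^+ k.+2 = p + (2 * L + 1) * h * p by rewrite /p /q !exprS; ring.
have b1 : a k <= p by exact: le_trans e1.
rewrite lerD//.
have : L * (a k + a k.+1) + Q <= (2 * L + 1) * p.
  have := ler_wpM2l L0 b1; have := ler_wpM2l L0 h2.
  by rewrite mulrDr mulrDl mul1r -mulrA; lra.
by move=> e3; rewrite -mulrA mulrCA ler_wpM2l.
Qed.

Lemma expn_le_expR (R : realType) (L h T : R) k : 0 <= L -> 0 <= h ->
  k%:R * h <= T -> (1 + L * h) ^+ k <= expR (L * T).
Proof.
move=> L0 h0 kT; have Lh : 0 <= L * h by exact: mulr_ge0.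
apply: (@le_trans _ _ (expR (L * h) ^+ k)).
  by rewrite lerXn2r ?nnegrE ?expR_ge0 ?addr_ge0// expR_ge1Dx.
by rewrite -expRM_natl ler_expR mulrCA ler_wpM2l.
Qed.

Section Comparison.
Variables (R : realType) (D : field_data R) (T M Hm cs Cs Mm : R).
Hypotheses (T0 : 0 < T) (cs0 : 0 < cs).
Notation V3 := (ix -> R).
Notation wf := (wf D Hm cs Cs Mm).
Notation bd := (bd D).
Notation om := (om D).
Notation un := (un D).
Notation bn := (bn D).
Notation good := (good D T M).

Lemma bet_le1 i y : `|bet D i y| <= 1.
Proof.
have := bet_unit D y; rewrite /sum3 => e.
have h : bet D i y ^+ 2 <= 1.
  have := sqr_ge0 (bet D X0 y); have := sqr_ge0 (bet D X1 y).
  by have := sqr_ge0 (bet D X2 y); case: i; lra.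
by rewrite -(@ler_pXn2r _ 2) ?nnegrE// expr1n real_normK ?num_real.
Qed.

Definition l1 (z : V3) : R := sum3 (fun i => `|z i|).

Lemma l1_ge0 z : 0 <= l1 z. Proof. by rewrite /l1 /sum3 !addr_ge0. Qed.

Lemma le_l1 z i : `|z i| <= l1 z.
Proof.
rewrite /l1 /sum3; move: (normr_ge0 (z X0)) (normr_ge0 (z X1)) (normr_ge0 (z X2)).
by case: i; lra.
Qed.

Lemma l1_le z C : (forall i, `|z i| <= C) -> l1 z <= 3 * C.
Proof. by move=> H; rewrite /l1 /sum3; have := H X0; have := H X1; have := H X2; lra. Qed.

(** Bounds up to [n] give the sharper estimate up to [n+1]; this gain of one index drives the
    continuation argument. Since [omega_0 = 0], the one-step bound starts the recursion with
    [omega_1 = O(h^2)]. *)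
Lemma om_bound (r : R) : 0 <= r -> exists2 C : R, 0 <= C &
  forall c n, wf c -> (forall k, (k <= n)%N -> bd r c k) ->
  (forall i, om c 0 i = 0) -> n.+1%:R * sh c <= T ->
  forall k, (k <= n.+1)%N -> forall i, `|om c k i| <= C * sh c ^+ 2.
Proof.
move=> r0.
have [Ca Ca0 Ha] := bO_ix (one_step_om' D Hm Cs Mm cs0 r0).
have [Cb Cb0 Hb] := bO_ix (two_step_dlt D Hm Cs Mm cs0 r0).
(* The factor 3 sums the coordinates; 6 also counts the two copies of [h^2] in [th2]. *)
pose L := 3 * Cb; pose q := 3 * Ca + 6 * Cb.
have L0 : 0 <= L by rewrite mulr_ge0.
have q0 : 0 <= q by rewrite addr_ge0// mulr_ge0.
exists (q * expR ((2 * L + 1) * T)); first by rewrite mulr_ge0// expR_ge0.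
move=> c n hw hbd om0 nT k kn i.
have [/andP[h0 _] _ _ _ _] := hw.
have h2 := sqr_ge0 (sh c).
have thE j : th D c j = l1 (om c j) + sh c ^+ 2 by [].
have := @gronwall2 R (fun j => l1 (om c j)) (q * sh c ^+ 2) L (sh c) n.+1
  (mulr_ge0 q0 h2) L0 (ltW h0).
have z0 : l1 (om c 0) = 0 by rewrite /l1 /sum3 !om0 normr0 !addr0.
rewrite z0 => /(_ (mulr_ge0 q0 h2)) /= G.
have G1 : (0 < n.+1)%N -> l1 (om c 1) <= q * sh c ^+ 2.
  move=> _; apply: (le_trans (l1_le (fun i => Ha i c 0%N (conj hw (hbd 0%N isT))))).
  rewrite thE z0 add0r /q mulrA ler_wpM2r//.
  by have := Cb0; lra.
have := G G1 _ k kn => {}G; apply: (le_trans (le_l1 _ i)); apply: (le_trans (G _)).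
- move=> j jn.
  have d2 : dom2 D Hm cs Cs Mm r c j by split=> //; apply: hbd; [exact: ltnW|].
  have hd := l1_le (fun i => Hb i c j d2).
  have : l1 (om c j.+2) <= l1 (om c j) + l1 (dlt D c j).
    have e a : `|om c j.+2 a| <= `|om c j a| + `|dlt D c j a|.
      by rewrite -[om c j.+2 a](subrKC (om c j a)) ler_normD.
    by rewrite /l1 /sum3; have := e X0; have := e X1; have := e X2; lra.
  move=> /le_trans; apply; rewrite lerD2l; apply: (le_trans hd).
  rewrite /th2 !thE /L /q.
  have -> : 3 * (Cb * (sh c * (l1 (om c j) + sh c ^+ 2 + (l1 (om c j.+1) + sh c ^+ 2)))) =
    sh c * (3 * Cb * (l1 (om c j) + l1 (om c j.+1)) + 6 * Cb * sh c ^+ 2) by ring.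
  rewrite ler_wpM2l ?(ltW h0)// lerD2l ler_wpM2r//.
  by have := Ca0; lra.
rewrite -[leRHS]mulrA [X in _ <= q * X]mulrC [leRHS]mulrA ler_wpM2l ?(mulr_ge0 q0 h2)//.
apply: expn_le_expR; [by rewrite addr_ge0// mulr_ge0|exact: ltW|].
apply: le_trans nT; rewrite ler_wpM2r ?(ltW h0)// ler_nat//.
Qed.

Lemma rhs_lip (r : R) : 0 <= r -> exists2 L : R, 0 <= L &
  forall (x X : V3) (a b m : R), inbox r x -> inbox r X -> `|a| <= r -> `|m| <= Mm ->
  (forall i, `|a * bet D i x - b * bet D i X| <= L * (dist1 x X + `|a - b|)) /\
  `|(bE D x - m * bR D x) - (bE D X - m * bR D X)| <= L * (dist1 x X + `|a - b|).
Proof.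
move=> r0.
have [L1 L10 H1] := loclip_ix (fun i => CC_loclip (CC_S (bet_CC D i))) r.
have [L2 L20 H2] := CC_loclip (CC_S (bE_CC D)) r.
have [L3 L30 H3] := CC_loclip (CC_S (bR_CC D)) r.
have M0 : 0 <= `|Mm| by [].
have rL1 := mulr_ge0 r0 L10; have ML := mulr_ge0 M0 L30.
exists (r * L1 + 1 + L2 + `|Mm| * L3); first by lra.
move=> x X a b m hx hX ha hm.
set d := dist1 x X; have d0 : 0 <= d by exact: ge0_dist1.
set g := `|a - b|; have g0 : 0 <= g by exact: normr_ge0.
have p1 := mulr_ge0 rL1 d0; have p2 := mulr_ge0 L20 d0; have p3 := mulr_ge0 ML d0.
have p4 := mulr_ge0 rL1 g0; have p5 := mulr_ge0 L20 g0; have p6 := mulr_ge0 ML g0.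
split=> [i|].
  have -> : a * bet D i x - b * bet D i X =
    a * (bet D i x - bet D i X) + (a - b) * bet D i X by ring.
  apply: (le_trans (ler_normD _ _)); rewrite !normrM -/g.
  have e1 : `|a| * `|bet D i x - bet D i X| <= r * (L1 * d) by rewrite ler_pM// H1.
  have e2 : g * `|bet D i X| <= g by rewrite ler_piMr// bet_le1.
  by clearbody d g; rewrite !mulrDl !mulrDr; lra.
have -> : bE D x - m * bR D x - (bE D X - m * bR D X) =
  (bE D x - bE D X) - m * (bR D x - bR D X) by ring.
apply: (le_trans (ler_normB _ _)); rewrite normrM.
have e1 : `|bE D x - bE D X| <= L2 * d by exact: H2.
have e2 : `|m| * `|bR D x - bR D X| <= `|Mm| * (L3 * d).
  by rewrite ler_pM// ?H3// (le_trans hm)// ler_norm.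
by clearbody d g; rewrite !mulrDl !mulrDr; lra.
Qed.

Notation Lam := (cs^-1).

(** The run [c] and the motion [tr] belong to the same problem. The modified initial velocity
    appears as equal parallel parts and [omega_0 = 0]. *)
Record linked (tr : trajectory R) (c : scheme R) : Prop := Linked {
  lk_x : sx c 0 = ox tr 0;
  lk_u : un c 0 = vpar D tr 0;
  lk_om : forall i, om c 0 i = 0;
  lk_m : sm c = mom D tr 0;
  lk_e : sk c * oe tr = sh c ^+ 2 }.

Lemma eps_le tr c : wf c -> linked tr c -> 0 < oe tr -> oe tr <= Lam * sh c ^+ 2.
Proof.
move=> [_ /andP[k0 _] _ _ _] [_ _ _ _ <-] e0.
rewrite mulrA; apply: ler_peMl; first exact: ltW.
by rewrite mulrC ler_pdivlMr// mul1r.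
Qed.

Variables (X : trajectory R -> R -> V3) (U : trajectory R -> R -> R).
Hypothesis HX : forall i, bO (onT D T M) (fun c _ => oe c) (fun c t => X c t i - ox c t i).
Hypothesis HU : bO (onT D T M) (fun c _ => oe c) (fun c t => U c t - vpar D c t).
Hypothesis HXc : forall i, bO (ctr D T M Lam) (fun _ j => j.1.2 ^+ 3)
  (fun c j => X c (j.1.1 + j.2) i - X c (j.1.1 - j.2) i
     - 2 * j.2 * (U c j.1.1 * bet D i (X c j.1.1))).
Hypothesis HUc : bO (ctr D T M Lam) (fun _ j => j.1.2 ^+ 3)
  (fun c j => U c (j.1.1 + j.2) - U c (j.1.1 - j.2)
     - 2 * j.2 * gforce D c (X c j.1.1)).
Hypothesis HXf : forall i, bO (fwd D T M Lam) (fun _ j => j.1.2 ^+ 2)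
  (fun c j => X c (j.1.1 + j.2) i - X c j.1.1 i
     - j.2 * (U c j.1.1 * bet D i (X c j.1.1))).
Hypothesis HUf : bO (fwd D T M Lam) (fun _ j => j.1.2 ^+ 2)
  (fun c j => U c (j.1.1 + j.2) - U c j.1.1 - j.2 * gforce D c (X c j.1.1)).

Definition err (tr : trajectory R) (c : scheme R) k : R :=
  l1 (fun i => sx c k i - X tr (k%:R * sh c) i) + `|un c k - U tr (k%:R * sh c)|.

Lemma err_ge0 tr c k : 0 <= err tr c k.
Proof. by rewrite addr_ge0// l1_ge0. Qed.

Lemma gforceE tr c k : linked tr c ->
  dot3 (bn c k) (Gn D c k) = gforce D tr (sx c k).
Proof.
by move=> lk; rewrite /gforce -(lk_m lk) /bE /bR /dot3 /sum3 /bn /Gn; ring.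
Qed.

Lemma err_bound (r : R) : 0 <= r -> exists2 C : R, 0 <= C &
  forall tr c n, good tr -> wf c -> linked tr c -> sh c <= 1 ->
  (forall k, (k <= n)%N -> bd r c k) ->
  (forall k, (k <= n)%N -> inbox r (X tr (k%:R * sh c))) ->
  n.+1%:R * sh c <= T ->
  forall k, (k <= n.+1)%N -> err tr c k <= C * sh c ^+ 2.
Proof.
move=> r0.
have [Co Co0 Ho] := om_bound r0.
(* One radius that serves both the a priori bounds and the bound [Co h^2] on [omega]. *)
pose r2 := r + Co; have r20 : 0 <= r2 by exact: addr_ge0.
have [S1 S10 HS1] := bO_ix (scheme_step_x D Hm Cs Mm cs0 r20).
have [S2 S20 HS2] := scheme_step_u D Hm Cs Mm cs0 r20.
have [S3 S30 HS3] := bO_ix (scheme_fwd_x D Hm Cs Mm cs0 r20).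
have [S4 S40 HS4] := scheme_fwd_u D Hm Cs Mm cs0 r20.
have [E1 E10 HE1] := bO_ix HXc; have [E2 E20 HE2] := HUc.
have [E3 E30 HE3] := bO_ix HXf; have [E4 E40 HE4] := HUf.
have [I1 I10 HI1] := bO_ix HX; have [I2 I20 HI2] := HU.
have [L L0 HL] := rhs_lip r0.
pose Z := S1 + S2 + S3 + S4 + E1 + E2 + E3 + E4.
have Z0 : 0 <= Z by rewrite /Z !addr_ge0.
pose Li := Lam * (I1 + I2).
have Li0 : 0 <= Li.
  by apply: mulr_ge0; [rewrite invr_ge0 ltW|exact: addr_ge0].
pose LL := 8 * L; have LL0 : 0 <= LL by rewrite mulr_ge0.
(* The initial error, its amplification over the first step, and the local defects. The factor 4
   counts three position components and one velocity; [LL] has a further 2 from the step [2 h]. *)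
pose Q := 4 * Li * (1 + LL) + 4 * Z.
have Q0 : 0 <= Q.
  apply: addr_ge0; last exact: mulr_ge0.
  by apply: mulr_ge0; [exact: mulr_ge0|exact: addr_ge0].
exists (Q * expR ((2 * LL + 1) * T)); first by rewrite mulr_ge0// expR_ge0.
move=> tr c n gd hw lk h1 hbd hX nT.
have [/andP[h0 _] _ hm _ _] := hw.
have h2 := sqr_ge0 (sh c).
have e0 := g_e0 gd; have ele := eps_le hw lk e0.
have hom := Ho c n hw hbd (lk_om lk) nT.
have bdS k : bd r c k -> bd r2 c k.
  move=> [b1 b2 b3]; split=> [i||i].
  - by apply: (le_trans (b1 i)); rewrite lerDl.
  - by apply: (le_trans b2); rewrite lerDl.
  - by apply: (le_trans (b3 i)); rewrite ler_wpM2r ?(ltW h0)// lerDl.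
have omS k i : (k <= n.+1)%N -> `|om c k i| <= r2 * sh c ^+ 2.
  by move=> kn; apply: (le_trans (hom k kn i)); rewrite ler_wpM2r// lerDr.
have kT k : (k <= n.+1)%N -> k%:R * sh c <= T.
  by move=> kn; apply: le_trans nT; rewrite ler_wpM2r ?(ltW h0)// ler_nat.
have kp k : 0 <= k%:R * sh c by rewrite mulr_ge0// ltW.
have lip k (kn : (k <= n)%N) := HL (sx c k) (X tr (k%:R * sh c)) (un c k)
  (U tr (k%:R * sh c)) (sm c) (let: And3 b _ _ := hbd k kn in b) (hX k kn)
  (let: And3 _ b _ := hbd k kn in b) hm.
(* The comparison path starts at [X(0)], not at [x(0)], so the initial error is [O(eps)] rather than
   0. *)
have I0 : err tr c 0 <= 4 * Li * sh c ^+ 2.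
  have o0 : onT D T M tr 0 by split=> //; rewrite lexx ltW.
  have a1 : l1 (fun i => sx c 0 i - X tr (0%:R * sh c) i) <= 3 * (I1 * oe tr).
    apply: l1_le => i; rewrite mul0r (lk_x lk) distrC; exact: (HI1 i tr 0 o0).
  have a2 : `|un c 0 - U tr (0%:R * sh c)| <= I2 * oe tr.
    by rewrite mul0r (lk_u lk) distrC; exact: (HI2 tr 0 o0).
  have a3 := ler_wpM2l I10 ele; have a4 := ler_wpM2l I20 ele.
  have -> : 4 * Li * sh c ^+ 2 = 4 * (I1 * (Lam * sh c ^+ 2)) + 4 * (I2 * (Lam * sh c ^+ 2)).
    by rewrite /Li; ring.
  have a5 := mulr_ge0 I10 (ltW e0); have a6 := mulr_ge0 I20 (ltW e0).
  by rewrite /err; move: a1 a2 a3 a4 a5 a6; set lam := Lam * _; lra.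
have := @gronwall2 R (err tr c) (Q * sh c ^+ 2) LL (sh c) n.+1
  (mulr_ge0 Q0 h2) LL0 (ltW h0).
have b0 : err tr c 0 <= Q * sh c ^+ 2.
  apply: (le_trans I0); rewrite ler_wpM2r// /Q.
  have := mulr_ge0 (mulr_ge0 (ler0n R 4) Li0) LL0; have := Z0.
  by rewrite mulrDr mulr1; lra.
move=> /(_ b0) G k kn; apply: (le_trans (G _ _ k kn)).
(* The second starting value, from the forward estimates of both sides. *)
- move=> _.
  have d1 : dom1s D Hm cs Cs Mm r2 c 0.
    by split; [split=> //; exact/bdS/hbd|move=> i; exact: omS].
  have f1 : fwd D T M Lam tr (0, sh c, sh c).
    split=> //; split=> //=.
    - by rewrite add0r; have := kT 1%N isT; rewrite mul1r.
    - by rewrite (ltW h0) lexx.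
    - by rewrite h0.
  have [l1a l1b] := lip 0%N isT.
  have t1 : 1%:R * sh c = 0 + sh c by rewrite mul1r add0r.
  have t0 : 0%:R * sh c = 0 by rewrite mul0r.
  have dE : dist1 (sx c 0) (X tr (0%:R * sh c)) + `|un c 0 - U tr (0%:R * sh c)| = err tr c 0 by [].
  rewrite dE in l1a l1b.
  have cx i : `|sx c 1 i - X tr (1%:R * sh c) i| <=
     `|sx c 0 i - X tr (0%:R * sh c) i| + (S3 + E3) * sh c ^+ 2 + L * err tr c 0.
    have s1 := HS3 i c 0%N d1; have s2 := HE3 i tr _ f1; have s3 := l1a i.
    rewrite /= in s2.
    have -> : sx c 1 i - X tr (1%:R * sh c) i = (sx c 0 i - X tr (0%:R * sh c) i)
      + ((sx c 1 i - sx c 0 i - sh c * (un c 0 * bn c 0 i)) -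
         (X tr (0 + sh c) i - X tr 0 i - sh c * (U tr 0 * bet D i (X tr 0))))
      + sh c * (un c 0 * bet D i (sx c 0) - U tr (0%:R * sh c) * bet D i (X tr (0%:R * sh c))).
      by rewrite t1 t0 /bn; ring.
    apply: (le_trans (ler_normD _ _)); apply: lerD.
      apply: (le_trans (ler_normD _ _)); rewrite lerD2l [leRHS]mulrDl.
      by apply: (le_trans (ler_normB _ _)); exact: (lerD s1 s2).
    rewrite normrM (ger0_norm (ltW h0)); apply: le_trans s3.
    by rewrite ler_piMl.
  have cu : `|un c 1 - U tr (1%:R * sh c)| <=
     `|un c 0 - U tr (0%:R * sh c)| + (S4 + E4) * sh c ^+ 2 + L * err tr c 0.
    have s1 := HS4 c 0%N d1; have s2 := HE4 tr _ f1.
    rewrite /= (gforceE _ lk) in s1; rewrite /= in s2.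
    have -> : un c 1 - U tr (1%:R * sh c) = (un c 0 - U tr (0%:R * sh c))
      + ((un c 1 - un c 0 - sh c * gforce D tr (sx c 0)) -
         (U tr (0 + sh c) - U tr 0 - sh c * gforce D tr (X tr 0)))
      + sh c * ((bE D (sx c 0) - sm c * bR D (sx c 0)) -
         (bE D (X tr (0%:R * sh c)) - sm c * bR D (X tr (0%:R * sh c)))).
      by rewrite t1 t0 /gforce (lk_m lk); ring.
    apply: (le_trans (ler_normD _ _)); apply: lerD.
      apply: (le_trans (ler_normD _ _)); rewrite lerD2l [leRHS]mulrDl.
      by apply: (le_trans (ler_normB _ _)); exact: (lerD s1 s2).
    rewrite normrM (ger0_norm (ltW h0)); apply: le_trans l1b.
    by rewrite ler_piMl.
  have : err tr c 1 <= err tr c 0 + (3 * (S3 + E3) + (S4 + E4)) * sh c ^+ 2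
      + 4 * (L * err tr c 0).
    rewrite {1 2}/err /l1 /sum3; have := cx X0; have := cx X1; have := cx X2; have := cu.
    by rewrite !mulrDl; lra.
  move=> /le_trans; apply.
  have q1 := ler_wpM2l L0 I0.
  have q2 : (3 * (S3 + E3) + (S4 + E4)) * sh c ^+ 2 <= 4 * Z * sh c ^+ 2.
    rewrite ler_wpM2r// /Z.
    by have := S10; have := S20; have := S30; have := S40; have := E10; have := E20; have := E30; have := E40; lra.
  have -> : Q * sh c ^+ 2 = 4 * Li * sh c ^+ 2 + 4 * Z * sh c ^+ 2
     + 8 * (L * (4 * Li * sh c ^+ 2)) by rewrite /Q /LL; ring.
  have q3 := mulr_ge0 L0 (mulr_ge0 (mulr_ge0 (ler0n R 4) Li0) h2).
  by move: I0 q1 q2 q3; lra.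
(* The recursion, from the centred estimates about step [j.+1]. *)
- move=> j jn.
  have jn1 : (j.+1 <= n)%N by [].
  have jn0 : (j <= n)%N by exact: ltnW.
  have d3 : dom3 D Hm cs Cs Mm r2 c j.
    split; first by split=> //; apply/bdS/hbd.
      by move=> i; apply: omS; exact: leqW.
    by move=> i; apply: omS; exact: leqW.
  have f3 : ctr D T M Lam tr (j.+1%:R * sh c, sh c, sh c).
    split=> //; split=> //=.
    - by rewrite -[leLHS]mul1r ler_wpM2r ?(ltW h0)// ler1n.
    - by have := kT j.+2 jn; rewrite -natr1 mulrDl mul1r.
    - by rewrite (ltW h0) lexx.
    - by rewrite h0.
  have [l1a l1b] := lip j.+1 jn1.
  have t2 : j.+2%:R * sh c = j.+1%:R * sh c + sh c by rewrite -natr1 mulrDl mul1r.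
  have t0 : j%:R * sh c = j.+1%:R * sh c - sh c by rewrite -[j.+1%:R]natr1 mulrDl mul1r addrK.
  have dE : dist1 (sx c j.+1) (X tr (j.+1%:R * sh c)) + `|un c j.+1 - U tr (j.+1%:R * sh c)|
     = err tr c j.+1 by [].
  rewrite dE in l1a l1b.
  have cx i : `|sx c j.+2 i - X tr (j.+2%:R * sh c) i| <=
     `|sx c j i - X tr (j%:R * sh c) i| + (S1 + E1) * sh c ^+ 3
      + sh c * (2 * (L * err tr c j.+1)).
    have s1 := HS1 i c j d3; have s2 := HE1 i tr _ f3; have s3 := l1a i.
    rewrite /= in s2.
    have -> : sx c j.+2 i - X tr (j.+2%:R * sh c) i = (sx c j i - X tr (j%:R * sh c) i)
      + ((sx c j.+2 i - sx c j i - 2 * sh c * (un c j.+1 * bn c j.+1 i)) -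
         (X tr (j.+1%:R * sh c + sh c) i - X tr (j.+1%:R * sh c - sh c) i
         - 2 * sh c * (U tr (j.+1%:R * sh c) * bet D i (X tr (j.+1%:R * sh c)))))
      + sh c * (2 * (un c j.+1 * bet D i (sx c j.+1) - U tr (j.+1%:R * sh c) * bet D i (X tr (j.+1%:R * sh c)))).
      by rewrite t2 t0 /bn; ring.
    apply: (le_trans (ler_normD _ _)); apply: lerD.
      apply: (le_trans (ler_normD _ _)); rewrite lerD2l [leRHS]mulrDl.
      by apply: (le_trans (ler_normB _ _)); exact: (lerD s1 s2).
    rewrite normrM (ger0_norm (ltW h0)) ler_wpM2l ?(ltW h0)//.
    by rewrite normrM ger0_norm// ler_wpM2l.
  have cu : `|un c j.+2 - U tr (j.+2%:R * sh c)| <=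
     `|un c j - U tr (j%:R * sh c)| + (S2 + E2) * sh c ^+ 3 + sh c * (2 * (L * err tr c j.+1)).
    have s1 := HS2 c j d3; have s2 := HE2 tr _ f3.
    rewrite /= (gforceE _ lk) in s1; rewrite /= in s2.
    have -> : un c j.+2 - U tr (j.+2%:R * sh c) = (un c j - U tr (j%:R * sh c))
      + ((un c j.+2 - un c j - 2 * sh c * gforce D tr (sx c j.+1)) -
         (U tr (j.+1%:R * sh c + sh c) - U tr (j.+1%:R * sh c - sh c)
           - 2 * sh c * gforce D tr (X tr (j.+1%:R * sh c))))
      + sh c * (2 * ((bE D (sx c j.+1) - sm c * bR D (sx c j.+1)) -
         (bE D (X tr (j.+1%:R * sh c)) - sm c * bR D (X tr (j.+1%:R * sh c))))).
      by rewrite t2 t0 /gforce (lk_m lk); ring.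
    apply: (le_trans (ler_normD _ _)); apply: lerD.
      apply: (le_trans (ler_normD _ _)); rewrite lerD2l [leRHS]mulrDl.
      by apply: (le_trans (ler_normB _ _)); exact: (lerD s1 s2).
    rewrite normrM (ger0_norm (ltW h0)) ler_wpM2l ?(ltW h0)//.
    by rewrite normrM ger0_norm// ler_wpM2l.
  have : err tr c j.+2 <= err tr c j + (3 * (S1 + E1) + (S2 + E2)) * sh c ^+ 3
      + sh c * (8 * (L * err tr c j.+1)).
    rewrite {1 2}/err /l1 /sum3; have := cx X0; have := cx X1; have := cx X2; have := cu.
    by rewrite !mulrDl; lra.
  move=> /le_trans; apply; rewrite -addrA lerD2l.
  have -> : (3 * (S1 + E1) + (S2 + E2)) * sh c ^+ 3 + sh c * (8 * (L * err tr c j.+1)) =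
    sh c * (LL * err tr c j.+1 + (3 * (S1 + E1) + (S2 + E2)) * sh c ^+ 2).
    by rewrite /LL; ring.
  rewrite ler_wpM2l ?(ltW h0)//; apply: lerD.
    by rewrite ler_wpM2l// lerDr err_ge0.
  rewrite ler_wpM2r// /Q /Z.
  have := mulr_ge0 (mulr_ge0 (ler0n R 4) Li0) (addr_ge0 ler01 LL0).
  by have := S10; have := S20; have := S30; have := S40; have := E10; have := E20; have := E30; have := E40; lra.
rewrite -[leRHS]mulrA [X in _ <= Q * X]mulrC [leRHS]mulrA ler_wpM2l ?(mulr_ge0 Q0 h2)//.
apply: expn_le_expR; [by rewrite addr_ge0// mulr_ge0|exact: ltW|exact: kT].
Qed.
End Comparison.

(** * Continuation of the a priori bounds and convergence *)

Section Convergence.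
Variables (R : realType) (D : field_data R) (T M Hm cs Cs Mm phimin : R).
Hypotheses (T0 : 0 < T) (cs0 : 0 < cs).
Hypothesis pot_lb : forall y, phimin <= pot D y.
Notation wf := (wf D Hm cs Cs Mm).
Notation good := (good D T M).
Notation om := (om D).
Notation un := (un D).
Notation bn := (bn D).
Notation linked := (linked D).

Definition concl (C : R) (tr : trajectory R) (c : scheme R) n :=
  let t := n%:R * sh c in
  [/\ forall i, `|sx c n i - ox tr t i| <= C * sh c ^+ 2,
      forall i, `|un c n * bn c n i - vpar D tr t * bet D i (ox tr t)| <= C * sh c ^+ 2
    & forall i, `|wn D c n i| <= C * sh c ^+ 2].

Lemma concl_le C C' tr c n : C <= C' -> concl C tr c n -> concl C' tr c n.
Proof.
move=> le [a1 a2 a3]; split=> i.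
- by apply: (le_trans (a1 i)); rewrite ler_wpM2r// sqr_ge0.
- by apply: (le_trans (a2 i)); rewrite ler_wpM2r// sqr_ge0.
- by apply: (le_trans (a3 i)); rewrite ler_wpM2r// sqr_ge0.
Qed.

Lemma wn_le c n (B : R) i : wf c -> (forall i, `|om c n i| <= B) ->
  `|wn D c n i| <= 2 * cs^-1 * B.
Proof.
move=> hw hB; have B0 : 0 <= B by apply: le_trans (hB X0).
rewrite (wn_om cs0 n i hw) normrM.
have e1 : `|ikr D c n| <= cs^-1.
  have k0 := skrho_gt0 cs0 n hw; have [_ /andP[k1 _] _ _ _] := hw.
  rewrite /ikr ger0_norm ?invr_ge0 ?(ltW k0)// lef_pV2 ?posrE//.
  by rewrite (le_trans k1)// ler_peMr ?rho_ge1// (le_trans _ k1)// ltW.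
have p a b : `|bn c n a * om c n b| <= B.
  rewrite normrM; apply: le_trans (hB b); rewrite ler_piMl//; exact: bet_le1.
have e2 : `|cross3 (bn c n) (om c n) i| <= 2 * B.
  have e a b : `|bn c n a * om c n b - bn c n b * om c n a| <= 2 * B.
    apply: (le_trans (ler_normB _ _)); have := p a b; have := p b a; lra.
  by case: i; rewrite /cross3; exact: e.
rewrite (_ : 2 * cs^-1 * B = cs^-1 * (2 * B)); last by ring.
by rewrite ler_pM.
Qed.

Lemma exact_bounds : exists2 r : R, 0 <= r & forall tr t, good tr -> 0 <= t <= T ->
  inbox r (ox tr t) /\ `|vpar D tr t| <= r.
Proof.
have [r1 r10 H1] := bO_inbox (@bounded_x R D T M T0 phimin pot_lb).
have [r2 r20 H2] := @bounded_vpar R D T M T0 phimin pot_lb.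
exists (r1 + r2) => [|tr t gd tT]; first exact: addr_ge0.
have o : onT D T M tr t by split.
split=> [i|]; first by apply: (le_trans (H1 _ _ o i)); rewrite lerDl.
by apply: (le_trans (H2 _ _ o)); rewrite mulr1 lerDr.
Qed.

Lemma concl0 tr c : wf c -> linked tr c -> concl 0 tr c 0.
Proof.
move=> hw lk; rewrite /concl mul0r mul0r; split=> i.
- by rewrite (lk_x lk) subrr normr0.
- by rewrite /bn (lk_u lk) (lk_x lk) subrr normr0.
- have := @wn_le c 0%N 0 i hw; rewrite mulr0; apply=> k.
  by rewrite (lk_om lk) normr0.
Qed.

Lemma small_steps : exists h0 C : R, [/\ 0 < h0, 0 <= C &
  forall tr c n, good tr -> wf c -> linked tr c -> sh c <= h0 ->
  n%:R * sh c <= T -> concl C tr c n].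
Proof.
have Lam0 : 0 < cs^-1 by rewrite invr_gt0.
have [X [U [[HX HU HXc HUc] [HXf HUf]]]] := @guiding_center_steps R D T M T0 phimin pot_lb cs^-1 Lam0.
have [rx rx0 Hrx] := exact_bounds.
have [I1 I10 HI1] := bO_ix HX; have [I2 I20 HI2] := HU.
(* [rx] bounds the exact motion, [I1] and [I2] its distance to [X] and [U] (as [eps < 1]), and 1 is
   the margin left to the numerical error. *)
pose r := rx + I1 + I2 + 1.
have r0 : 0 <= r by rewrite /r !addr_ge0.
have [Co Co0 Ho] := @om_bound R D T Hm cs Cs Mm cs0 r r0.
have [Ce Ce0 He] := err_bound Hm Cs Mm T0 cs0 HX HU HXc HUc HXf HUf r0.
have [L L0 HL] := @rhs_lip R D Mm r r0.
(* Below this threshold [h], [h Ce] and [h Co] are at most 1, so the errors fit in the margin. *)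
pose h0 := (1 + Ce + Co)^-1.
have s0 : 0 < 1 + Ce + Co by rewrite -addrA addrC ltr_wpDl// addr_ge0.
have h00 : 0 < h0 by rewrite invr_gt0.
pose A1 := Ce + cs^-1 * I1; pose A2 := Ce + cs^-1 * I2.
have A10 : 0 <= A1 by rewrite addr_ge0// mulr_ge0// ltW.
have A20 : 0 <= A2 by rewrite addr_ge0// mulr_ge0// ltW.
pose C := A1 + L * (3 * A1 + A2) + 2 * cs^-1 * Co.
have B0 : 0 <= L * (3 * A1 + A2) by rewrite mulr_ge0// addr_ge0// mulr_ge0.
have B1 : 0 <= 2 * cs^-1 * Co by rewrite mulr_ge0// mulr_ge0// ltW.
have Cp : 0 <= C by exact: (addr_ge0 (addr_ge0 A10 B0) B1).
exists h0, C; split=> //.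
move=> tr c n gd hw lk hh.
have [/andP[hp _] _ hm _ _] := hw.
have sh1 : sh c * (1 + Ce + Co) <= 1 by rewrite -ler_pdivlMr// mul1r.
have hCe : sh c * Ce <= 1.
  apply: le_trans sh1; rewrite ler_wpM2l ?(ltW hp)//; have := Co0; lra.
have hCo : sh c * Co <= 1.
  apply: le_trans sh1; rewrite ler_wpM2l ?(ltW hp)//; have := Ce0; lra.
have h1 : sh c <= 1.
  by apply: le_trans sh1; rewrite ler_peMr ?(ltW hp)//; have := Co0; have := Ce0; lra.
have kp k : 0 <= k%:R * sh c by rewrite mulr_ge0// ltW.
have e0 := g_e0 gd; have e1 := g_e1 gd.
have XB k : k%:R * sh c <= T -> inbox (rx + I1) (X tr (k%:R * sh c)).
  move=> kT i; have kk : 0 <= k%:R * sh c <= T by rewrite kp.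
  have [b1 _] := Hrx tr _ gd kk.
  have a1 := HI1 i tr (k%:R * sh c) (conj gd kk).
  rewrite -[X tr _ i](subrKC (ox tr (k%:R * sh c) i)).
  apply: (le_trans (ler_normD _ _)); rewrite lerD//; apply: (le_trans a1).
  by rewrite ler_piMr// ltW.
have UB k : k%:R * sh c <= T -> `|U tr (k%:R * sh c)| <= rx + I2.
  move=> kT; have kk : 0 <= k%:R * sh c <= T by rewrite kp.
  have [_ b1] := Hrx tr _ gd kk.
  have a1 := HI2 tr (k%:R * sh c) (conj gd kk).
  rewrite -[U tr _](subrKC (vpar D tr (k%:R * sh c))).
  apply: (le_trans (ler_normD _ _)); rewrite lerD//; apply: (le_trans a1).
  by rewrite ler_piMr// ltW.
have XB' k : k%:R * sh c <= T -> inbox r (X tr (k%:R * sh c)).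
  by move=> kT i; apply: (le_trans (XB k kT i)); rewrite /r; have := I20; lra.
have mono k m : (k <= m)%N -> m%:R * sh c <= T -> k%:R * sh c <= T.
  by move=> km; apply: le_trans; rewrite ler_wpM2r ?(ltW hp)// ler_nat.
(* Continuation: the bounds up to [m] give, via [Ho] and [He], estimates at [m.+1] that restore [bd]
   with the same radius. *)
have S m : m%:R * sh c <= T -> forall k, (k <= m)%N -> bd D r c k.
  elim: m => [|m IH] mT k.
    rewrite leqn0 => /eqP ->.
    have z0 : 0 <= (0 : R) <= T by rewrite lexx ltW.
    have [b1 b2] := Hrx tr 0 gd z0.
    split=> [i||i].
    - rewrite (lk_x lk); apply: (le_trans (b1 i)).
      by rewrite /r; have := I10; have := I20; lra.
    - rewrite (lk_u lk); apply: (le_trans b2).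
      by rewrite /r; have := I10; have := I20; lra.
    - by rewrite (lk_om lk) normr0 mulr_ge0// ltW.
  rewrite leq_eqVlt => /orP[/eqP ->|]; last first.
    by rewrite ltnS; apply: IH; exact: mono mT.
  have IHm := IH (mono _ _ (leqnSn m) mT).
  have om1 := Ho c m hw IHm (lk_om lk) mT m.+1 (leqnn _).
  have er1 := He tr c m gd hw lk h1 IHm (fun k km => XB' k (mono _ _ (leqW km) mT)) mT m.+1 (leqnn _).
  have er2 : err D X U tr c m.+1 <= 1.
    apply: (le_trans er1); apply: le_trans hCe; rewrite expr2 mulrA [leRHS]mulrC.
    by rewrite ler_piMr// mulr_ge0// ltW.
  split=> [i||i].
  - rewrite -[sx c m.+1 i](subrKC (X tr (m.+1%:R * sh c) i)).
    apply: (le_trans (ler_normD _ _)).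
    have a1 := XB _ mT i.
    have a2 := le_l1 (fun i => sx c m.+1 i - X tr (m.+1%:R * sh c) i) i.
    have a3 := normr_ge0 (un c m.+1 - U tr (m.+1%:R * sh c)).
    rewrite /err in er2; rewrite /r; have := I20; move: a1 a2 a3 er2.
    by move: (l1 _) => q; rewrite /=; lra.
  - rewrite -[un c m.+1](subrKC (U tr (m.+1%:R * sh c))).
    apply: (le_trans (ler_normD _ _)).
    have a1 := UB _ mT.
    have a2 := l1_ge0 (fun i => sx c m.+1 i - X tr (m.+1%:R * sh c) i).
    rewrite /err in er2; rewrite /r; have := I10; move: a1 a2 er2.
    by move: (l1 _) => q; lra.
  - apply: (le_trans (om1 i)); rewrite expr2 mulrA ler_wpM2r ?(ltW hp)//.
    rewrite mulrC; apply: (le_trans hCo); rewrite /r.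
    by have := rx0; have := I10; have := I20; lra.
case: n => [_|m mT].
  exact: (concl_le Cp (concl0 hw lk)).
have Sm := S m.+1 mT.
have om1 := Ho c m hw (fun k km => Sm k (leqW km)) (lk_om lk) mT m.+1 (leqnn _).
have er1 := He tr c m gd hw lk h1 (fun k km => Sm k (leqW km))
  (fun k km => XB' k (mono _ _ (leqW km) mT)) mT m.+1 (leqnn _).
have kk : 0 <= m.+1%:R * sh c <= T by rewrite kp.
set t := m.+1%:R * sh c in er1 kk.
have ele := eps_le cs0 hw lk e0.
have dx i : `|sx c m.+1 i - ox tr t i| <= A1 * sh c ^+ 2.
  rewrite (_ : _ - _ = (sx c m.+1 i - X tr t i) + (X tr t i - ox tr t i)); last by ring.
  apply: (le_trans (ler_normD _ _)); rewrite /A1 mulrDl lerD//.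
    apply: le_trans er1; rewrite /err -/t.
    have a2 := le_l1 (fun i => sx c m.+1 i - X tr t i) i.
    by apply: (le_trans a2); rewrite lerDl.
  apply: (le_trans (HI1 i tr t (conj gd kk))).
  rewrite [leRHS](_ : _ = I1 * (cs^-1 * sh c ^+ 2)); last by ring.
  by rewrite ler_wpM2l.
have du : `|un c m.+1 - vpar D tr t| <= A2 * sh c ^+ 2.
  rewrite (_ : _ - _ = (un c m.+1 - U tr t) + (U tr t - vpar D tr t)); last by ring.
  apply: (le_trans (ler_normD _ _)); rewrite /A2 mulrDl lerD//.
    apply: le_trans er1; rewrite /err -/t.
    by rewrite lerDr l1_ge0.
  apply: (le_trans (HI2 tr t (conj gd kk))).
  rewrite [leRHS](_ : _ = I2 * (cs^-1 * sh c ^+ 2)); last by ring.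
  by rewrite ler_wpM2l.
have [b1 b2 b3] := Sm m.+1 (leqnn _).
have [c1' c2'] := Hrx tr t gd kk.
have c1r : inbox r (ox tr t).
  by move=> i; apply: (le_trans (c1' i)); rewrite /r; have := I10; have := I20; lra.
have [l1' _] := HL (sx c m.+1) (ox tr t) (un c m.+1) (vpar D tr t) (sm c) b1 c1r b2 hm.
have h2 := sqr_ge0 (sh c).
have a1 : A1 <= C by rewrite /C -addrA lerDl (addr_ge0 B0 B1).
have a2 : L * (3 * A1 + A2) <= C by rewrite /C addrAC lerDr (addr_ge0 A10 B1).
have a3 : 2 * cs^-1 * Co <= C by rewrite /C lerDr (addr_ge0 A10 B0).
rewrite /concl -/t; split=> i.
- by apply: (le_trans (dx i)); rewrite ler_wpM2r.
- apply: (le_trans (l1' i)).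
  apply: (@le_trans _ _ (L * (3 * A1 + A2) * sh c ^+ 2)); last by rewrite ler_wpM2r.
  rewrite -[leRHS]mulrA ler_wpM2l// [leRHS]mulrDl lerD//.
  by rewrite -[leRHS]mulrA; exact: (l1_le dx).
- by apply: (le_trans (wn_le i hw om1)); rewrite mulrA ler_wpM2r.
Qed.

(** The radius deteriorates at each step, which is harmless for a number of steps fixed in
    advance. *)
Lemma bounded_iterates (N : nat) : exists2 r : R, 0 <= r &
  forall tr c n, good tr -> wf c -> linked tr c -> (n <= N)%N -> bd D r c n.
Proof.
elim: N => [|N [r r0 IH]].
  have [rx rx0 Hrx] := exact_bounds.
  exists rx => // tr c n gd hw lk; rewrite leqn0 => /eqP ->.
  have [|b1 b2] := Hrx tr 0 gd; first by rewrite lexx ltW.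
  have [/andP[hp _] _ _ _ _] := hw.
  split=> [i||i].
  - by rewrite (lk_x lk).
  - by rewrite (lk_u lk).
  - by rewrite (lk_om lk) normr0 mulr_ge0// ltW.
have [C1 C10 H1] := bO_ix (one_step_x' D Hm Cs Mm cs0 r0).
have [C2 C20 H2] := one_step_u' D Hm Cs Mm cs0 r0.
have [C3 C30 H3] := bO_ix (one_step_om' D Hm Cs Mm cs0 r0).
pose q := C3 * (3 * r + `|Hm|).
have q0 : 0 <= q by rewrite mulr_ge0// addr_ge0// mulr_ge0.
exists (r + C1 + C2 + q); first by rewrite !addr_ge0.
move=> tr c n gd hw lk; rewrite leq_eqVlt => /orP[/eqP ->|]; last first.
  rewrite ltnS => nN; have [b1 b2 b3] := IH tr c n gd hw lk nN.
  have [/andP[hp _] _ _ _ _] := hw.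
  split=> [i||i].
  - by apply: (le_trans (b1 i)); lra.
  - by apply: (le_trans b2); lra.
  - by apply: (le_trans (b3 i)); rewrite ler_wpM2r ?(ltW hp)//; lra.
have b := IH tr c N gd hw lk (leqnn _).
have d1 : dom1 D Hm cs Cs Mm r c N by split.
have [/andP[hp hH] _ _ _ _] := hw; have [_ _ b3] := b.
split=> [i||i].
- by apply: (le_trans (H1 i c N d1)); rewrite mulr1; lra.
- by apply: (le_trans (H2 c N d1)); rewrite mulr1; lra.
- apply: (le_trans (H3 i c N d1)).
  apply: (@le_trans _ _ (q * sh c)); last by rewrite ler_wpM2r ?(ltW hp)//; lra.
  rewrite /q -mulrA ler_wpM2l// /th mulrDl lerD//.
    by rewrite -mulrA; exact: (l1_le b3).
  by rewrite expr2 ler_wpM2r ?(ltW hp)// (le_trans hH)// ler_norm.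
Qed.

(** At most [T / h0] steps fit in [[0, T]], so all quantities stay bounded, and a bounded error is
    [O(h^2)] because [h >= h0]. *)
Lemma large_steps (h0 : R) : 0 < h0 -> exists2 C : R, 0 <= C &
  forall tr c n, good tr -> wf c -> linked tr c -> h0 <= sh c ->
  n%:R * sh c <= T -> concl C tr c n.
Proof.
move=> h00.
have [rx rx0 Hrx] := exact_bounds.
pose N := Num.bound (T / h0).
have [r r0 Hr] := bounded_iterates N.
pose q := 2 * cs^-1 * (r * `|Hm|).
have q0 : 0 <= q by rewrite !mulr_ge0// ?invr_ge0 ?ltW.
pose A := r + rx + q.
have A0 : 0 <= A by rewrite !addr_ge0.
exists (A / h0 ^+ 2); first by rewrite divr_ge0// sqr_ge0.
move=> tr c n gd hw lk hh nT.
have [/andP[hp hH] _ _ _ _] := hw.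
have nN : (n <= N)%N.
  rewrite -(ler_nat R); apply: (@le_trans _ _ (T / h0)).
    rewrite ler_pdivlMr//; apply: le_trans nT.
    by rewrite ler_wpM2l.
  by apply: ltW; apply: archi_boundP; rewrite divr_ge0// ltW.
have [b1 b2 b3] := Hr tr c n gd hw lk nN.
have kk : 0 <= n%:R * sh c <= T by rewrite nT mulr_ge0// ltW.
have [c1' c2'] := Hrx tr _ gd kk.
have AA : A <= A / h0 ^+ 2 * sh c ^+ 2.
  rewrite mulrAC ler_pdivlMr ?exprn_gt0// ler_wpM2l//.
  by rewrite ler_pXn2r ?nnegrE ?(ltW h00) ?(ltW hp).
split=> i; apply: (le_trans _ AA).
- apply: (le_trans (ler_normB _ _)); have := b1 i; have := c1' i; rewrite /A; lra.
- apply: (le_trans (ler_normB _ _)); rewrite !normrM.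
  have e1 : `|un c n| * `|bn c n i| <= r.
    by apply: le_trans b2; rewrite ler_piMr//; exact: bet_le1.
  have e2 : `|vpar D tr (n%:R * sh c)| * `|bet D i (ox tr (n%:R * sh c))| <= rx.
    by apply: le_trans c2'; rewrite ler_piMr//; exact: bet_le1.
  by rewrite /A; lra.
- have om1 k : `|om c n k| <= r * `|Hm|.
    by apply: (le_trans (b3 k)); rewrite ler_wpM2l// (le_trans hH)// ler_norm.
  by apply: (le_trans (wn_le i hw om1)); rewrite -/q /A; lra.
Qed.

Theorem scheme_converges : exists2 C : R, 0 <= C &
  forall tr c n, good tr -> wf c -> linked tr c -> n%:R * sh c <= T -> concl C tr c n.
Proof.
have [h0 [C1 [h00 C10 H1]]] := small_steps.
have [C2 C20 H2] := large_steps h00.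
exists (C1 + C2) => [|tr c n gd hw lk nT]; first exact: addr_ge0.
have [hh|hh] := leP (sh c) h0.
  by apply: concl_le (H1 tr c n gd hw lk hh nT); rewrite lerDl.
by apply: concl_le (H2 tr c n gd hw lk (ltW hh) nT); rewrite lerDr.
Qed.

End Convergence.

(** * From coordinates back to the vectors of the statement *)

Section Translation.
Variables (R : realType) (D : field_data R) (B1 : 'rV[R]_3 -> 'rV[R]_3).
Hypothesis BE : forall y i, cvec (B1 (mkv y)) i = rho D y * bet D i y.
Variable eps : R.
Hypothesis eps0 : 0 < eps.
Notation V := 'rV[R]_3.
Let B (x : V) : V := eps^-1 *: B1 x.

Lemma cvecB (x : V) i : cvec (B x) i = eps^-1 * (rho D (cvec x) * bet D i (cvec x)).
Proof. by rewrite cvecZ -BE mkv_cvec. Qed.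

Let e0 : eps != 0. Proof. exact: lt0r_neq0. Qed.

Lemma cvec_Ppar (x v : V) i : cvec (Ppar B x v) i =
  dot3 (fun k => bet D k (cvec x)) (cvec v) * bet D i (cvec x).
Proof.
rewrite /Ppar cvecZ !cvec_dot cvecB.
set r := rho D _; have r0 : r != 0 by exact: rho_neq0.
pose b k := bet D k (cvec x).
have -> : dot3 (cvec (B x)) (cvec (B x)) = (eps^-1 * r) ^+ 2 * sum3 (fun k => b k ^+ 2).
  by rewrite /dot3 /sum3 !cvecB /b /r; ring.
have -> : sum3 (fun k => b k ^+ 2) = 1 by exact: bet_unit.
rewrite /dot3 /sum3 !cvecB -/r -!/(b _); field.
by rewrite r0 e0.
Qed.

Lemma cvec_crossB (v x : V) i : cvec (cross v (B x)) i =
  eps^-1 * (rho D (cvec x) * cross3 (cvec v) (fun k => bet D k (cvec x)) i).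
Proof.
rewrite cvec_cross; case: i; rewrite /cross3 !cvecB; ring.
Qed.

Lemma enorm_B (x : V) : enorm (B x) = eps^-1 * rho D (cvec x).
Proof.
have h0 : 0 <= eps^-1 * rho D (cvec x).
  by rewrite mulr_ge0// ?invr_ge0 ?ltW// (lt_le_trans ltr01)// rho_ge1.
rewrite enorm_cvec -[RHS](ger0_norm h0) -sqrtr_sqr; congr (Num.sqrt _).
rewrite -[RHS]mulr1 -(bet_unit D (cvec x)) /sum3 !cvecB; ring.
Qed.

(** Lagrange's identity for [|v x b|^2]. The factor [eps] cancels the [1/eps] of [grad |B|] in the
    scheme. *)
Lemma magmomE (x v : V) : magmom B x v =
  eps * ((rho D (cvec x))^-1 * (2^-1 * (dot3 (cvec v) (cvec v) -
     dot3 (fun k => bet D k (cvec x)) (cvec v) ^+ 2))).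
Proof.
rewrite /magmom enorm_B.
set r := rho D _; have r0 : r != 0 by exact: rho_neq0.
pose b k := bet D k (cvec x).
have -> : enorm (cross v (B x)) ^+ 2 = (eps^-1 * r) ^+ 2 *
    (sum3 (fun k => b k ^+ 2) * dot3 (cvec v) (cvec v) - dot3 b (cvec v) ^+ 2).
  rewrite enorm_cvec sqr_sqrtr; last by rewrite /sum3 !addr_ge0// sqr_ge0.
  by rewrite /sum3 !cvec_crossB -/r /cross3 /dot3 /sum3 /b; ring.
have -> : sum3 (fun k => b k ^+ 2) = 1 by exact: bet_unit.
by rewrite mul1r -/b; field; rewrite r0 e0.
Qed.

End Translation.

Theorem theorem2p1 (R : realType)
  (B1 : 'rV[R]_3 -> 'rV[R]_3) (A1 : 'rV[R]_3 -> 'rV[R]_3) (phi : 'rV[R]_3 -> R)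
  (hB1 : smooth B1) (hA1 : smooth A1) (hphi : smooth phi)
  (hcurl : forall x, curl A1 x = B1 x)
  (hB1ge : forall x, 1 <= enorm (B1 x))
  (hphib : exists m : R, forall x, m <= phi x)
  (M0 M1 T cs Cs K : R)
  (hT : 0 < T) (hcs : 0 < cs) (hCs : 0 < Cs) (hK : 0 < K) :
  exists C : R, 0 < C /\
  forall (eps h : R), 0 < eps -> eps < 1 -> 0 < h ->
  cs * eps <= h ^+ 2 -> h ^+ 2 <= Cs * eps ->
  let B := fun x => eps^-1 *: B1 x in
  let E := fun x => - grad phi x in
  forall (x dx ddx : R -> 'rV[R]_3),
  (forall t : R, is_derive t (1 : R) x (dx t)) ->
  (forall t : R, is_derive t (1 : R) dx (ddx t)) ->
  (forall t, 0 <= t <= T -> ddx t = cross (dx t) (B (x t)) + E (x t)) ->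
  enorm (x 0) <= M0 -> enorm (dx 0) <= M1 ->
  let mu0 := magmom B (x 0) (dx 0) in
  let v0 := Ppar B (x 0) (dx 0) in
  let F := fun y v => cross v (B y) + E y - mu0 *: grad (normB B) y in
  forall xs : nat -> 'rV[R]_3,
  xs 0%N = x 0 ->
  xs 1%N = xs 0%N + h *: v0 + (h ^+ 2 / 2) *: F (xs 0%N) v0 ->
  (forall n : nat, (h ^+ 2)^-1 *: (xs n.+2 - 2 *: xs n.+1 + xs n)
                     = F (xs n.+1) (numv h v0 xs n.+1)) ->
  (forall n : nat, n%:R * h <= T -> Linv_bounded K h B (xs n) (numv h v0 xs n)) ->
  forall n : nat, n%:R * h <= T ->
    [/\ enorm (xs n - x (n%:R * h)) <= C * h ^+ 2,
        enorm (Ppar B (xs n) (numv h v0 xs n)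
               - Ppar B (x (n%:R * h)) (dx (n%:R * h))) <= C * h ^+ 2
      & enorm (Pperp B (xs n) (numv h v0 xs n)) <= C * h ^+ 2].
Proof.
have [D [BE potE EfE gE]] := field_data_exists hB1 hA1 hphi hcurl hB1ge.
have [phimin pm] := hphib.
have pot_lb y : phimin <= pot D y by rewrite potE.
pose M := `|M0| + `|M1|.
have [Mm Mm0 HMm] := @bounded_mom R D T M hT phimin pot_lb.
(* The bound [Cs + 1] on [h] follows from [h^2 <= Cs eps <= Cs]. *)
have [C C0 HC] := @scheme_converges R D T M (Cs + 1) cs Cs Mm phimin hT hcs pot_lb.
(* The 2 passes from coordinates to the Euclidean norm by [enorm_le]; the 1 makes the constant
   positive. *)
exists (2 * C + 1); split; first by rewrite ltr_wpDl// mulr_ge0.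
move=> eps h eps0 eps1 h0 hlo hhi B E x dx ddx dxd dvd ode x0M v0M mu0 v0 F xs xs0 xs1 rec _ n nT.
have en0 : eps != 0 by exact: lt0r_neq0.
have hn0 : h != 0 by exact: lt0r_neq0.
pose tr := Trajectory eps (fun t => cvec (x t)) (fun t => cvec (dx t)) (fun t => cvec (ddx t)).
pose v k := numv h v0 xs k.
pose c := Scheme h (h ^+ 2 / eps) (mom D tr 0) (fun k => cvec (xs k)) (fun k => cvec (v k)).
have gd : good D T M tr.
  split=> //=.
  - by move=> t i; exact: is_derive_cvec.
  - by move=> t i; exact: is_derive_cvec.
  - move=> t i tT; rewrite (ode t tT) cvecD (cvec_crossB BE) /E -EfE mkv_cvec.
    by field.
  - move=> i; apply: (le_trans (cvec_le_enorm _ _)); apply: (le_trans x0M).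
    by rewrite /M (le_trans (ler_norm _))// lerDl.
  - move=> i; apply: (le_trans (cvec_le_enorm _ _)); apply: (le_trans v0M).
    by rewrite /M (le_trans (ler_norm _))// lerDr.
have mu0E : mu0 = eps * mom D tr 0.
  by rewrite /mu0 (magmomE BE eps0) /mom /irho /vsq /vpar /dot3 -expr2.
have FE k i : h ^+ 2 * cvec (F (xs k) (v k)) i = an D c k i.
  have e1 : cvec (E (xs k)) i = Ef D i (cvec (xs k)) by rewrite -EfE mkv_cvec.
  have e2 : cvec (- (mu0 *: grad (normB B) (xs k))) i = - (mom D tr 0 * rhog D i (cvec (xs k))).
    rewrite cvecN cvecZ -{1}(mkv_cvec (xs k)) (gE _ _ _ eps0) mu0E.
    by field.
  rewrite /F cvecD cvecD e1 e2 (cvec_crossB BE) /an /om /Gn /bn /=.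
  by field.
have vS k : v k.+1 = (2 * h)^-1 *: (xs k.+2 - xs k) by [].
have aS k i : an D c k.+1 i = cvec (xs k.+2) i - 2 * cvec (xs k.+1) i + cvec (xs k) i.
  rewrite -FE -rec cvecZ !cvecD cvecN cvecZ mulrA mulfV ?mul1r//.
  by rewrite expf_neq0.
have wfx k i : sx c k.+1 i = sx c k i + sh c * sv c k i + 2^-1 * an D c k i.
  (* For positive indices this combines the centred difference with the recursion; at index 0 it is
     the prescribed starting value. *)
  case: k => [|k]; last first.
    have e : sv c k.+1 i = (2 * h)^-1 * (cvec (xs k.+2) i - cvec (xs k) i).
      by rewrite /= cvecZ cvecD cvecN.
    by rewrite e aS /=; field.
  have e : v 0%N = v0 by [].
  rewrite /= -FE e xs1 cvecD cvecD cvecZ cvecZ.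
  by move: (cvec (F _ _) i) => f; field.
have hwf : wf D (Cs + 1) cs Cs Mm c.
  split=> //=.
  - rewrite h0 /= leNgt; apply/negP => hC.
    have : h ^+ 2 <= Cs by apply: (le_trans hhi); rewrite ler_piMr// ltW.
    by move=> h2; nra.
  - by rewrite ler_pdivlMr// hlo ler_pdivrMr.
  - by have := HMm tr 0; rewrite mulr1; apply; split=> //; rewrite lexx ltW.
  (* The increment from [k] to [k.+1] is written twice, backwards from [v k.+1] and forwards from
     [v k]; equating the two gives the velocity relation. *)
  - move=> k i.
    have e1 : h * cvec (v k.+1) i - 2^-1 * an D c k.+1 i = cvec (xs k.+1) i - cvec (xs k) i.
      by rewrite aS vS cvecZ cvecD cvecN; field.
    have e2 := wfx k i; rewrite /= in e2.
    transitivity (2 * (h * cvec (v k.+1) i - 2^-1 * an D c k.+1 i) + an D c k.+1 i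
       - 2 * h * cvec (v k) i); first by field.
    by rewrite e1 e2; field.
have lk : linked D tr c.
  split=> //=.
  - by rewrite xs0.
  - rewrite /un /bn /= xs0 /v /=.
    transitivity (sum3 (fun k => bet D k (cvec (x 0)) ^+ 2) *
      dot3 (fun k => bet D k (cvec (x 0))) (cvec (dx 0))).
      by rewrite {1}/dot3 /sum3 !(cvec_Ppar BE eps0); ring.
    by rewrite bet_unit mul1r.
  - move=> i; rewrite /om /bn /= xs0 /v /=; apply/eqP; rewrite mulf_eq0; apply/orP; right.
    by apply/eqP; case: i; rewrite /cross3 !(cvec_Ppar BE eps0); ring.
  - by rewrite divfK.
have [r1 r2 r3] := HC tr c n gd hwf lk nT.
have Ch : 0 <= C * h ^+ 2 by rewrite mulr_ge0// sqr_ge0.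
have fin (z : 'rV[R]_3) : (forall i, `|cvec z i| <= C * h ^+ 2) ->
    enorm z <= (2 * C + 1) * h ^+ 2.
  move=> H; apply: (le_trans (enorm_le Ch H)).
  by rewrite [leRHS]mulrDl mul1r mulrA lerDl sqr_ge0.
split; apply: fin => i.
- by rewrite cvecD cvecN; exact: r1.
- by rewrite cvecD cvecN !(cvec_Ppar BE eps0); exact: r2.
- by rewrite /Pperp cvecD cvecN (cvec_Ppar BE eps0); exact: r3.
Qed.
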